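(* Let $T$ be a semistable unitary operator on $L^2(\mathbb{R})$. If $T$ is (i) translation-invariant, (ii) symmetric, and (iii) locally uniformly continuous (LUC) under dilation, then there exist constants $\alpha,\beta\in\mathbb{R}$ such that $$\widehat{Tf}(\xi)=e^{i\beta|\xi|^\alpha}\hat f(\xi)\quad\text{for a.e. }\xi\in\mathbb{R},\qquad \text{for all } f\in L^2(\mathbb{R}).$$ Moreover, if $T\neq I$ (the identity operator), then the constants $\alpha,\beta$ are uniquely determined by $T$.
   Context: $L^2(\mathbb{R})$ is the space of complex-valued Lebesgue square-integrable functions on $\mathbb{R}$ modulo a.e. equality, and $\mathscr{L}(L^2(\mathbb{R}))$ is the space of bounded linear operators on it. The Fourier transform is the unitary one, $\hat f(\xi)=\frac{1}{\sqrt{2\pi}}\int_{\mathbb{R}} f(x)e^{-i\xi x}\,dx$ (extended to $L^2$ as usual). For $\lambda\in\mathbb{R}\setminus\{0\}$ and $a\in\mathbb{R}$, set $\delta_\lambda f(x)=\frac{1}{|\lambda|}f(x/\lambda)$ and $\tau_a f(x)=f(x-a)$. For $T\in\mathscr{L}(L^2(\mathbb{R}))$ and $\lambda\in\mathbb{R}\setminus\{0\}$, set $T_\lambda=\delta_\lambda\,T\,\delta_{\lambda^{-1}}$. For $R>1$, $L^2_R(\mathbb{R})=\{f\in L^2(\mathbb{R}): \hat f(\xi)=0 \text{ for a.e. }\xi\text{ with }|\xi|<R^{-1}\text{ or }|\xi|>R\}$. Definitions for $T\in\mathscr{L}(L^2(\mathbb{R}))$: - $T$ is semistable if there exist constants $a,b>0$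 such that $T^2=T_a$ and $T^3=T_b$. - $T$ is translation-invariant if $\tau_{-a}T\tau_a=T$ for all $a\in\mathbb{R}$. - $T$ is symmetric if $T_{-1}=T$. - $T$ is locally uniformly continuous (LUC) under dilation if for every $R>1$ the map $\lambda\mapsto T_\lambda|_{L^2_R(\mathbb{R})}$, from $(0,\infty)$ to the bounded operators $L^2_R(\mathbb{R})\to L^2(\mathbb{R})$, is continuous with respect to the operator norm. *)

(* Defs.v *)
From HB Require Import structures.
From mathcomp Require Import all_boot all_order all_algebra.
From mathcomp Require Import generic_quotient ring_quotient.
From mathcomp Require Import complex.
From mathcomp Require Import all_classical all_reals all_analysis.
From mathcomp Require Import measurable_realfun.
From mathcomp Require Import ring lra.

Set Implicit Arguments.
Unset Strict Implicit.
Unset Printing Implicit Defensive.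
Import Order.TTheory GRing.Theory Num.Theory.
Import numFieldNormedType.Exports.
Import Normc.

Local Open Scope classical_set_scope.
Local Open Scope ring_scope.
Local Open Scope complex_scope.
Local Open Scope quotient_scope.

Section L2.
Variable R : realType.
Local Notation mu := (@lebesgue_measure R).
Implicit Types f g : R -> R[i].

(* Measurability is Borel measurability of the real and imaginary parts: every
   Lebesgue measurable function agrees almost everywhere with such a function,
   so the quotient L2 below is the same. *)
Definition cmeasurable f : Prop :=
  measurable_fun setT (fun x => complex.Re (f x)) /\
  measurable_fun setT (fun x => complex.Im (f x)).

Definition eL2norm f : \bar R := ('N[mu]_2%:E[EFin \o (fun x => normc (f x))])%E.

Definition L2pred : {pred R -> R[i]} :=
  [pred f | `[< cmeasurable f /\ (eL2norm f < +oo)%E >]].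

Lemma L2predP f :
  reflect (cmeasurable f /\ (eL2norm f < +oo)%E) (f \in L2pred).
Proof. exact: asboolP. Qed.

Lemma normcE f :
  (fun x => normc (f x)) =
  (fun x => Num.sqrt (complex.Re (f x) ^+ 2 + complex.Im (f x) ^+ 2)).
Proof. by apply/funext => x; case: (f x). Qed.

Lemma normc_ge0 (z : R[i]) : 0 <= normc z.
Proof. by case: z => a b; exact: sqrtr_ge0. Qed.

Lemma cmeasurable_normc f : cmeasurable f ->
  measurable_fun setT (fun x => normc (f x)).
Proof.
move=> [mr mi]; rewrite normcE.
apply: (@measurableT_comp _ _ _ _ _ _ (@Num.sqrt R)).
  by apply: continuous_measurable_fun; exact: sqrt_continuous.
by apply: measurable_funD; exact: measurable_funX.
Qed.

Lemma cmeasurable_lin (c : R[i]) f g :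
  cmeasurable f -> cmeasurable g -> cmeasurable (c *: f + g).
Proof.
move=> [fr fi] [gr gi]; split.
- rewrite (_ : (fun x => _) = (fun x => (complex.Re c * complex.Re (f x)
    - complex.Im c * complex.Im (f x)) + complex.Re (g x))); last first.
    by apply/funext => x; rewrite !fctE; case: c (f x) (g x) => ? ? [? ?] [? ?].
  apply: measurable_funD => //.
  by apply: measurable_funB; exact: measurable_funM.
- rewrite (_ : (fun x => _) = (fun x => (complex.Re c * complex.Im (f x)
    + complex.Im c * complex.Re (f x)) + complex.Im (g x))); last first.
    by apply/funext => x; rewrite !fctE; case: c (f x) (g x) => ? ? [? ?] [? ?].
  apply: measurable_funD => //.
  by apply: measurable_funD; exact: measurable_funM.
Qed.

Lemma le_eL2norm f (h : R -> R) : cmeasurable f -> measurable_fun setT h ->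
  (forall x, normc (f x) <= h x) -> (eL2norm f <= 'N[mu]_2%:E[EFin \o h])%E.
Proof.
move=> mf mh fh; rewrite /eL2norm unlock.
have mn (k : R -> R) : measurable_fun setT k ->
    measurable_fun setT (fun x => (`|k x| `^ 2)%:E).
  move=> mk; apply/measurable_EFinP.
  by apply: (@measurableT_comp _ _ _ _ _ _ (@powR R ^~ 2)) => //;
    exact: measurableT_comp.
apply: gt0_ler_poweR; rewrite ?invr_ge0 ?in_itv/= ?leey ?andbT//.
- by apply: integral_ge0 => x _; rewrite lee_fin powR_ge0.
- by apply: integral_ge0 => x _; rewrite lee_fin powR_ge0.
apply: ge0_le_integral => //.
- exact: (mn _ (cmeasurable_normc mf)).
- exact: (mn _ mh).
- move=> x _; rewrite lee_fin ge0_ler_powR ?nnegrE//.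
  by rewrite ger0_norm ?normc_ge0// (le_trans (fh x))// ler_norm.
Qed.

Lemma L2pred_submod_closed : submod_closed L2pred.
Proof.
split.
  apply/L2predP; split.
    by split; exact: measurable_cst.
  rewrite /eL2norm (_ : EFin \o _ = cst 0%E) ?Lnorm0//.
  by apply/funext => x /=; rewrite expr0n/= addr0 sqrtr0.
move=> c f g /L2predP[mf lf] /L2predP[mg lg]; apply/L2predP.
have mfg := cmeasurable_lin c mf mg; split => //.
have mnf := cmeasurable_normc mf; have mng := cmeasurable_normc mg.
have mcf : measurable_fun setT (normc c \o* (fun x => normc (f x))).
  exact: measurable_funM.
apply: (@le_lt_trans _ _
  ('N[mu]_2%:E[EFin \o (normc c \o* (fun x => normc (f x))
                        \+ (fun x => normc (g x)))%R])%E).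
  apply: le_eL2norm => //; first exact: measurable_funD.
  by move=> x; rewrite !fctE (le_trans (le_normcD _ _))// lerD2r normcM mulrC.
have := @minkowski_EFin _ _ R mu _ _ 2 mcf mng (ler1n _ 2).
move=> /le_lt_trans; apply.
rewrite lte_add_pinfty//.
have : (fun x => normc (f x)) \in Lfun mu 2%:E.
  by rewrite inE; apply/andP; split; rewrite inE.
move=> /(Lfun_scale (normc c)) -/(_ (ler1n _ _)).
by rewrite inE => /andP[_]; rewrite inE.
Qed.

HB.instance Definition _ :=
  GRing.isSubmodClosed.Build R[i] (R -> R[i]) L2pred L2pred_submod_closed.

Record L2fun := MkL2fun { L2fun_val :> R -> R[i]; _ : L2fun_val \in L2pred }.

HB.instance Definition _ := [isSub for L2fun_val].
HB.instance Definition _ := [Choice of L2fun by <:].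
HB.instance Definition _ := [SubChoice_isSubLmodule of L2fun by <:].

Definition L2null : {pred L2fun} :=
  [pred f : L2fun | `[< \forall x \ae mu, f x = 0 >]].

Lemma L2null_submod_closed : submod_closed L2null.
Proof.
split; first by apply/asboolP/aeW.
move=> c f g /asboolP f0 /asboolP g0; apply/asboolP.
have aeF : Filter (nbhs (almost_everywhere mu)).
  exact: ae_filter_ringOfSetsType.
move: f0 g0; apply: filterS2 => x /= fx gx.
by rewrite !fctE fx gx scaler0 addr0.
Qed.

HB.instance Definition _ :=
  GRing.isSubmodClosed.Build R[i] L2fun L2null L2null_submod_closed.

Definition L2 : Type := Quotient.quot L2null.
HB.instance Definition _ := EqQuotient.on L2.
HB.instance Definition _ := GRing.Zmodule.on L2.

Lemma L2_eqP (f g : L2fun) :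
  (\pi_L2 f = \pi_L2 g) <-> (\forall x \ae mu, f x = g x).
Proof.
have E : (f == g %[mod L2]) = `[< \forall x \ae mu, (f - g) x = 0 >].
  by rewrite -[L2]/(Quotient.quot L2null) -Quotient.idealrBE.
have aeF : Filter (nbhs (almost_everywhere mu)).
  exact: ae_filter_ringOfSetsType.
split.
  move=> /eqP; rewrite E => /asboolP; apply: filterS => x /eqP.
  by rewrite subr_eq0 => /eqP.
move=> fg; apply/eqP; rewrite E; apply/asboolP; move: fg.
by apply: filterS => x fgx; apply/eqP; rewrite subr_eq0; apply/eqP.
Qed.

Definition L2scale (c : R[i]) : L2 -> L2 := lift_op1 L2 ( *:%R c).

Lemma pi_L2scale c : {morph \pi_L2 : f / c *: f >-> L2scale c f}.
Proof.
move=> f; unlock L2scale; apply/eqP.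
rewrite -[L2]/(Quotient.quot L2null) -Quotient.idealrBE -scalerBr rpredZ//.
by rewrite Quotient.idealrBE reprK.
Qed.
Canonical pi_L2scale_morph c := PiMorph1 (pi_L2scale c).

Lemma L2scaleA a b v : L2scale a (L2scale b v) = L2scale (a * b) v.
Proof. by rewrite -[v]reprK !piE scalerA. Qed.

Lemma L2scale1 : left_id 1 L2scale.
Proof. by move=> v; rewrite -[v]reprK !piE scale1r. Qed.

Lemma L2scaleDr : right_distributive L2scale +%R.
Proof.
by move=> a u v; rewrite -[u]reprK -[v]reprK !piE scalerDr.
Qed.

Lemma L2scaleDl v : {morph L2scale^~ v : a b / a + b}.
Proof. by move=> a b /=; rewrite -[v]reprK !piE scalerDl. Qed.

HB.instance Definition _ := GRing.Zmodule_isLmodule.Build R[i] L2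
  L2scaleA L2scale1 L2scaleDr L2scaleDl.

Definition L2_repr (f : L2) : R -> R[i] := repr f.

(* The class of f; its value is 0 (junk) when f is not square-integrable. *)
Definition toL2 f : L2 := \pi_L2 (insubd (0 : L2fun) f).
End L2.
Coercion L2_repr : L2 >-> Funclass.

Section affine_substitution.
Variable R : realType.
Local Notation mu := (@lebesgue_measure R).
Variables (s b : R).
Hypothesis s0 : s != 0.
Let phi : R -> measurableTypeR R := fun x => s * x + b.

Let mphi : measurable_fun setT phi.
Proof. by apply: measurable_funD => //; exact: measurable_funM. Qed.

Lemma lebesgue_measure_affine (A : set R) : measurable A ->
  pushforward mu phi A = (`|s|^-1%:E * mu A)%E.
Proof.
move=> mA.
have n0 : (0 <= `|s|) by [].
have H : forall X, ocitv X -> mu X = mscale (NngNum n0) (pushforward mu phi) X.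
  move=> mphi0 X; rewrite /ocitv /= => -[[x y] _ <-]; rewrite /mscale/= /pushforward.
  have [sp|sn] := ltP 0 s.
    rewrite (_ : phi @^-1` `]x, y] = `](x - b) / s, (y - b) / s]%classic); last first.
      apply/seteqP; split=> z; rewrite /phi/= !in_itv/=;
        by rewrite ltr_pdivrMr// ler_pdivlMr// ltrBlDr lerBrDr mulrC.
    rewrite !lebesgue_measure_itv/= !lte_fin ltr_pM2r ?invr_gt0// ltrD2r.
    case: ifPn => _; last by rewrite mule0.
    rewrite -!EFinB -EFinM gtr0_norm//; congr EFin.
    by field.
  have sl : s < 0 by rewrite lt_neqAle s0.
  rewrite (_ : phi @^-1` `]x, y] = `[(y - b) / s, (x - b) / s[%classic); last first.
    apply/seteqP; split=> z; rewrite /phi/= !in_itv/=;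
      by rewrite ler_ndivrMr// ltr_ndivlMr// ltrBlDr lerBrDr mulrC andbC.
  rewrite !lebesgue_measure_itv/= !lte_fin ltr_nM2r ?invr_lt0// ltrD2r.
  case: ifPn => _; last by rewrite mule0.
  rewrite -!EFinB -EFinM ltr0_norm//; congr EFin.
  by field.
have := lebesgue_measure_unique (H mphi) mA.
rewrite /mscale/= => ->.
by rewrite muleA -EFinM mulVf ?mul1e// normr_eq0.
Qed.

Lemma ae_affine (P : R -> Prop) :
  (\forall x \ae mu, P x) -> \forall x \ae mu, P (s * x + b).
Proof.
move=> [N [mN N0 PN]]; exists (phi @^-1` N); split.
- by rewrite -[_ @^-1` _]setTI; exact: mphi.
- by have := lebesgue_measure_affine mN; rewrite /pushforward N0 mule0.
- by move=> x nPx; apply: (PN (phi x)).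
Qed.

Lemma L2pred_affine (f : R -> R[i]) :
  f \in @L2pred R -> (fun x => f (s * x + b)) \in @L2pred R.
Proof.
move=> /L2predP[mf lf]; apply/L2predP.
have mfphi : cmeasurable (fun x => f (s * x + b)).
  case: mf => mr mi; split.
  - exact: (measurableT_comp mr mphi).
  - exact: (measurableT_comp mi mphi).
split => //.
have mh : measurable_fun setT (fun x => (`|normc (f x)| `^ 2)%:E).
  apply/measurable_EFinP.
  apply: (@measurableT_comp _ _ _ _ _ _ (@powR R ^~ 2)) => //.
  by apply: measurableT_comp => //; exact: cmeasurable_normc.
have n0 : 0 <= `|s|^-1 by rewrite invr_ge0.
have E : (\int[mu]_x (`|normc (f (s * x + b))| `^ 2)%:E =
    `|s|^-1%:E * \int[mu]_x (`|normc (f x)| `^ 2)%:E)%E.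
  transitivity (\int[pushforward mu phi]_x (`|normc (f x)| `^ 2)%:E)%E.
    by rewrite ge0_integral_pushforward.
  transitivity (\int[mscale (NngNum n0) mu]_x (`|normc (f x)| `^ 2)%:E)%E.
    by apply: eq_measure_integral => B mB _; exact: lebesgue_measure_affine.
  by rewrite ge0_integral_mscale// => x _; rewrite lee_fin powR_ge0.
move: lf; rewrite /eL2norm unlock => /(lty_poweRy _) lf.
rewrite poweR_lty//= E lte_mul_pinfty ?lee_fin//.
by apply: lf; rewrite invr_neq0.
Qed.
End affine_substitution.

Section operators.
Variable R : realType.
Local Notation mu := (@lebesgue_measure R).
Local Notation L2 := (L2 R).
Implicit Types (f g : L2) (T : L2 -> L2).

Lemma toL2E (u : R -> R[i]) :
  u \in @L2pred R -> \forall x \ae mu, toL2 u x = u x.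
Proof.
move=> uL; have : \pi_L2 (repr (toL2 u)) = \pi_L2 (insubd (0 : L2fun R) u).
  by rewrite reprK.
move/L2_eqP; have aeF : Filter (nbhs (almost_everywhere mu)).
  exact: ae_filter_ringOfSetsType.
by apply: filterS => x; rewrite /L2_repr => ->; rewrite val_insubd uL.
Qed.

Definition L2norm f : R := fine (eL2norm f).

Definition cintegral (D : set R) (u : R -> R[i]) : R[i] :=
  (\int[mu]_(x in D) complex.Re (u x)) +i* (\int[mu]_(x in D) complex.Im (u x)).

Definition inner f g : R[i] := cintegral setT (fun x => f x * (g x)^*).

Definition cexpi (t : R) : R[i] := cos t +i* sin t.

Definition fourier_trunc f (n : nat) (xi : R) : R[i] :=
  (Num.sqrt (2 * trigo.pi))^-1%:C *
  cintegral `[- n%:R, n%:R] (fun x => f x * cexpi (- (xi * x))).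

(* g is the limit in L2 of the transforms of the truncations of f to [-n, n],
   which are both integrable and square-integrable. By Plancherel's theorem
   this limit exists and is unique in L2, so that the default value 0 in
   [fourier] is never used as junk. *)
Definition is_fourier f g : Prop :=
  eL2norm (fun xi => fourier_trunc f n xi - g xi) @[n --> \oo] --> 0%E.

Definition fourier f : L2 := xget 0 [set g | is_fourier f g].

(* Only meaningful for lam != 0: see [dilateE]. *)
Definition dilate (lam : R) f : L2 :=
  toL2 (fun x => `|lam|^-1%:C * f (x / lam)).

Definition translate (a : R) f : L2 := toL2 (fun x => f (x - a)).

Lemma dilateE lam f : lam != 0 ->
  \forall x \ae mu, dilate lam f x = `|lam|^-1%:C * f (x / lam).
Proof.
move=> lam0; apply: toL2E.
rewrite (_ : (fun x => _) =
  `|lam|^-1%:C *: (fun x => f (lam^-1 * x + 0))); last first.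
  by apply/funext => x; rewrite !fctE addr0 (mulrC lam^-1).
rewrite rpredZ// L2pred_affine ?invr_neq0//; exact: (valP (repr f)).
Qed.

Lemma translateE a f : \forall x \ae mu, translate a f x = f (x - a).
Proof.
apply: toL2E; rewrite (_ : (fun x => _) = (fun x => f (1 * x + - a))).
  by rewrite L2pred_affine ?oner_neq0//; exact: (valP (repr f)).
by apply/funext => x; rewrite mul1r.
Qed.

Definition dilate_op (lam : R) T : L2 -> L2 := dilate lam \o T \o dilate lam^-1.

Definition bounded_op T : Prop :=
  exists M : R, forall f, L2norm (T f) <= M * L2norm f.

Definition unitary_op T : Prop :=
  (forall f g, inner (T f) (T g) = inner f g) /\ (forall g, exists f, T f = g).

Definition semistable T : Prop :=
  exists a b : R, [/\ 0 < a, 0 < b,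
    T \o T = dilate_op a T & T \o T \o T = dilate_op b T].

Definition translation_invariant T : Prop :=
  forall a : R, translate (- a) \o T \o translate a = T.

Definition symmetric_op T : Prop := dilate_op (-1) T = T.

Definition L2band (r : R) : set L2 :=
  [set f | \forall xi \ae mu, `|xi| < r^-1 \/ r < `|xi| -> fourier f xi = 0].

(* Operator norm of the restriction of T to V. *)
Definition opnorm_on (V : set L2) T : \bar R :=
  ereal_sup [set (L2norm (T f))%:E | f in [set f | V f /\ L2norm f <= 1]].

Definition LUC T : Prop :=
  forall r : R, 1 < r -> forall lam0 : R, 0 < lam0 ->
    opnorm_on (L2band r) (fun f => dilate_op lam T f - dilate_op lam0 T f)
      @[lam --> lam0] --> 0%E.

Definition has_multiplier T (alpha beta : R) : Prop :=
  forall f, \forall xi \ae mu,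
    fourier (T f) xi = cexpi (beta * `|xi| `^ alpha) * fourier f xi.
End operators.

(* Main.v *)
(* Since T is unitary and commutes with translations, the Parseval identity
   gives (Tf)^ conj (Tg)^ = f^ conj g^ a.e.; taking g with g^ > 0 shows that T
   is multiplication by a unimodular m on the Fourier side, and semistability
   and symmetry become m (a x) = m(x)^2, m (b x) = m(x)^3 and m (- x) = m x.
   The LUC condition at dilation 1, tested on indicators of intervals, says that
   the averages of |m (lam x) - m x|^2 over all intervals of [1/r, r] are
   uniformly small, which at Lebesgue points makes m uniformly continuous; so m
   is a.e. equal to a continuous function on (0, oo).  Lifting t |-> m (e^t) to
   a continuous phase, suitably normalised by a constant, turns the equations
   into phi (t + ln a) = 2 phi t and phi (t + ln b) = 3 phi t.  Unless phi = 0,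
   dividing phi by e^(alpha t), alpha = ln 2 / ln a, leaves a bounded continuous
   function with periods ln a and ln b, whose ratio ln 2 / ln 3 is irrational:
   it is constant.  The Plancherel theory behind this rests on the Abel
   regularisation e^(- e |x|), whose Fourier transform is the Poisson kernel. *)
Require Import Defs.
From mathcomp Require Import all_boot all_order all_algebra.
From mathcomp Require Import complex generic_quotient.
From mathcomp Require Import all_classical all_reals all_analysis.
From mathcomp Require Import measurable_realfun.
From mathcomp Require Import ring lra.

Set Implicit Arguments.
Unset Strict Implicit.
Unset Printing Implicit Defensive.
Import Order.TTheory GRing.Theory Num.Theory.
Import numFieldNormedType.Exports.
Import Normc.

Local Open Scope classical_set_scope.
Local Open Scope ring_scope.
Local Open Scope complex_scope.
Local Open Scope quotient_scope.

(** Elements of [L2] are classes and [fourier] is selected by a choice operator, so the transform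
    theory is carried out for functions, through the relation [is_FT], and reaches [L2] only through
    [fourierP]. Complex integrals are taken by real and imaginary parts, which costs a factor 2 in
    norm estimates; only boundedness and limits are drawn from those estimates. Intervals serve as
    test functions because the Poisson integral of an indicator is an explicit difference of
    arctangents, so that weak inversion reduces to dominated convergence. On the multiplier side
    everything is known only almost everywhere, while lifting to a phase needs genuine continuity
    and equations valid at every point of (0, oo); the passage is made separately for the real and
    imaginary parts, each a bounded real function. A phase is determined only modulo 2 pi, both in
    existence and in uniqueness: in each case a continuous function with values in the multiples of
    2 pi is shown to be constant, and the constant is then handled algebraically. *)

Local Notation "z ^*" := (conjc z) : ring_scope.

(** * Fubini and affine substitution for real integrals *)

Section real_fubini.
Variable R : realType.
Local Notation mu := (@lebesgue_measure R).
Local Notation RT := (measurableTypeR R).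
Local Notation rI f := (mu.-integrable setT (EFin \o f)).

Lemma integrable_dom (f g : R -> R) :
  measurable_fun setT f -> rI g -> (forall x, `|f x| <= g x) -> rI f.
Proof.
move=> mf ig fg; apply: (le_integrable _ _ _ ig) => //.
  exact/measurable_EFinP.
by move=> x _ /=; rewrite lee_fin (le_trans (fg x))// ler_norm.
Qed.

Lemma integrableMl_EFin (c : R) (f : R -> R) : rI f -> rI (fun x => c * f x).
Proof.
by move=> /(integrableZl measurableT c); apply: eq_integrable.
Qed.

Lemma integrable_measurable (f : R -> R) : rI f -> measurable_fun setT f.
Proof. by move/measurable_int/measurable_EFinP. Qed.

Section separated_bound.
Variables (h : RT * RT -> RT) (a b : R -> R).
Hypothesis mh : measurable_fun setT h.
Hypothesis ia : rI a.
Hypothesis ib : rI b.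
Hypothesis hab : forall x y, `|h (x, y)| <= a x * b y.

Let mh1 x : measurable_fun setT (fun y => h (x, y)).
Proof. exact: measurableT_comp mh (measurable_pair1 _). Qed.

Let mh2 y : measurable_fun setT (fun x => h (x, y)).
Proof. exact: measurableT_comp mh (measurable_pair2 _). Qed.

(** The product bound holds pointwise, so every slice is integrable and not just almost every one;
    the real-valued iterated integrals are then never the [fine] of an infinite value. *)
Lemma sep_integrable1 x : rI (fun y => h (x, y)).
Proof.
apply: (integrable_dom (g := fun y => a x * b y)) (mh1 x) _ _ => //.
exact: integrableMl_EFin.
Qed.

Lemma sep_integrable2 y : rI (fun x => h (x, y)).
Proof.
apply: (integrable_dom (g := fun x => b y * a x)) (mh2 y) _ _.
  exact: integrableMl_EFin.
by move=> x; rewrite mulrC.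
Qed.

Lemma sep_integrable : (mu \x mu)%E.-integrable setT (EFin \o h).
Proof.
have mh' : measurable_fun setT (fun z => (`|h z|%:E)).
  by apply/measurable_EFinP; exact: measurableT_comp.
have fb : (\int[mu]_y `|b y|%:E \is a fin_num)%E.
  rewrite ge0_fin_numE; last exact: integral_ge0.
  by case/integrableP : ib.
apply/integrable12ltyP; first exact/measurable_EFinP.
apply: (@le_lt_trans _ _ (\int[mu]_x (`|a x|%:E * \int[mu]_y `|b y|%:E))%E).
  apply: ge0_le_integral => //.
  - by move=> x _; exact: integral_ge0.
  - exact: (measurable_fun_fubini_tonelli_F (fun z => `|h z|%:E)).
  - rewrite -(fineK fb); apply/measurable_EFinP; apply: measurable_funM => //.
    by apply: measurableT_comp => //; exact: integrable_measurable.
  - move=> x ?; rewrite -ge0_integralZl//; last first.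
      apply/measurable_EFinP; apply: measurableT_comp => //.
      exact: integrable_measurable.
    apply: ge0_le_integral => //.
    + by apply/measurable_EFinP; apply: measurableT_comp.
    + apply/measurable_EFinP; apply: measurable_funM => //.
      by apply: measurableT_comp => //; exact: integrable_measurable.
    + move=> y _; rewrite -EFinM lee_fin (le_trans (hab x y))//.
      by rewrite -normrM ler_norm.
rewrite ge0_integralZr//.
- rewrite lte_mul_pinfty//; last by rewrite -ge0_fin_numE// integral_ge0.
    exact: integral_ge0.
  rewrite ge0_fin_numE; last exact: integral_ge0.
  by case/integrableP : ia.
- apply/measurable_EFinP; apply: measurableT_comp => //.
  exact: integrable_measurable.
- exact: integral_ge0.
Qed.

Lemma sep_Rintegral_integrable : rI (fun x => \int[mu]_y h (x, y)).
Proof.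
have := integrable_fubini_F sep_integrable; apply: eq_integrable => // x _.
by rewrite /fubini_F /Rintegral/= fineK//; apply: integrable_fin_num => //;
  exact: sep_integrable1.
Qed.

Lemma sep_Fubini :
  \int[mu]_x \int[mu]_y h (x, y) = \int[mu]_y \int[mu]_x h (x, y).
Proof.
rewrite /Rintegral; congr fine.
have := Fubini sep_integrable; move=> /= H; etransitivity; last (etransitivity; [exact: H|]).
- apply: eq_integral => x _; rewrite fineK//; apply: integrable_fin_num => //.
  exact: sep_integrable1.
- apply: eq_integral => x _; rewrite fineK//; apply: integrable_fin_num => //.
  exact: sep_integrable2.
Qed.

End separated_bound.

(** For a nonnegative integrand the formula is the change of measure [lebesgue_measure_affine]; a
    signed one is split into its positive and negative parts, whose integrals are both finite. *)
Lemma Rintegral_affine (f : R -> R) (s b : R) : s != 0 -> rI f ->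
  rI (fun x => f (s * x + b)) /\
  \int[mu]_x f (s * x + b) = `|s|^-1 * \int[mu]_x f x.
Proof.
move=> s0 If.
pose phi : R -> RT := fun x => s * x + b.
have mphi : measurable_fun setT phi.
  by apply: measurable_funD => //; exact: measurable_funM.
have n0 : 0 <= `|s|^-1 by rewrite invr_ge0.
have mf := integrable_measurable If.
have mscaleE B : measurable B ->
    pushforward mu phi B = mscale (NngNum n0) mu B.
  by move=> mB; exact: lebesgue_measure_affine.
have Ig (g : R -> \bar R) : measurable_fun setT g -> (forall x, 0 <= g x)%E ->
    (\int[mu]_x g (s * x + b)%R = `|s|^-1%:E * \int[mu]_x g x)%E.
  move=> mg g0.
  transitivity (\int[pushforward mu phi]_x g x)%E.
    by rewrite ge0_integral_pushforward.
  transitivity (\int[mscale (NngNum n0) mu]_x g x)%E.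
    by apply: eq_measure_integral => B mB _; exact: mscaleE.
  by rewrite ge0_integral_mscale.
have mfphi : measurable_fun setT (fun x => f (s * x + b)).
  exact: (measurableT_comp mf mphi).
have If' : rI (fun x => f (s * x + b)).
  apply/integrableP; split; first exact/measurable_EFinP.
  rewrite (Ig (fun x => `|f x|%:E))//.
    by rewrite lte_mul_pinfty//; case/integrableP : If.
  by apply/measurable_EFinP; exact: measurableT_comp.
split=> //.
rewrite /Rintegral integralE/=.
have fpE : (fun x => (f (s * x + b))%:E)^\+%E =
    (fun x => ((EFin \o f)^\+)%E (s * x + b)).
  by apply/funext => x; rewrite !funeposE.
have fnE : (fun x => (f (s * x + b))%:E)^\-%E =
    (fun x => ((EFin \o f)^\-)%E (s * x + b)).
  by apply/funext => x; rewrite !funenegE.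
have mp : measurable_fun setT ((EFin \o f)^\+)%E.
  by apply: measurable_funepos; exact/measurable_EFinP.
have mn : measurable_fun setT ((EFin \o f)^\-)%E.
  by apply: measurable_funeneg; exact/measurable_EFinP.
rewrite fpE fnE !Ig//.

rewrite -muleBr//; last first.
  apply: (@fin_num_adde_defl _ _ _); rewrite ?fin_numN; exact: integrable_neg_fin_num.
rewrite -integralE fineM//.
exact: integrable_fin_num.
Qed.

End real_fubini.

(** * Real and imaginary parts, moduli and [cexpi] *)

Section complex_facts.
Variable R : realType.
Implicit Types (z w : R[i]) (t : R).
Local Notation Re := complex.Re.
Local Notation Im := complex.Im.

Lemma complexP z w : Re z = Re w -> Im z = Im w -> z = w.
Proof. by case: z => a b; case: w => c d /= -> ->. Qed.

Lemma cReD z w : Re (z + w) = Re z + Re w. Proof. by case: z; case: w. Qed.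
Lemma cImD z w : Im (z + w) = Im z + Im w. Proof. by case: z; case: w. Qed.
Lemma cReN z : Re (- z) = - Re z. Proof. by case: z. Qed.
Lemma cImN z : Im (- z) = - Im z. Proof. by case: z. Qed.
Lemma cReM z w : Re (z * w) = Re z * Re w - Im z * Im w.
Proof. by case: z; case: w. Qed.
Lemma cImM z w : Im (z * w) = Re z * Im w + Im z * Re w.
Proof. by case: z => a b; case: w => c d /=; rewrite addrC. Qed.
Lemma cReJ z : Re z^* = Re z. Proof. by case: z. Qed.
Lemma cImJ z : Im z^* = - Im z. Proof. by case: z. Qed.
Lemma cRe0 : Re (0 : R[i]) = 0. Proof. by []. Qed.
Lemma cIm0 : Im (0 : R[i]) = 0. Proof. by []. Qed.
Lemma cRe1 : Re (1 : R[i]) = 1. Proof. by []. Qed.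
Lemma cIm1 : Im (1 : R[i]) = 0. Proof. by []. Qed.
Lemma cReE t : Re (cexpi t) = cos t. Proof. by []. Qed.
Lemma cImE t : Im (cexpi t) = sin t. Proof. by []. Qed.
Lemma cReC t : Re t%:C = t. Proof. by []. Qed.
Lemma cImC t : Im t%:C = 0. Proof. by []. Qed.

(** Turns an identity in R[i] into two real identities within reach of [ring], conjugates and
    exponentials included. *)
Definition ReImE := (cReD, cImD, cReN, cImN, cReM, cImM, cReJ, cImJ, cReE, cImE, cReC,
  cImC, cRe0, cIm0, cRe1, cIm1).

Lemma normc2E z : normc z ^+ 2 = Re z ^+ 2 + Im z ^+ 2.
Proof. by case: z => a b; rewrite sqr_sqrtr// addr_ge0// sqr_ge0. Qed.

Lemma normc_Re z : `|Re z| <= normc z.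
Proof.
by case: z => a b /=; rewrite -sqrtr_sqr ler_wsqrtr// lerDl sqr_ge0.
Qed.

Lemma normc_Im z : `|Im z| <= normc z.
Proof.
by case: z => a b /=; rewrite -sqrtr_sqr ler_wsqrtr// lerDr sqr_ge0.
Qed.

Lemma normc_le z : normc z <= `|Re z| + `|Im z|.
Proof.
rewrite -(@ler_pXn2r _ 2)// ?nnegrE ?normc_ge0 ?addr_ge0// normc2E.
rewrite sqrrD !real_normK ?num_real//.
by rewrite -addrA lerD2l lerDr mulrn_wge0// mulr_ge0.
Qed.

Lemma normc_conj z : normc z^* = normc z.
Proof. by case: z => a b /=; rewrite sqrrN. Qed.

Lemma normc_cexpi t : normc (cexpi t) = 1.
Proof. by rewrite /= cos2Dsin2 sqrtr1. Qed.

Lemma normcC t : normc t%:C = `|t|.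
Proof. by rewrite /= expr0n/= addr0 sqrtr_sqr. Qed.

Lemma mulcJ z : z * z^* = (normc z ^+ 2)%:C.
Proof. by apply: complexP; rewrite !ReImE ?normc2E; ring. Qed.

Lemma cexpiD s t : cexpi (s + t) = cexpi s * cexpi t.
Proof. by apply: complexP; rewrite !ReImE ?cosD ?sinD; ring. Qed.

Lemma cexpi0 : cexpi (0 : R) = 1.
Proof. by rewrite /cexpi cos0 sin0. Qed.

Lemma cexpiJ t : (cexpi t)^* = cexpi (- t).
Proof. by apply: complexP; rewrite !ReImE ?cosN ?sinN. Qed.

Lemma conj_mul z w : (z * w)^* = z^* * w^*.
Proof. by apply: complexP; rewrite !ReImE; ring. Qed.

Lemma conj_real t : (t%:C)^* = t%:C.
Proof. by apply: complexP; rewrite !ReImE; ring. Qed.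

Lemma conj_invol z : (z^*)^* = z.
Proof. by apply: complexP; rewrite !ReImE; ring. Qed.

Lemma cexpiMn t n : cexpi (t *+ n) = cexpi t ^+ n.
Proof.
by elim: n => [|n IHn]; rewrite ?mulr0n ?cexpi0 ?expr0// mulrS cexpiD IHn exprS.
Qed.

End complex_facts.

(** * Measurability of complex functions *)

Section complex_measurable.
Variable R : realType.
Local Notation Re := complex.Re.
Local Notation Im := complex.Im.
Context d (T : measurableType d).
Implicit Types u v : T -> R[i].

(** [cmeasurable] over an arbitrary measurable type, since kernels live on the plane. *)
Definition cmeas u :=
  measurable_fun setT (fun x => Re (u x)) /\
  measurable_fun setT (fun x => Im (u x)).

Lemma cmeasD u v : cmeas u -> cmeas v -> cmeas (fun x => u x + v x).
Proof.
move=> [ur ui] [vr vi]; split.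
- by under eq_fun do rewrite ReImE; exact: measurable_funD.
- by under eq_fun do rewrite ReImE; exact: measurable_funD.
Qed.

Lemma cmeasN u : cmeas u -> cmeas (fun x => - u x).
Proof.
move=> [ur ui]; split.
- by under eq_fun do rewrite ReImE; exact: measurableT_comp.
- by under eq_fun do rewrite ReImE; exact: measurableT_comp.
Qed.

Lemma cmeasB u v : cmeas u -> cmeas v -> cmeas (fun x => u x - v x).
Proof. by move=> mu mv; apply: cmeasD => //; exact: cmeasN. Qed.

Lemma cmeasM u v : cmeas u -> cmeas v -> cmeas (fun x => u x * v x).
Proof.
move=> [ur ui] [vr vi]; split.
- under eq_fun do rewrite ReImE.
  by apply: measurable_funB; exact: measurable_funM.
- under eq_fun do rewrite ReImE.
  by apply: measurable_funD; exact: measurable_funM.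
Qed.

Lemma cmeasJ u : cmeas u -> cmeas (fun x => (u x)^*).
Proof.
move=> [ur ui]; split.
- by under eq_fun do rewrite ReImE.
- by under eq_fun do rewrite ReImE; exact: measurableT_comp.
Qed.

Lemma cmeas_cst (c : R[i]) : cmeas (fun=> c).
Proof. by split; exact: measurable_cst. Qed.

Lemma cmeasC (f : T -> R) : measurable_fun setT f -> cmeas (fun x => (f x)%:C).
Proof. by move=> mf; split => //; exact: measurable_cst. Qed.

Lemma cmeas_cexpi (f : T -> R) :
  measurable_fun setT f -> cmeas (fun x => cexpi (f x)).
Proof.
move=> mf; split.
- apply: measurableT_comp mf.
  by apply: continuous_measurable_fun; exact: continuous_cos.
- apply: measurableT_comp mf.
  by apply: continuous_measurable_fun; exact: continuous_sin.
Qed.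

Lemma cmeas_normc u : cmeas u -> measurable_fun setT (fun x => normc (u x)).
Proof.
move=> [ur ui].
rewrite (_ : (fun x => _) = (fun x => Num.sqrt (Re (u x) ^+ 2 + Im (u x) ^+ 2))).
  apply: (@measurableT_comp _ _ _ _ _ _ (@Num.sqrt R)).
    by apply: continuous_measurable_fun; exact: sqrt_continuous.
  by apply: measurable_funD; exact: measurable_funX.
by apply/funext => x; case: (u x).
Qed.

End complex_measurable.

Lemma cmeas_comp (R : realType) d1 d2 (T1 : measurableType d1)
    (T2 : measurableType d2) (u : T2 -> R[i]) (phi : T1 -> T2) :
  measurable_fun setT phi -> cmeas u -> cmeas (u \o phi).
Proof.
by move=> mp [ur ui]; split; [exact: (measurableT_comp ur)|
  exact: (measurableT_comp ui)].
Qed.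

(** * Integrals of complex functions *)

Section complex_integral.
Variable R : realType.
Local Notation mu := (@lebesgue_measure R).
Local Notation RT := (measurableTypeR R).
Local Notation rI f := (mu.-integrable setT (EFin \o f)).
Local Notation Re := complex.Re.
Local Notation Im := complex.Im.
Implicit Types u v : R -> R[i].

Definition cint u : R[i] := cintegral setT u.

Definition cintegrable u :=
  rI (fun x => Re (u x)) /\ rI (fun x => Im (u x)).

Lemma Re_cint u : Re (cint u) = \int[mu]_x Re (u x). Proof. by []. Qed.
Lemma Im_cint u : Im (cint u) = \int[mu]_x Im (u x). Proof. by []. Qed.

Lemma cintegrable_cmeas u : cintegrable u -> cmeas (u : RT -> _).
Proof. by move=> [/integrable_measurable ? /integrable_measurable ?]. Qed.

Lemma cintegrable_dom u (g : R -> R) : cmeas (u : RT -> _) -> rI g ->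
  (forall x, normc (u x) <= g x) -> cintegrable u.
Proof.
move=> [mr mi] ig ug; split; apply: integrable_dom ig _ => // x;
  by rewrite (le_trans _ (ug x))// ?normc_Re ?normc_Im.
Qed.

Lemma integrableD_EFin (f g : R -> R) : rI f -> rI g ->
  rI (fun x => f x + g x).
Proof. by move=> fi gi; have := integrableD measurableT fi gi; apply: eq_integrable. Qed.

Lemma cintegrable_normc u : cintegrable u -> rI (fun x => normc (u x)).
Proof.
move=> iu; have [ir ii] := iu.
apply: (integrable_dom (g := fun x => `|Re (u x)| + `|Im (u x)|)).
- by apply: cmeas_normc; exact: cintegrable_cmeas.
- by apply: integrableD_EFin; exact: integrable_norm.
- by move=> x; rewrite ger0_norm ?normc_ge0// normc_le.
Qed.

Lemma cintegrableD u v : cintegrable u -> cintegrable v ->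
  cintegrable (fun x => u x + v x).
Proof.
by move=> [ur ui] [vr vi]; split; [move: (integrableD_EFin ur vr)|
  move: (integrableD_EFin ui vi)]; apply: eq_integrable => // x _ /=;
  rewrite ReImE.
Qed.

Lemma cintegrableZ (c : R[i]) u : cintegrable u ->
  cintegrable (fun x => c * u x).
Proof.
move=> iu; apply: (cintegrable_dom (g := fun x => normc c * normc (u x))).
- by apply: cmeasM; [exact: cmeas_cst|exact: cintegrable_cmeas].
- by apply: integrableMl_EFin; exact: cintegrable_normc.
- by move=> x; rewrite normcM.
Qed.

Lemma cintegrableN u : cintegrable u -> cintegrable (fun x => - u x).
Proof.
move=> /(cintegrableZ (-1)).
by rewrite (_ : (fun x => -1 * u x) = fun x => - u x)//; apply/funext => x;
  rewrite mulN1r.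
Qed.

Lemma cintegrableB u v : cintegrable u -> cintegrable v ->
  cintegrable (fun x => u x - v x).
Proof. by move=> iu iv; apply: cintegrableD => //; exact: cintegrableN. Qed.

Lemma cintegrableJ u : cintegrable u -> cintegrable (fun x => (u x)^*).
Proof.
move=> iu; apply: (cintegrable_dom (g := fun x => normc (u x))).
- by apply: cmeasJ; exact: cintegrable_cmeas.
- exact: cintegrable_normc.
- by move=> x; rewrite normc_conj.
Qed.

Lemma cintD u v : cintegrable u -> cintegrable v ->
  cint (fun x => u x + v x) = cint u + cint v.
Proof.
move=> [ur ui] [vr vi]; apply: complexP; rewrite ?cReD ?cImD ?Re_cint ?Im_cint.
- by under eq_Rintegral do rewrite ReImE; rewrite RintegralD.
- by under eq_Rintegral do rewrite ReImE; rewrite RintegralD.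
Qed.

Lemma cintZ c u : cintegrable u -> cint (fun x => c * u x) = c * cint u.
Proof.
move=> [ur ui]; apply: complexP; rewrite ?cReM ?cImM ?Re_cint ?Im_cint.
- under eq_Rintegral do rewrite ReImE.
  rewrite RintegralB//; [|exact: integrableMl_EFin|exact: integrableMl_EFin].
  by rewrite !RintegralZl.
- under eq_Rintegral do rewrite ReImE.
  rewrite RintegralD//; [|exact: integrableMl_EFin|exact: integrableMl_EFin].
  by rewrite !RintegralZl.
Qed.

Lemma cintB u v : cintegrable u -> cintegrable v ->
  cint (fun x => u x - v x) = cint u - cint v.
Proof.
move=> iu iv; rewrite cintD//; last exact: cintegrableN.
by congr (_ + _); rewrite -mulN1r -cintZ//; congr cint; apply/funext => x;
  rewrite mulN1r.
Qed.

Lemma cintJ u : cintegrable u -> cint (fun x => (u x)^*) = (cint u)^*.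
Proof.
move=> [ur ui]; apply: complexP; rewrite ?cReJ ?cImJ ?Re_cint ?Im_cint.
- by under eq_Rintegral do rewrite ReImE.
- under eq_Rintegral do rewrite ReImE -mulN1r.
  by rewrite RintegralZl// mulN1r.
Qed.

Lemma normc_cint_le u : cintegrable u ->
  normc (cint u) <= 2 * \int[mu]_x normc (u x).
Proof.
move=> iu; have [ur ui] := iu; apply: (le_trans (normc_le _)).
rewrite mulr_natl mulr2n; apply: lerD.
- apply: (le_trans (le_normr_Rintegral _ ur)) => //.
  apply: le_Rintegral => //; first exact: integrable_norm.
    exact: cintegrable_normc.
  by move=> x _; exact: normc_Re.
- apply: (le_trans (le_normr_Rintegral _ ui)) => //.
  apply: le_Rintegral => //; first exact: integrable_norm.
    exact: cintegrable_normc.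
  by move=> x _; exact: normc_Im.
Qed.

Lemma ae_eq_cint u v : cmeas (u : RT -> _) -> cmeas (v : RT -> _) ->
  (\forall x \ae mu, u x = v x) -> cint u = cint v.
Proof.
have aeF : Filter (nbhs (almost_everywhere mu)).
  exact: ae_filter_ringOfSetsType.
move=> [ur ui] [vr vi] uv; apply: complexP; rewrite /= /Rintegral; congr fine.
- apply: ae_eq_integral => //; [exact/measurable_EFinP|exact/measurable_EFinP|].
  by apply: filterS uv => x /= -> _.
- apply: ae_eq_integral => //; [exact/measurable_EFinP|exact/measurable_EFinP|].
  by apply: filterS uv => x /= -> _.
Qed.

Lemma cint_affine u (s b : R) : s != 0 -> cintegrable u ->
  cintegrable (fun x => u (s * x + b)) /\
  cint (fun x => u (s * x + b)) = `|s|^-1%:C * cint u.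
Proof.
move=> s0 [ur ui].
have [ir er] := Rintegral_affine b s0 ur; have [ii ei] := Rintegral_affine b s0 ui.
split=> //; apply: complexP; rewrite !ReImE ?Re_cint ?Im_cint ?er ?ei /=.
- by rewrite mul0r subr0.
- by rewrite mul0r addr0.
Qed.

Section swap.
Variables (H : RT * RT -> R[i]) (a b : R -> R).
Hypothesis mH : cmeas H.
Hypothesis ia : rI a.
Hypothesis ib : rI b.
Hypothesis Hab : forall x y, normc (H (x, y)) <= a x * b y.

Let bR x y : `|Re (H (x, y))| <= a x * b y.
Proof. exact: le_trans (normc_Re _) _. Qed.
Let bI x y : `|Im (H (x, y))| <= a x * b y.
Proof. exact: le_trans (normc_Im _) _. Qed.

Lemma cint_swap :
  cint (fun x => cint (fun y => H (x, y))) =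
  cint (fun y => cint (fun x => H (x, y))).
Proof.
case: mH => mr mi; apply: complexP => /=.
- exact: (sep_Fubini mr ia ib bR).
- exact: (sep_Fubini mi ia ib bI).
Qed.

Lemma cintegrable_cint : cintegrable (fun x => cint (fun y => H (x, y))).
Proof.
case: mH => mr mi; split.
- exact: (sep_Rintegral_integrable mr ia ib bR).
- exact: (sep_Rintegral_integrable mi ia ib bI).
Qed.

End swap.

End complex_integral.

(** * Square-integrable functions and convergence in mean square *)

Section square_integrable.
Variable R : realType.
Local Notation mu := (@lebesgue_measure R).
Local Notation RT := (measurableTypeR R).
Local Notation rI f := (mu.-integrable setT (EFin \o f)).
Local Notation Re := complex.Re.
Local Notation Im := complex.Im.
Implicit Types u v w : R -> R[i].

(** [L2pred] phrased with the integral of the square, so that [sqnorm] is a real number and no root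
    has to be carried. *)
Definition memL2 u := cmeas (u : RT -> _) /\ rI (fun x => normc (u x) ^+ 2).

Definition sqnorm u : R := \int[mu]_x (normc (u x) ^+ 2).

Lemma measurable_normc2 u : cmeas (u : RT -> _) ->
  measurable_fun setT (fun x => normc (u x) ^+ 2).
Proof. by move=> mu'; apply: measurable_funX; exact: cmeas_normc. Qed.

Lemma memL2_dom u (g : R -> R) : cmeas (u : RT -> _) -> rI g ->
  (forall x, normc (u x) ^+ 2 <= g x) -> memL2 u.
Proof.
move=> mu' ig ug; split=> //; apply: integrable_dom ig _.
  exact: measurable_normc2.
by move=> x; rewrite ger0_norm ?exprn_ge0 ?normc_ge0.
Qed.

Lemma memL2_lty u : cmeas (u : RT -> _) ->
  (\int[mu]_x (normc (u x) ^+ 2)%:E < +oo)%E -> memL2 u.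
Proof.
move=> mu' ui; split=> //; apply/integrableP; split.
  by apply/measurable_EFinP; exact: measurable_normc2.
suff -> : (\int[mu]_x `|(EFin \o (fun x => normc (u x) ^+ 2)%R) x| =
  \int[mu]_x (normc (u x) ^+ 2)%:E)%E by [].
by apply: eq_integral => x _ /=; rewrite ger0_norm// exprn_ge0 ?normc_ge0.
Qed.

Lemma integral_sqnorm u : memL2 u ->
  (\int[mu]_x (normc (u x) ^+ 2)%:E)%E = (sqnorm u)%:E.
Proof. by move=> [_ ui]; rewrite fineK//; exact: integrable_fin_num. Qed.

Lemma eL2normE u :
  eL2norm u = ((\int[mu]_x (normc (u x) ^+ 2)%:E) `^ 2^-1)%E.
Proof.
rewrite /eL2norm unlock; congr (_ `^ _)%E; apply: eq_integral => x _ /=.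
by rewrite ger0_norm ?normc_ge0// powR_mulrn ?normc_ge0.
Qed.

Lemma sqnorm_ge0 u : 0 <= sqnorm u.
Proof. by apply: Rintegral_ge0 => x _; rewrite exprn_ge0 ?normc_ge0. Qed.

Lemma eL2norm_sqnorm u : memL2 u -> eL2norm u = (Num.sqrt (sqnorm u))%:E.
Proof.
by move=> /integral_sqnorm u2; rewrite eL2normE u2 poweR_EFin powR12_sqrt// sqnorm_ge0.
Qed.

Lemma L2pred_memL2 u : u \in @L2pred R -> memL2 u.
Proof.
move=> /L2predP[mu']; rewrite eL2normE => /(lty_poweRy _) ui.
by apply: memL2_lty => //; apply: ui; rewrite invr_neq0.
Qed.

Lemma memL2_L2pred u : memL2 u -> u \in @L2pred R.
Proof. by move=> u2; apply/L2predP; split; [exact: u2.1|rewrite eL2norm_sqnorm// ltry]. Qed.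

(** The parallelogram law with the term in z - w dropped. It serves as the triangle inequality for
    [sqnorm], at the price of factors 2 that limits absorb. *)
Lemma sqr_normcD (z w : R[i]) : normc (z + w) ^+ 2 <= 2 * normc z ^+ 2 + 2 * normc w ^+ 2.
Proof.
rewrite !normc2E !ReImE -subr_ge0.
rewrite (_ : _ - _ = (Re z - Re w) ^+ 2 + (Im z - Im w) ^+ 2); last by ring.
by rewrite addr_ge0// sqr_ge0.
Qed.

Lemma memL2D u v : memL2 u -> memL2 v -> memL2 (fun x => u x + v x).
Proof.
move=> [mu' ui] [mv vi].
apply: (memL2_dom (g := fun x => 2 * normc (u x) ^+ 2 + 2 * normc (v x) ^+ 2)).
- exact: cmeasD.
- by apply: integrableD_EFin; exact: integrableMl_EFin.
- by move=> x; exact: sqr_normcD.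
Qed.

Lemma sqnormD_le u v : memL2 u -> memL2 v ->
  sqnorm (fun x => u x + v x) <= 2 * sqnorm u + 2 * sqnorm v.
Proof.
move=> u2 v2; have [mu' ui] := u2; have [mv vi] := v2.
rewrite /sqnorm -!RintegralZl// -RintegralD//; try exact: integrableMl_EFin.
apply: le_Rintegral => //.
- by have [] := memL2D u2 v2.
- by apply: integrableD_EFin; exact: integrableMl_EFin.
- by move=> x _; exact: sqr_normcD.
Qed.

Lemma memL2_bounded u v (c : R) : (forall x, normc (v x) <= c) ->
  cmeas (v : RT -> _) -> memL2 u -> memL2 (fun x => v x * u x).
Proof.
move=> vc mv [mu' ui].
apply: (memL2_dom (g := fun x => c ^+ 2 * normc (u x) ^+ 2)).
- exact: cmeasM.
- exact: integrableMl_EFin.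
- move=> x; rewrite normcM exprMn ler_wpM2r ?exprn_ge0 ?normc_ge0//.
  by rewrite lerXn2r// ?nnegrE ?normc_ge0// (le_trans (normc_ge0 _) (vc x)).
Qed.

Lemma memL2Z c u : memL2 u -> memL2 (fun x => c * u x).
Proof. by apply: (@memL2_bounded _ _ (normc c)) => //; exact: cmeas_cst. Qed.

Lemma memL2N u : memL2 u -> memL2 (fun x => - u x).
Proof.
move=> /(memL2Z (-1)); rewrite (_ : (fun x => _ * _) = fun x => - u x)//.
by apply/funext => x; rewrite mulN1r.
Qed.

Lemma memL2B u v : memL2 u -> memL2 v -> memL2 (fun x => u x - v x).
Proof. by move=> u2 v2; apply: memL2D => //; exact: memL2N. Qed.

Lemma memL2J u : memL2 u -> memL2 (fun x => (u x)^*).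
Proof.
move=> [mu' ui]; apply: (memL2_dom (g := fun x => normc (u x) ^+ 2)) => //.
- exact: cmeasJ.
- by move=> x; rewrite normc_conj.
Qed.

Lemma sqnormJ u : sqnorm (fun x => (u x)^*) = sqnorm u.
Proof. by apply: eq_Rintegral => x _; rewrite normc_conj. Qed.

Lemma sqnorm_sym u v : sqnorm (fun x => u x - v x) = sqnorm (fun x => v x - u x).
Proof. by apply: eq_Rintegral => x _; rewrite -normcN opprB. Qed.

Lemma sqnormZ c u : memL2 u -> sqnorm (fun x => c * u x) = normc c ^+ 2 * sqnorm u.
Proof.
move=> [_ ui]; rewrite /sqnorm -RintegralZl//.
by apply: eq_Rintegral => x _; rewrite normcM exprMn.
Qed.

Lemma sqnormB_le u v w : memL2 u -> memL2 v -> memL2 w ->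
  sqnorm (fun x => u x - w x) <= 2 * sqnorm (fun x => u x - v x) + 2 * sqnorm (fun x => v x - w x).
Proof.
move=> u2 v2 w2.
rewrite (_ : (fun x => u x - w x) = fun x => (u x - v x) + (v x - w x)).
  by apply: sqnormD_le; exact: memL2B.
by apply/funext => x; rewrite addrA subrK.
Qed.

Lemma ae_eq_sqnorm u v : cmeas (u : RT -> _) -> cmeas (v : RT -> _) ->
  (\forall x \ae mu, u x = v x) -> sqnorm u = sqnorm v.
Proof.
have aeF : Filter (nbhs (almost_everywhere mu)).
  exact: ae_filter_ringOfSetsType.
move=> mu' mv uv; rewrite /sqnorm /Rintegral; congr fine; apply: ae_eq_integral => //.
- by apply/measurable_EFinP; exact: measurable_normc2.
- by apply/measurable_EFinP; exact: measurable_normc2.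
- by apply: filterS uv => x /= -> _.
Qed.

Lemma sqnorm_eq0 u : memL2 u -> sqnorm u = 0 -> \forall x \ae mu, u x = 0.
Proof.
have aeF : Filter (nbhs (almost_everywhere mu)).
  exact: ae_filter_ringOfSetsType.
move=> u2 u0; have mn := measurable_normc2 u2.1.
have /(ae_eq_integral_abs mu measurableT) : measurable_fun setT
    (fun x => (normc (u x) ^+ 2)%:E) by exact/measurable_EFinP.
have -> : (\int[mu]_x `|(normc (u x) ^+ 2)%:E| =
    \int[mu]_x (normc (u x) ^+ 2)%:E)%E.
  by apply: eq_integral => x _ /=; rewrite ger0_norm// exprn_ge0 ?normc_ge0.
rewrite integral_sqnorm// u0 => -[/(_ erefl) H _].
apply: filterS H => x /= /(_ I) [] /eqP.
by rewrite expf_eq0/= => /eqP /eq0_normc.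
Qed.

Lemma memL2_mul u v : memL2 u -> memL2 v -> cintegrable (fun x => u x * v x).
Proof.
move=> [mu' ui] [mv vi].
apply: (cintegrable_dom (g := fun x => normc (u x) ^+ 2 + normc (v x) ^+ 2)).
- exact: cmeasM.
- exact: integrableD_EFin.
- move=> x; rewrite normcM.
  by have := normc_ge0 (u x); have := normc_ge0 (v x); nra.
Qed.

(** Young's inequality 2 p q <= c p^2 + q^2 / c under the integral. The weight c stays free so that,
    in a limit, the term in v can be made small before the one in u. *)
Lemma normc_cint_mul_le u v (c : R) : 0 < c -> memL2 u -> memL2 v ->
  normc (cint (fun x => u x * v x)) <= c * sqnorm u + c^-1 * sqnorm v.
Proof.
move=> c0 u2 v2; have uv := memL2_mul u2 v2; have [_ ui] := u2; have [_ vi] := v2.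
apply: (le_trans (normc_cint_le uv)).
rewrite -RintegralZl//; last exact: cintegrable_normc.
rewrite /sqnorm -!RintegralZl// -RintegralD//; try exact: integrableMl_EFin.
apply: le_Rintegral => //.
- by apply: integrableMl_EFin; exact: cintegrable_normc.
- by apply: integrableD_EFin; exact: integrableMl_EFin.
- move=> x _; rewrite normcM.
  set p := normc (u x); set q := normc (v x).
  rewrite -subr_ge0 (_ : _ - _ = c^-1 * (c * p - q) ^+ 2).
    by rewrite mulr_ge0 ?invr_ge0 ?sqr_ge0 ?ltW.
  by field; rewrite gt_eqF.
Qed.

Lemma cint_mulJ u : memL2 u -> cint (fun x => u x * (u x)^*) = (sqnorm u)%:C.
Proof.
move=> u2; apply: complexP; rewrite ?Re_cint ?Im_cint ?cReC ?cImC.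
  by apply: eq_Rintegral => x _; rewrite mulcJ.
transitivity (\int[mu]_(x in setT) (0 : R)).
  by apply: eq_Rintegral => x _; rewrite mulcJ.
by rewrite Rintegral_cst// mul0r.
Qed.

Lemma memL2_affine u (s b : R) : s != 0 -> memL2 u ->
  memL2 (fun x => u (s * x + b)) /\
  sqnorm (fun x => u (s * x + b)) = `|s|^-1 * sqnorm u.
Proof.
move=> s0 [mu' ui]; have [i e] := Rintegral_affine b s0 ui; split=> //.
split=> //; apply: (cmeas_comp (phi := fun x : RT => s * x + b : RT)) => //.
by apply: measurable_funD => //; exact: measurable_funM.
Qed.

Definition cvgL2 (f_ : nat -> R -> R[i]) u :=
  sqnorm (fun x => f_ n x - u x) @[n --> \oo] --> (0 : R).

(** Convergence in R[i] expressed by a real sequence, so that squeezing arguments apply directly. *)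
Definition cvgc (z_ : nat -> R[i]) (z : R[i]) :=
  normc (z_ n - z) @[n --> \oo] --> (0 : R).

Lemma squeeze0 (a_ b_ : nat -> R) : (forall n, 0 <= a_ n <= b_ n) ->
  b_ n @[n --> \oo] --> (0 : R) -> a_ n @[n --> \oo] --> (0 : R).
Proof.
move=> ab b0; apply: (squeeze_cvgr _ (cvg_cst 0) b0).
by apply: nearW => n; exact: ab.
Qed.

Lemma cvg0_le (a : R) (a_ : nat -> R) : (forall n, a <= a_ n) ->
  a_ n @[n --> \oo] --> (0 : R) -> a <= 0.
Proof.
move=> aa a0; rewrite -(cvg_lim _ a0)//; apply: limr_ge.
  by apply/cvg_ex; exists 0.
exact: nearW.
Qed.

Lemma cvgr0MD (c d : R) (a_ b_ : nat -> R) :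
  a_ n @[n --> \oo] --> (0 : R) -> b_ n @[n --> \oo] --> (0 : R) ->
  c * a_ n + d * b_ n @[n --> \oo] --> (0 : R).
Proof.
move=> a0 b0; rewrite -[0](_ : c * 0 + d * 0 = 0); last by rewrite !mulr0 addr0.
by apply: cvgD; apply: cvgMr.
Qed.

Lemma cvgc_unique (z_ : nat -> R[i]) (z w : R[i]) : cvgc z_ z -> cvgc z_ w -> z = w.
Proof.
move=> zz zw; apply/eqP; rewrite -subr_eq0; apply/eqP/eq0_normc/eqP.
rewrite eq_le normc_ge0 andbT.
apply: (cvg0_le _ (cvgr0MD 1 1 zz zw)) => n; rewrite !mul1r.
rewrite (_ : z - w = (z - z_ n) + (z_ n - w)); last by rewrite addrA subrK.
by rewrite (le_trans (le_normcD _ _))// lerD2r -normcN opprB.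
Qed.

Lemma cvgL2_unique f_ u v : (forall n, memL2 (f_ n)) -> memL2 u -> memL2 v ->
  cvgL2 f_ u -> cvgL2 f_ v -> \forall x \ae mu, u x = v x.
Proof.
have aeF : Filter (nbhs (almost_everywhere mu)).
  exact: ae_filter_ringOfSetsType.
move=> mf mu' mv fu fv.
have : \forall x \ae mu, u x - v x = 0.
  apply: sqnorm_eq0; first exact: memL2B.
  apply/eqP; rewrite eq_le sqnorm_ge0 andbT.
  apply: (cvg0_le _ (cvgr0MD 2 2 fu fv)) => n.
  by rewrite (sqnorm_sym (f_ n)); exact: sqnormB_le.
by apply: filterS => x /eqP; rewrite subr_eq0 => /eqP.
Qed.

Lemma cvgc_cint f_ u v : (forall n, memL2 (f_ n)) -> memL2 u -> memL2 v ->
  cvgL2 f_ u -> cvgc (fun n => cint (fun x => f_ n x * v x)) (cint (fun x => u x * v x)).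
Proof.
move=> mf mu' mv fu; apply/cvgr0Pnorm_le => e e0.
(* Makes c^-1 * sqnorm v at most e / 2; the + 1 keeps c positive when [sqnorm v] is 0. *)
pose c := (2 * (sqnorm v + 1)) / e.
have v0 := sqnorm_ge0 v.
have c0 : 0 < c by rewrite divr_gt0// mulr_gt0// ltr_wpDl.
move/cvgr0Pnorm_le : fu => /(_ (e / 2 / c)) [|N _ HN].
  by apply: divr_gt0 => //; exact: divr_gt0.
exists N => // n /HN; rewrite ger0_norm ?sqnorm_ge0// => H.
rewrite ger0_norm ?normc_ge0//.
rewrite -cintB; [|exact: memL2_mul|exact: memL2_mul].
rewrite (_ : (fun x => _) = fun x => (f_ n x - u x) * v x); last first.
  by apply/funext => x; rewrite mulrBl.
apply: (le_trans (normc_cint_mul_le c0 (memL2B (mf n) mu') mv)).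
rewrite [leRHS](_ : _ = e / 2 + e / 2); last by field.
apply: lerD; first by rewrite mulrC -ler_pdivlMr.
rewrite mulrC ler_pdivrMr// /c.
rewrite (_ : e / 2 * _ = sqnorm v + 1); first by rewrite lerDl.
by field; rewrite gt_eqF.
Qed.

Lemma cvgc_cst z_ (z : R[i]) : (forall n, z_ n = z) -> cvgc z_ z.
Proof.
move=> zz; rewrite /cvgc; under eq_fun do rewrite zz subrr normc0.
exact: cvg_cst.
Qed.

End square_integrable.

(** * Completeness, and functions with vanishing integrals over intervals *)

Section completeness.
Variable R : realType.
Local Notation mu := (@lebesgue_measure R).
Local Notation RT := (measurableTypeR R).
Local Notation Re := complex.Re.
Local Notation Im := complex.Im.
Implicit Types u v : R -> R[i].

Lemma geometric_cvg (a : nat -> R) (c : R) :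
  (forall k, `|a k.+1 - a k| <= c * 2^-1 ^+ k) -> cvgn a.
Proof.
move=> ac.
have -> : a = (fun n => a 0%N + series (telescope a) n).
  by apply/funext => n; rewrite -eq_sum_telescope.
apply: is_cvgD; first exact: is_cvg_cst.
apply: normed_cvg.
apply: (@series_le_cvg _ _ (geometric c 2^-1)) => [n|n|n|].
- exact: normr_ge0.
- by apply: le_trans (ac n); exact: normr_ge0.
- exact: ac.
- apply: is_cvg_geometric_series; rewrite ger0_norm ?invr_ge0//.
  by rewrite invf_lt1// ltr1n.
Qed.

Lemma limn_einf_le (a : nat -> \bar R) (e : \bar R) :
  (forall k, a k <= e)%E -> (limn_einf a <= e)%E.
Proof.
move=> ae; rewrite limn_einf_lim; apply: lime_le; first exact: is_cvg_einfs.
apply: nearW => n; apply: le_trans (ae n).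
by apply: ereal_inf_lbound; exists n => /=.
Qed.

(** The Riesz-Fischer argument: a fast subsequence converges almost everywhere, and Fatou's lemma
    bounds the distance of its limit to every late [f_ n]. *)
Lemma L2_complete (f_ : nat -> R -> R[i]) : (forall n, memL2 (f_ n)) ->
  (forall e : R, 0 < e -> exists N : nat, forall m n : nat,
    (N <= m)%N -> (N <= n)%N -> sqnorm (fun x => f_ m x - f_ n x) <= e) ->
  exists2 u, memL2 u & cvgL2 f_ u.
Proof.
move=> mf cf.
have aeF : Filter (nbhs (almost_everywhere mu)).
  exact: ae_filter_ringOfSetsType.
have e_gt0 k : 0 < (8^-1 : R) ^+ k by rewrite exprn_gt0// invr_gt0.
pose N k := sval (cid (cf _ (e_gt0 k))).
have NP k m n : (N k <= m)%N -> (N k <= n)%N ->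
    sqnorm (fun x => f_ m x - f_ n x) <= 8^-1 ^+ k.
  by rewrite /N; case: cid => /= ? H; exact: H.
(* The sum of the [N i] makes [phi] monotone whatever [N] is, and the summand k makes it
   unbounded. *)
pose phi k := (\sum_(i < k.+1) N i + k)%N.
have phiN k : (N k <= phi k)%N.
  by rewrite /phi big_ord_recr/= -addnA -addnCA leq_addr.
have phiS k : (phi k <= phi k.+1)%N.
  by rewrite /phi [in leqRHS]big_ord_recr/= -addnA leq_add2l addnS -addSn leq_addl.
have phik k : (k <= phi k)%N by rewrite leq_addl.
pose D k x := f_ (phi k.+1) x - f_ (phi k) x.
have mD k : memL2 (D k) by exact: memL2B.
have D8 k : sqnorm (D k) <= 8^-1 ^+ k.
  by apply: NP; [exact: leq_trans (phiN k) (phiS k)|exact: phiN].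
(* The weight 4^k leaves increments of square norm 8^-k summable, with total at most 2; where the
   sum S is finite, it yields |D k x| <= sqrt (S x) * 2^-k. *)
pose t k x := 4 ^+ k * normc (D k x) ^+ 2.
have t0 k x : 0 <= t k x by rewrite mulr_ge0 ?exprn_ge0 ?normc_ge0.
have mt k : measurable_fun setT (t k).
  by apply: measurable_funM => //; exact: (measurable_normc2 (mD k).1).
pose S x := (\sum_(0 <= k <oo) (t k x)%:E)%E.
have S0 x : (0 <= S x)%E by apply: nneseries_ge0 => n _ _; rewrite lee_fin.
have mS : measurable_fun setT S.
  apply: (ge0_emeasurable_sum (P := xpredT)) => [k x _ _|k _].
    by rewrite lee_fin.
  exact/measurable_EFinP.
have intS : (\int[mu]_x S x <= 2%:E)%E.
  have mtE n : measurable_fun setT (fun x => (t n x)%:E) by exact/measurable_EFinP.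
  have t0E n x : setT x -> (0 <= (t n x)%:E)%E by rewrite lee_fin.
  rewrite (integral_nneseries mu measurableT mtE t0E).
  apply: lime_le.
    by apply: is_cvg_nneseries => n _ _; apply: integral_ge0 => x _; rewrite lee_fin.
  apply: nearW => n.
  have : (\sum_(0 <= i < n) \int[mu]_x (t i x)%:E <=
      \sum_(0 <= i < n) (2^-1 ^+ i)%:E)%E.
    apply: lee_sum => i _; rewrite /t.
    under eq_integral do rewrite EFinM.
    rewrite ge0_integralZl_EFin//; last 2 first.
    - by move=> x _; rewrite lee_fin exprn_ge0 ?normc_ge0.
    - by apply/measurable_EFinP; exact: (measurable_normc2 (mD i).1).
    rewrite integral_sqnorm// -EFinM lee_fin.
    apply: (le_trans (ler_wpM2l _ (D8 i))); first by rewrite exprn_ge0.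
    by rewrite -exprMn (_ : 4 * 8^-1 = 2^-1 :> R)//; field.
  move/le_trans; apply; rewrite sumEFin lee_fin.
  suff -> : \sum_(0 <= i < n) (2^-1 : R) ^+ i = 2 - 2 * 2^-1 ^+ n.
    by rewrite gerBl mulr_ge0// exprn_ge0// invr_ge0.
  elim: n => [|n IHn]; first by rewrite big_nil expr0 mulr1 subrr.
  by rewrite big_nat_recr//= IHn exprS; field.
pose A := [set x : RT | (S x < +oo)%E].
have mA : measurable A.
  by rewrite -[A]setTI; exact: emeasurable_fun_infty_o.
have aeA : \forall x \ae mu, A x.
  have : mu.-integrable setT S.
    apply/integrableP; split=> //.
    under eq_integral do rewrite gee0_abs//.
    exact: le_lt_trans intS (ltry _).
  move=> /(integrable_ae measurableT); apply: filterS => x /= /(_ I).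
  by rewrite ge0_fin_numE.
(* Off the full-measure set A the sequence is replaced by 0, so that its limit exists at every point
   and is measurable. *)
pose g k x := (\1_A x)%:C * f_ (phi k) x.
have mg k : cmeas (g k : RT -> _).
  by apply: cmeasM; [apply: cmeasC|exact: (mf _).1].
have gE k x : A x -> g k x = f_ (phi k) x.
  by move=> Ax; rewrite /g indicE mem_set// mul1r.
have gN k x : ~ A x -> g k x = 0.
  by move=> Ax; rewrite /g indicE memNset// mul0r.
have Db x : A x -> exists c, forall k, normc (D k x) <= c * 2^-1 ^+ k.
  rewrite /A /= => Sx; have Sf : S x \is a fin_num by rewrite ge0_fin_numE.
  exists (Num.sqrt (fine (S x))) => k.
  have tS : t k x <= fine (S x).
    rewrite -lee_fin fineK//.
    have := @nneseries_lim_ge R (fun k => (t k x)%:E) xpredT 0 k.+1.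
    rewrite big_nat_recr//= => H; apply: le_trans (H _).
      by rewrite leeDr// sume_ge0// => i _; rewrite lee_fin.
    by move=> n _ _; rewrite lee_fin.
  have s0 : 0 <= Num.sqrt (fine (S x)) * 2^-1 ^+ k.
    by rewrite mulr_ge0 ?sqrtr_ge0 ?exprn_ge0 ?invr_ge0.
  rewrite -(@ler_pXn2r _ 2)// ?nnegrE ?normc_ge0//.
  rewrite exprMn sqr_sqrtr ?fine_ge0// -exprM mulnC exprM.
  rewrite (_ : (2^-1 ^+ 2) = 4^-1 :> R); last by rewrite exprVn -natrX.
  by rewrite exprVn ler_pdivlMr ?exprn_gt0// mulrC.
have cvgP (h : R[i] -> R) : (forall z w : R[i], h (z - w) = h z - h w) ->
    (forall z : R[i], `|h z| <= normc z) -> forall x, cvgn (fun k => h (g k x)).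
  move=> hB hn x; have [Ax|nAx] := pselect (A x); last first.
    rewrite (_ : (fun k => _) = fun=> h 0); first exact: is_cvg_cst.
    by apply/funext => k; rewrite gN.
  have [c Hc] := Db x Ax; apply: (@geometric_cvg _ c) => k.
  by rewrite -hB !gE//; exact: le_trans (hn _) (Hc k).
have cR : forall x, cvgn (fun k => Re (g k x)).
  move=> x; refine (cvgP (fun z => Re z) _ (@normc_Re R) x) => z w.
  by rewrite cReD cReN.
have cI : forall x, cvgn (fun k => Im (g k x)).
  move=> x; refine (cvgP (fun z => Im z) _ (@normc_Im R) x) => z w.
  by rewrite cImD cImN.
pose u x := limn (fun k => Re (g k x)) +i* limn (fun k => Im (g k x)).
have mu' : cmeas (u : RT -> _).
  split.
  - apply: (measurable_fun_cvg (h := fun k x => Re (g k x))) => [k|x _].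
      exact: (mg k).1.
    exact: cR.
  - apply: (measurable_fun_cvg (h := fun k x => Im (g k x))) => [k|x _].
      exact: (mg k).2.
    exact: cI.
(* Fatou's lemma in k with n fixed; the shift by K discards the indices for which no bound is
   assumed. *)
have key (n K : nat) (e : R) : (forall k : nat, (K <= k)%N ->
      sqnorm (fun x => f_ (phi k) x - f_ n x) <= e) ->
    (\int[mu]_x (normc (u x - f_ n x) ^+ 2)%:E <= e%:E)%E.
  move=> He.
  pose G k x := (normc (g (k + K)%N x - f_ n x) ^+ 2)%:E.
  have mG k : measurable_fun setT (G k).
    by apply/measurable_EFinP; exact: (measurable_normc2 (cmeasB (mg _) (mf n).1)).
  have G0 k x : setT x -> (0 <= G k x)%E by rewrite lee_fin exprn_ge0 ?normc_ge0.
  have H := @fatou _ _ _ mu setT measurableT G mG G0.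
  apply: (@le_trans _ _ (limn_einf (fun k => \int[mu]_x G k x)%E)); last first.
    apply: limn_einf_le => k.
    rewrite (_ : (\int[mu]_x _)%E = (sqnorm (fun x => f_ (phi (k + K)%N) x - f_ n x))%:E).
      by rewrite lee_fin He// leq_addl.
    rewrite -integral_sqnorm; last exact: memL2B.
    apply: ae_eq_integral => //.
      apply/measurable_EFinP.
      exact: (measurable_normc2 (cmeasB (mf _).1 (mf _).1)).
    by apply: filterS aeA => x Ax _; rewrite /G gE.
  apply: le_trans H; rewrite le_eqVlt; apply/orP; left; apply/eqP.
  apply: eq_integral => x _.
  suff GG : G k x @[k --> \oo] --> (normc (u x - f_ n x) ^+ 2)%:E.
    by rewrite [RHS](cvg_limn_einf_sup GG).1.
  apply: cvg_EFin; first exact: nearW.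
  have shift (a : nat -> R) : cvgn a -> a (k + K)%N @[k --> \oo] --> limn a.
    by move=> ca; rewrite (cvg_shiftn K a).
  have hR : Re (g (k + K)%N x - f_ n x) @[k --> \oo] --> Re (u x - f_ n x).
    rewrite cReD cReN; under eq_fun do rewrite cReD cReN.
    by apply: cvgB; [exact: (shift _ (cR x))|exact: cvg_cst].
  have hI : Im (g (k + K)%N x - f_ n x) @[k --> \oo] --> Im (u x - f_ n x).
    rewrite cImD cImN; under eq_fun do rewrite cImD cImN.
    by apply: cvgB; [exact: (shift _ (cI x))|exact: cvg_cst].
  rewrite [X in X @ _](_ : _ = fun k =>
    Re (g (k + K)%N x - f_ n x) * Re (g (k + K)%N x - f_ n x) +
    Im (g (k + K)%N x - f_ n x) * Im (g (k + K)%N x - f_ n x)).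
    by rewrite normc2E !expr2; exact: (cvgD (cvgM hR hR) (cvgM hI hI)).
  by apply/funext => k; rewrite /G /= normc2E !expr2.
have key2 (e : R) : 0 < e -> exists M : nat, forall n, (M <= n)%N ->
    (\int[mu]_x (normc (u x - f_ n x) ^+ 2)%:E <= e%:E)%E.
  move=> e0; have [M HM] := cf e e0; exists M => n Mn.
  by apply: (key n M) => k Mk; apply: HM => //; exact: leq_trans Mk (phik k).
have mun n : cmeas ((fun x => u x - f_ n x) : RT -> _).
  by apply: cmeasB => //; exact: (mf n).1.
have u2 : memL2 u.
  have [M HM] := key2 1 ltr01.
  have : memL2 (fun x => u x - f_ M x).
    by apply: memL2_lty => //; apply: le_lt_trans (HM M _) (ltry _).
  move=> /(fun h => memL2D h (mf M)).
  by rewrite (_ : (fun x => _) = u)//; apply/funext => x; rewrite subrK.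
exists u => //; apply/cvgr0Pnorm_le => e e0.
have [M HM] := key2 e e0; exists M => // n Mn /=.
rewrite ger0_norm ?sqnorm_ge0// sqnorm_sym -lee_fin -integral_sqnorm; first exact: HM.
exact: memL2B.
Qed.

(** By Lebesgue differentiation f is almost everywhere the derivative of its primitive from -n,
    which is constantly 0. A primitive starting at -n controls only the points to its right, hence
    all n are used at once. *)
Lemma ae0_itv (f : R -> R) : measurable_fun setT f ->
  (forall a b : R, mu.-integrable `[a, b] (EFin \o f)) ->
  (forall a b : R, \int[mu]_(x in `[a, b]) f x = 0) ->
  \forall x \ae mu, f x = 0.
Proof.
move=> mf fi f0.
have aeF : Filter (nbhs (almost_everywhere mu)).
  exact: ae_filter_ringOfSetsType.
have lf : locally_integrable [set: R] f.
  split=> //; first exact: openT.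
  move=> K _ cK; have [M [Mr HM]] := compact_bounded cK.
  have KM : K `<=` `[- (M + 1), M + 1].
    move=> x Kx /=; rewrite in_itv/= -ler_norml.
    by apply: HM => //; rewrite ltrDl.
  have : mu.-integrable K (EFin \o f).
    refine (@integrableS _ RT R mu `[- (M + 1), M + 1]%classic K _ _ _ KM _) => //.
      exact: compact_measurable.
  by move=> /integrableP [].
have H n := FTC1 (a := BLeft (- n%:R)) (fi (- n%:R)) lf.
have := ae_foralln H; apply: filterS => x Hx.
have [n nx] : exists n : nat, - x < n%:R.
  by exists (Num.truncn `|x|).+1; rewrite (le_lt_trans (ler_norm _))// normrN Num.Theory.truncnS_gt.
have [|_ <-] := Hx n; first by rewrite lte_fin ltrNl.
rewrite (_ : (fun x => _) = cst 0) ?derive1_cst//.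
by apply/funext => y; exact: f0.
Qed.

End completeness.

(** * Abel weights and the Poisson kernel *)

Section poisson_kernel.
Variable R : realType.
Local Notation mu := (@lebesgue_measure R).
Local Notation RT := (measurableTypeR R).
Local Notation rI f := (mu.-integrable setT (EFin \o f)).
Implicit Types (e t x : R).

Definition abel e x : R := expR (- (e * `|x|)).

Lemma abel_gt0 e x : 0 < abel e x. Proof. exact: expR_gt0. Qed.

Lemma abel_le1 e x : 0 < e -> abel e x <= 1.
Proof.
by move=> e0; rewrite -expR0 ler_expR oppr_le0 mulr_ge0// ltW.
Qed.

Lemma continuous_abel e : continuous (abel e).
Proof.
move=> x; apply: continuous_comp; last exact: continuous_expR.
apply: cvgN; apply: cvgMr; exact: norm_continuous.
Qed.

Lemma cvg_expRNM e : 0 < e -> expR (- (e * x)) @[x --> +oo] --> (0 : R).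
Proof.
move=> e0; apply: (cvg_comp _ _ _ (@cvgr_expR R)).
exact: gt0_cvgMry.
Qed.

Let is_derive_primitive e t x : 0 < e ->
  is_derive x 1 (fun x => expR (- (e * x)) *
    ((t * sin (t * x) - e * cos (t * x)) / (e ^+ 2 + t ^+ 2) - e^-1))
  (expR (- (e * x)) * (1 + cos (t * x))).
Proof.
move=> e0.
have et : e ^+ 2 + t ^+ 2 != 0.
  by rewrite gt_eqF// ltr_wpDr ?sqr_ge0// exprn_gt0.
apply: is_derive_eq.
rewrite /GRing.scale/=.
by field; rewrite et gt_eqF.
Qed.

(** Adding 1 to the cosine makes the integrand nonnegative, as the fundamental theorem on a
    half-line requires here. The case t = 0 gives the integral of [abel e], and a subtraction then
    gives the cosine transform. *)
Lemma integral_abel1cos e t : 0 < e ->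
  (\int[mu]_x (abel e x * (1 + cos (t * x)))%:E =
   (2 * (e^-1 + e / (e ^+ 2 + t ^+ 2)))%:E)%E.
Proof.
move=> e0.
have ccos : continuous (fun x => cos (t * x)).
  by move=> x; apply: continuous_comp; [exact: cvgMr|exact: continuous_cos].
have cf : continuous (fun x => abel e x * (1 + cos (t * x))).
  move=> x; apply: cvgM; first exact: continuous_abel.
  by apply: cvgD; [exact: cvg_cst|exact: ccos].
have cos1 x : 0 <= 1 + cos x by rewrite -lerBlDl sub0r cos_geN1.
rewrite ge0_symfun_integralT//; last 2 first.
- by move=> x; rewrite mulr_ge0 ?expR_ge0.
- by move=> x /=; rewrite /abel normrN mulrN cosN.
rewrite -set_itvcy EFinM; congr (_ * _)%E.
pose F x := expR (- (e * x)) *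
  ((t * sin (t * x) - e * cos (t * x)) / (e ^+ 2 + t ^+ 2) - e^-1).
have dF x : is_derive x 1 F (expR (- (e * x)) * (1 + cos (t * x))).
  exact: is_derive_primitive.
have fourier_cst : continuous F.
  by move=> x; apply/differentiable_continuous/derivable1_diffP; exact: ex_derive.
transitivity (\int[mu]_(x in `[0%R, +oo[) (expR (- (e * x)) * (1 + cos (t * x)))%:E)%E.
  apply: eq_integral => x; rewrite inE/= in_itv/= andbT => x0.
  by rewrite /abel ger0_norm.
rewrite (@ge0_continuous_FTC2y _ _ F 0 0).
- rewrite /F !mulr0 oppr0 expR0 sin0 cos0 -EFinB; congr EFin; ring.
- by move=> x _; rewrite mulr_ge0 ?expR_ge0.
- apply: continuous_subspaceT => x; apply: cvgM.
    by apply: continuous_comp; [apply: cvgN; exact: cvgMr|exact: continuous_expR].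
  by apply: cvgD; [exact: cvg_cst|exact: ccos].
- pose C := (`|t| + e) / (e ^+ 2 + t ^+ 2) + e^-1.
  apply/norm_cvg0P; apply: (@squeeze_cvgr _ _ _ _ (cst 0) (fun x => expR (- (e * x)) * C)).
  + apply: nearW => x /=; rewrite normr_ge0/= /F normrM ger0_norm ?expR_ge0//.
    rewrite ler_wpM2l ?expR_ge0// (le_trans (ler_normB _ _))//.
    have ei : 0 <= e^-1 by rewrite invr_ge0 ltW.
    rewrite (ger0_norm ei) /C lerD2r.
    have et : 0 <= e ^+ 2 + t ^+ 2 by rewrite addr_ge0 ?sqr_ge0.
    rewrite normrM normfV (ger0_norm et) ler_wpM2r ?invr_ge0//.
    rewrite (le_trans (ler_normB _ _))// !normrM (gtr0_norm e0).
    apply: lerD; rewrite ler_piMr ?(ltW e0)// ler_norml.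
      by rewrite sin_geN1 sin_le1.
    by rewrite cos_geN1 cos_le1.
  + exact: cvg_cst.
  + rewrite -[X in _ --> X](mul0r C); apply: cvgMl.
    exact: cvg_expRNM.
- by move=> x _; exact: ex_derive.
- by apply: cvg_at_right_filter; exact: fourier_cst.
- by move=> x _; rewrite derive1E; exact: derive_val.
Qed.

Lemma integrable_abel1cos e t : 0 < e ->
  rI (fun x => abel e x * (1 + cos (t * x))).
Proof.
move=> e0.
have mf : measurable_fun setT (fun x => abel e x * (1 + cos (t * x))).
  apply: continuous_measurable_fun => x.
  apply: cvgM; first exact: continuous_abel.
  apply: cvgD; first exact: cvg_cst.
  by apply: continuous_comp; [exact: cvgMr|exact: continuous_cos].
apply/integrableP; split; first exact/measurable_EFinP.
rewrite (_ : (\int[mu]_x _)%E =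
    (\int[mu]_x (abel e x * (1 + cos (t * x)))%:E)%E).
  by rewrite integral_abel1cos// ltry.
apply: eq_integral => x _ /=; rewrite ger0_norm// mulr_ge0 ?expR_ge0//.
Qed.

Lemma integrable_abel e : 0 < e -> rI (abel e).
Proof.
move=> /(integrable_abel1cos 0) /(integrableMl_EFin 2^-1).
apply: eq_integrable => // x _ /=.
by rewrite mul0r cos0; congr EFin; field.
Qed.

Lemma Rintegral_abel e : 0 < e -> \int[mu]_x abel e x = 2 / e.
Proof.
move=> e0.
transitivity (2^-1 * \int[mu]_x (abel e x * (1 + cos (0 * x)))).
  rewrite -RintegralZl//; last exact: integrable_abel1cos.
  by apply: eq_Rintegral => x _; rewrite mul0r cos0; field.
rewrite /Rintegral integral_abel1cos//=; field.
by rewrite gt_eqF.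
Qed.

Lemma abel_fourier e t : 0 < e ->
  cintegrable (fun x => (abel e x)%:C * cexpi (t * x)) /\
  cint (fun x => (abel e x)%:C * cexpi (t * x)) =
  (2 * e / (e ^+ 2 + t ^+ 2))%:C.
Proof.
move=> e0; have ia := integrable_abel e0.
have mabel : measurable_fun setT (abel e) by exact: integrable_measurable.
have mt : measurable_fun setT (fun x : RT => t * x : RT) by exact: measurable_funM.
have ci : cintegrable (fun x => (abel e x)%:C * cexpi (t * x)).
  apply: (cintegrable_dom _ ia).
    by apply: cmeasM; [exact: cmeasC|exact: cmeas_cexpi].
  by move=> x; rewrite normcM normc_cexpi mulr1 normcC ger0_norm ?expR_ge0.
split=> //; apply: complexP.
- rewrite Re_cint cReC.
  transitivity (\int[mu]_x (abel e x * (1 + cos (t * x)) - abel e x)).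
    by apply: eq_Rintegral => x _; rewrite !ReImE; ring.
  rewrite RintegralB//; last exact: integrable_abel1cos.
  rewrite Rintegral_abel// /Rintegral integral_abel1cos//=.
  have et : e ^+ 2 + t ^+ 2 != 0.
    by rewrite gt_eqF// ltr_wpDr ?sqr_ge0// exprn_gt0.
  by field; rewrite et gt_eqF.
(* The sine part is odd: the reflection x -> - x shows that its integral equals its own opposite. *)
- have [_ h] := ci; rewrite Im_cint cImC.
  have N1 : (-1 : R) != 0 by rewrite oppr_eq0 oner_neq0.
  have [_] := Rintegral_affine 0 N1 h.
  rewrite normrN1 invr1 mul1r => H.
  have : \int[mu]_x complex.Im ((abel e x)%:C * cexpi (t * x)) =
      - \int[mu]_x complex.Im ((abel e x)%:C * cexpi (t * x)).
    rewrite -{1}H.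
    transitivity (\int[mu]_x (-1 * complex.Im ((abel e x)%:C * cexpi (t * x)))).
      apply: eq_Rintegral => x _.
      by rewrite !ReImE addr0 !mulN1r /abel normrN mulrN sinN; ring.
    by rewrite RintegralZl// mulN1r.
  by lra.
Qed.

(** The transform 2 e / (e^2 + x^2) of [abel e], divided by 2 pi. The factor 1 / (2 pi) is the
    square of the normalising constant of the Fourier transform, and it gives the kernel mass 1. *)
Definition poisson e x : R := e / (pi * (e ^+ 2 + x ^+ 2)).

Lemma poisson_denom e x : 0 < e -> 0 < pi * (e ^+ 2 + x ^+ 2).
Proof.
by move=> e0; rewrite mulr_gt0 ?pi_gt0// ltr_wpDr ?sqr_ge0// exprn_gt0.
Qed.

Lemma poisson_ge0 e x : 0 < e -> 0 <= poisson e x.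
Proof. by move=> e0; rewrite divr_ge0 ?ltW// poisson_denom. Qed.

Lemma poissonN e x : poisson e (- x) = poisson e x.
Proof. by rewrite /poisson sqrrN. Qed.

Lemma poisson_le e x : 0 < e -> poisson e x <= (pi * e)^-1.
Proof.
move=> e0; rewrite /poisson ler_pdivrMr ?poisson_denom//.
rewrite mulrC ler_pdivlMr ?mulr_gt0 ?pi_gt0//.
by rewrite mulrCA ler_pM2l ?pi_gt0// -expr2 lerDl sqr_ge0.
Qed.

Lemma continuous_poisson e : 0 < e -> continuous (poisson e).
Proof.
move=> e0 x; apply: cvgMr; apply: cvgV; first by rewrite gt_eqF ?poisson_denom.
by apply: cvgMr; apply: cvgD; [exact: cvg_cst|exact: exprn_continuous].
Qed.

Lemma is_derive_atan_div e x : 0 < e ->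
  is_derive x 1 (fun x => pi^-1 * atan (x / e)) (poisson e x).
Proof.
move=> e0; apply: is_derive_eq.
rewrite /GRing.scale/= /poisson.
have x1 : 1 + (x / e) ^+ 2 != 0 by rewrite gt_eqF// ltr_wpDr ?sqr_ge0.
have ex : e ^+ 2 + x ^+ 2 != 0.
  by rewrite gt_eqF// ltr_wpDr ?sqr_ge0// exprn_gt0.
have pi0 : pi != 0 :> R by rewrite gt_eqF ?pi_gt0.
have ee : e != 0 by rewrite gt_eqF.
have -> : 1 + (x / e) ^+ 2 = (e ^+ 2 + x ^+ 2) / e ^+ 2 by field.
rewrite ?mulr0 ?addr0 ?add0r.
move: (@trigo.pi R) pi0 => p pi0.
by field; rewrite ?ex ?pi0 ?ee.
Qed.

Let continuous_atan_div e : 0 < e -> continuous (fun x => pi^-1 * atan (x / e)).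
Proof.
move=> e0 x; apply/differentiable_continuous/derivable1_diffP.
by have [] := is_derive_atan_div x e0.
Qed.

Lemma integral_poisson e : 0 < e -> (\int[mu]_x (poisson e x)%:E = 1%:E)%E.
Proof.
move=> e0; rewrite ge0_symfun_integralT; last 3 first.
- by move=> x; exact: poisson_ge0.
- exact: continuous_poisson.
- by move=> x /=; rewrite poissonN.
have dP := fun x => is_derive_atan_div x e0.
rewrite -set_itvcy (@ge0_continuous_FTC2y _ _ (fun x => pi^-1 * atan (x / e)) 0 2^-1).
- by rewrite mul0r atan0 mulr0 -EFinB -EFinM subr0 divff.
- by move=> x _; exact: poisson_ge0.
- by apply: continuous_subspaceT; exact: continuous_poisson.
- rewrite (_ : 2^-1 = pi^-1 * (pi / 2)); last first.
    by rewrite mulrA mulVf ?mul1r// gt_eqF ?pi_gt0.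
  apply: cvgMr; apply: (cvg_comp _ _ _ (@cvgy_atan R)).
  by apply: gt0_cvgMly => //; rewrite invr_gt0.
- by move=> x _; have [] := dP x.
- by apply: cvg_at_right_filter; exact: continuous_atan_div.
- by move=> x _; rewrite derive1E; have [] := dP x.
Qed.

Lemma integrable_poisson e : 0 < e -> rI (poisson e).
Proof.
move=> e0; apply/integrableP; split.
  apply/measurable_EFinP; apply: continuous_measurable_fun.
  exact: (continuous_poisson e0).
rewrite (_ : (\int[mu]_x _)%E = (\int[mu]_x (poisson e x)%:E)%E).
  by rewrite integral_poisson// ltry.
by apply: eq_integral => x _ /=; rewrite ger0_norm// poisson_ge0.
Qed.

Lemma poisson_shift e y : 0 < e ->
  rI (fun x => poisson e (x - y)) /\ \int[mu]_x poisson e (x - y) = 1.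
Proof.
move=> e0; have [i E] := Rintegral_affine (- y) (oner_neq0 R) (integrable_poisson e0).
have eq1 x : poisson e (1 * x + - y) = poisson e (x - y) by rewrite mul1r.
split; first by apply: eq_integrable i => // x _ /=; rewrite eq1.
transitivity (\int[mu]_x poisson e (1 * x + - y)).
  by apply: eq_Rintegral => x _; rewrite eq1.
by rewrite E normr1 invr1 mul1r /Rintegral integral_poisson.
Qed.

Lemma Rintegral_poisson_itv e a b y : 0 < e -> a < b ->
  \int[mu]_(x in `[a, b]) poisson e (x - y) =
  pi^-1 * (atan ((b - y) / e) - atan ((a - y) / e)).
Proof.
move=> e0 ab.
have dP x : is_derive x 1 (fun x => pi^-1 * atan ((x - y) / e)) (poisson e (x - y)).
  have := is_derive_atan_div (x - y) e0 => dP.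
  apply: (is_derive_eq (is_derive1_comp (f := fun x => pi^-1 * atan (x / e))
    (g := fun x => x - y) _ _)).
  by rewrite subr0 mulr1.
rewrite /Rintegral (@continuous_FTC2 _ _ (fun x => pi^-1 * atan ((x - y) / e)))//.
- by rewrite -EFinB /= mulrBr.
- apply: continuous_subspaceT => x.
  apply: (continuous_comp (f := fun x => x - y)); last exact: continuous_poisson.
  by apply: cvgB; [exact: cvg_id|exact: cvg_cst].
- have fourier_cst : continuous (fun x => pi^-1 * atan ((x - y) / e)).
    move=> x; apply/differentiable_continuous/derivable1_diffP.
    by have [] := dP x.
  split.
  + by move=> x _; have [] := dP x.
  + by apply: cvg_at_right_filter; exact: fourier_cst.
  + by apply: cvg_at_left_filter; exact: fourier_cst.
- by move=> x _; rewrite derive1E; have [] := dP x.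
Qed.

(* The values of the Abel parameter along which limits are taken. *)
Definition epsn (n : nat) : R := n.+1%:R^-1.

Lemma epsn_gt0 n : 0 < epsn n. Proof. by rewrite invr_gt0. Qed.

Lemma atan_div_epsn c : c != 0 ->
  atan (c / epsn n) @[n --> \oo] --> Num.sg c * (pi / 2).
Proof.
have pos (d : R) : 0 < d -> atan (d / epsn n) @[n --> \oo] --> pi / 2.
  move=> d0; apply: (cvg_comp _ _ _ (@cvgy_atan R)).
  have ny : n.+1%:R @[n --> \oo] --> (+oo : set_system R).
    by rewrite (cvg_shiftS (fun n => n%:R : R)); exact: cvgr_idn.
  rewrite (_ : (fun n => d / epsn n) = (fun n => d * n.+1%:R)).
    exact: (cvg_comp _ _ ny (gt0_cvgMry d0 (@cvg_id _ +oo))).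
  by apply/funext => n; rewrite /epsn invrK.
move=> c0; have [cp|cn|/eqP] := ltrgtP 0 c; last by rewrite eq_sym (negbTE c0).
  by rewrite gtr0_sg// mul1r; exact: pos.
rewrite ltr0_sg// mulN1r.
rewrite (_ : (fun n => _) = fun n => - atan (- c / epsn n)).
  by apply: cvgN; apply: pos; rewrite oppr_gt0.
by apply/funext => n; rewrite mulNr atanN opprK.
Qed.

Definition poisson_itv a b n y : R := \int[mu]_(x in `[a, b]) poisson (epsn n) (x - y).

Lemma poisson_itv_norm a b n y : `|poisson_itv a b n y| <= 1.
Proof.
rewrite /poisson_itv.
have [i E] := poisson_shift y (epsn_gt0 n).
have p0 x : 0 <= poisson (epsn n) (x - y) by apply: poisson_ge0; exact: epsn_gt0.
rewrite ger0_norm; last by apply: Rintegral_ge0.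
rewrite -E Rintegral_mkcond; apply: le_Rintegral => //.
- by rewrite -restrict_EFin -integrable_mkcond//; apply: integrableS i.
- by move=> x _; rewrite patchE; case: ifPn.
Qed.

(** Each arctangent in the explicit integral tends to plus or minus pi / 2 according to the side on
    which y lies. At an endpoint the limit would be 1 / 2, hence the exclusions. *)
Lemma cvg_poisson_itv a b y : a < b -> y != a -> y != b ->
  poisson_itv a b n y @[n --> \oo] --> (\1_(`[a, b]%classic) y : R).
Proof.
move=> ab ya yb; rewrite /poisson_itv.
under eq_fun do rewrite Rintegral_poisson_itv ?epsn_gt0//.
have -> : (\1_(`[a, b]%classic) y : R) =
    pi^-1 * (Num.sg (b - y) * (pi / 2) - Num.sg (a - y) * (pi / 2)).
  have pi0 : pi != 0 :> R by rewrite gt_eqF ?pi_gt0.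
  rewrite indicE; have [y_a|y_a] := ltP y a.
    rewrite memNset; last by rewrite /= in_itv/= leNgt y_a.
    have y_b := lt_trans y_a ab.
    by rewrite !gtr0_sg ?subr_gt0// subrr mulr0.
  have {}y_a : a < y by rewrite lt_neqAle eq_sym ya.
  have [y_b|y_b] := ltP b y.
    rewrite memNset; last by rewrite /= in_itv/= [y <= b]leNgt y_b andbF.
    by rewrite !ltr0_sg ?subr_lt0// subrr mulr0.
  rewrite mem_set; last by rewrite /= in_itv/= y_b ltW.
  have {}y_b : y < b by rewrite lt_neqAle yb.
  rewrite gtr0_sg ?subr_gt0// ltr0_sg ?subr_lt0//=.
  by move: (@trigo.pi R) pi0 => p pi0; field.
apply: cvgMr; apply: cvgB; apply: atan_div_epsn.
- by rewrite subr_eq0 eq_sym.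
- by rewrite subr_eq0 eq_sym.
Qed.

End poisson_kernel.

(** * The Fourier transform of integrable functions *)

Section fourier_L1.
Variable R : realType.
Local Notation mu := (@lebesgue_measure R).
Local Notation RT := (measurableTypeR R).
Local Notation rI f := (mu.-integrable setT (EFin \o f)).
Local Notation Re := complex.Re.
Implicit Types u v f g : R -> R[i].

Lemma realcM (a b : R) : (a * b)%:C = a%:C * b%:C :> R[i].
Proof. by apply: complexP; rewrite !ReImE; ring. Qed.

Lemma addr_sqr_neq0 (d e : R) : 0 < e -> e ^+ 2 + d ^+ 2 != 0.
Proof. by move=> e0; rewrite gt_eqF// ltr_wpDr ?sqr_ge0// exprn_gt0. Qed.

Lemma cintegrable_bounded u v (c : R) : (forall x, normc (v x) <= c) ->
  cmeas (v : RT -> _) -> cintegrable u -> cintegrable (fun x => v x * u x).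
Proof.
move=> vc mv iu; apply: (cintegrable_dom (g := fun x => c * normc (u x))).
- by apply: cmeasM => //; exact: cintegrable_cmeas.
- by apply: integrableMl_EFin; exact: cintegrable_normc.
- by move=> x; rewrite normcM ler_wpM2r ?normc_ge0.
Qed.

(** The integrand u x * k (x, y) * v y is dominated by c |u x| |v y|, so Fubini applies. The kernels
    in use are exp (i s x y), bounded by 1, and the Poisson kernel, bounded by 1 / (pi e). *)
Lemma kernel_swap (k : RT * RT -> R[i]) (c : R) u v : cmeas k ->
  (forall x y, normc (k (x, y)) <= c) -> cintegrable u -> cintegrable v ->
  cintegrable (fun x => u x * cint (fun y => k (x, y) * v y)) /\
  cint (fun x => u x * cint (fun y => k (x, y) * v y)) =
  cint (fun y => v y * cint (fun x => u x * k (x, y))).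
Proof.
move=> mk kc iu iv.
pose H z := u z.1 * (k z * v z.2).
have mH : cmeas H.
  apply: cmeasM.
    by apply: (cmeas_comp (phi := fst)) (cintegrable_cmeas iu); exact: measurable_fst.
  apply: cmeasM => //.
  by apply: (cmeas_comp (phi := snd)) (cintegrable_cmeas iv); exact: measurable_snd.
have mk1 x : cmeas ((fun y => k (x, y)) : RT -> _).
  exact: (cmeas_comp (measurable_pair1 x) mk).
have mk2 y : cmeas ((fun x => k (x, y)) : RT -> _).
  exact: (cmeas_comp (measurable_pair2 y) mk).
have ia := integrableMl_EFin c (cintegrable_normc iu).
have ib := cintegrable_normc iv.
have Hab x y : normc (H (x, y)) <= c * normc (u x) * normc (v y).
  rewrite /H !normcM mulrA ler_wpM2r ?normc_ge0// mulrC ler_wpM2r ?normc_ge0//.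
have eq1 x : u x * cint (fun y => k (x, y) * v y) = cint (fun y => H (x, y)).
  by rewrite -cintZ//; apply: (cintegrable_bounded (c := c)).
have eq2 y : v y * cint (fun x => u x * k (x, y)) = cint (fun x => H (x, y)).
  rewrite -cintZ.
    by congr cint; apply/funext => x; rewrite /H /= mulrC mulrA.
  have := cintegrable_bounded (kc ^~ y) (mk2 y) iu.
  by under eq_fun do rewrite mulrC.
rewrite (_ : (fun x => _) = (fun x => cint (fun y => H (x, y)))); last first.
  by apply/funext.
rewrite [X in _ = cint X](_ : _ = (fun y => cint (fun x => H (x, y)))); last first.
  by apply/funext.
split; first exact: (cintegrable_cint mH ia ib Hab).
exact: (cint_swap mH ia ib Hab).
Qed.

Definition fourier_cst : R := (Num.sqrt (2 * pi))^-1.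

Definition fourierL1 u (xi : R) : R[i] := fourier_cst%:C * cint (fun x => u x * cexpi (- (xi * x))).

Lemma fourier_cst_gt0 : 0 < fourier_cst.
Proof. by rewrite invr_gt0 sqrtr_gt0 mulr_gt0 ?pi_gt0. Qed.

Lemma fourier_cst2 : fourier_cst * fourier_cst = (2 * pi)^-1.
Proof. by rewrite -expr2 exprVn sqr_sqrtr// mulr_ge0 ?pi_ge0. Qed.

Lemma cmeas_expi_lin (s : R) : cmeas ((fun x => cexpi (s * x)) : RT -> R[i]).
Proof. by apply: cmeas_cexpi; exact: measurable_funM. Qed.

Lemma cmeas_expi_lin2 (s : R) :
  cmeas ((fun z => cexpi (s * (z.1 * z.2))) : RT * RT -> R[i]).
Proof.
apply: cmeas_cexpi; apply: measurable_funM => //.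
by apply: measurable_funM; [exact: measurable_fst|exact: measurable_snd].
Qed.

Lemma cintegrable_expi u (s : R) : cintegrable u ->
  cintegrable (fun x => u x * cexpi (s * x)).
Proof.
move=> iu; have := cintegrable_bounded (c := 1) _ (cmeas_expi_lin s) iu.
under eq_fun do rewrite mulrC; apply => x.
by rewrite normc_cexpi.
Qed.

Lemma fourierL1E u xi : fourierL1 u xi = fourier_cst%:C * cint (fun x => u x * cexpi ((- xi) * x)).
Proof. by rewrite /fourierL1; congr (_ * cint _); apply/funext => x; rewrite mulNr. Qed.

Lemma normc_fourierL1_le u xi : cintegrable u ->
  normc (fourierL1 u xi) <= fourier_cst * (2 * \int[mu]_x normc (u x)).
Proof.
move=> iu; rewrite fourierL1E normcM normcC (ger0_norm (ltW fourier_cst_gt0)).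
rewrite ler_wpM2l ?(ltW fourier_cst_gt0)//.
apply: (le_trans (normc_cint_le (cintegrable_expi (- xi) iu))).
rewrite ler_wpM2l// le_eqVlt; apply/orP; left; apply/eqP.
by apply: eq_Rintegral => x _; rewrite normcM normc_cexpi mulr1.
Qed.

Lemma cintegrable_abel (e : R) : 0 < e -> cintegrable (fun x => (abel e x)%:C).
Proof.
move=> e0; have [+ _] := abel_fourier 0 e0.
by under eq_fun do rewrite mul0r cexpi0 mulr1.
Qed.

Let cexpi_le1 (s x y : R) : normc (cexpi (s * (x * y))) <= 1.
Proof. by rewrite normc_cexpi. Qed.

(** Measurability of an integral in its parameter is read off Fubini, which wants integrability in
    xi as well; the transform is therefore multiplied by [abel 1] and divided by it afterwards. *)
Lemma fourierL1_cmeas u : cintegrable u -> cmeas (fourierL1 u : RT -> _).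
Proof.
move=> iu.
have [+ _] := kernel_swap (c := 1) (k := fun z => cexpi (-1 * (z.1 * z.2)))
  (cmeas_expi_lin2 (-1)) (cexpi_le1 (-1)) (cintegrable_abel ltr01) iu.
move=> /cintegrable_cmeas H.
have -> : fourierL1 u = (fun xi => (fourier_cst / abel 1 xi)%:C * ((abel 1 xi)%:C *
    cint (fun y => cexpi (-1 * (xi * y)) * u y))).
  apply/funext => xi; rewrite mulrA /fourierL1; congr (_ * _).
    by rewrite -realcM mulfVK// gt_eqF ?abel_gt0.
  by congr cint; apply/funext => y; rewrite mulrC mulN1r.
apply: cmeasM; last exact: H.
apply: cmeasC; apply: measurable_funM => //.
apply: continuous_measurable_fun => x; apply: cvgV.
  by rewrite gt_eqF ?abel_gt0.
exact: continuous_abel.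
Qed.

Lemma fourierL1_cmul (c : R[i]) u : cintegrable u -> fourierL1 (fun x => c * u x) = (fun xi => c * fourierL1 u xi).
Proof.
move=> iu; apply/funext => xi; rewrite !fourierL1E mulrCA -(cintZ c (cintegrable_expi _ iu)).
by congr (_ * cint _); apply/funext => x; rewrite mulrA.
Qed.

Lemma fourierL1B u v : cintegrable u -> cintegrable v ->
  fourierL1 (fun x => u x - v x) = (fun xi => fourierL1 u xi - fourierL1 v xi).
Proof.
move=> iu iv; apply/funext => xi; rewrite !fourierL1E -mulrBr -cintB; try exact: cintegrable_expi.
by congr (_ * cint _); apply/funext => x; rewrite mulrBl.
Qed.

Lemma fourierL1_conj u xi : cintegrable u ->
  (fourierL1 u xi)^* = fourier_cst%:C * cint (fun x => (u x)^* * cexpi (xi * x)).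
Proof.
move=> iu; rewrite fourierL1E conj_mul. rewrite conj_real -cintJ; last exact: cintegrable_expi.
congr (_ * cint _).
by apply/funext => x; rewrite conj_mul cexpiJ mulNr opprK.
Qed.

Lemma fourierL1_mult u v : cintegrable u -> cintegrable v ->
  cint (fun x => fourierL1 u x * v x) = cint (fun x => u x * fourierL1 v x).
Proof.
move=> iu iv.
have [_ E] := kernel_swap (k := fun z => cexpi (-1 * (z.1 * z.2)))
  (cmeas_expi_lin2 (-1)) (cexpi_le1 (-1)) (cintegrableZ fourier_cst%:C iu) iv.
transitivity (cint (fun x => fourier_cst%:C * u x * cint (fun y => cexpi (-1 * (x * y)) * v y))).
  rewrite E; congr cint; apply/funext => x; rewrite fourierL1E mulrC; congr (_ * _).
  rewrite -(cintZ _ (cintegrable_expi (- x) iu)).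
  by congr cint; apply/funext => y; rewrite mulrA mulN1r (mulrC y) mulNr.
congr cint; apply/funext => x; rewrite /fourierL1 mulrCA mulrA; congr (_ * cint _).
by apply/funext => y; rewrite mulrC mulN1r.
Qed.

Lemma measurable_poisson_sub (e : R) : 0 < e ->
  measurable_fun setT ((fun z => poisson e (z.2 - z.1)) : RT * RT -> RT).
Proof.
move=> e0; apply: (@measurableT_comp _ _ _ _ _ _ (poisson e)).
  by apply: continuous_measurable_fun; exact: continuous_poisson.
by apply: measurable_funB; [exact: measurable_snd|exact: measurable_fst].
Qed.

Let normc_poisson (e : R) (e0 : 0 < e) x y :
  normc (poisson e (y - x))%:C <= (pi * e)^-1.
Proof. by rewrite normcC ger0_norm ?poisson_ge0// poisson_le. Qed.

(** A regularised Parseval identity. The weight [abel e] makes every double integral absolutely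
    convergent; exchanging the integral over xi with the one defining the transform of g, then with
    the one defining the transform of f, leaves the transform of the weight, which is the Poisson
    kernel up to constants. *)
Lemma poisson_formula (e : R) f g : 0 < e -> cintegrable f -> cintegrable g ->
  cint (fun xi => (abel e xi)%:C * (fourierL1 f xi * (fourierL1 g xi)^*)) =
  cint (fun y => (g y)^* * cint (fun x => (poisson e (x - y))%:C * f x)).
Proof.
move=> e0 jf jg.
pose u xi := fourier_cst%:C * (fourierL1 f xi * (abel e xi)%:C).
have iu : cintegrable u.
  apply: cintegrableZ; apply: cintegrable_bounded.
  - by move=> x; exact: normc_fourierL1_le.
  - exact: fourierL1_cmeas.
  - exact: cintegrable_abel.
have [_ E1] := kernel_swap (k := fun z => cexpi (1 * (z.1 * z.2)))
  (cmeas_expi_lin2 1) (cexpi_le1 1) iu (cintegrableJ jg).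
transitivity (cint (fun x => u x * cint (fun y => cexpi (1 * (x * y)) * (g y)^*))).
  congr cint; apply/funext => xi; rewrite (fourierL1_conj _ jg) /u.
  rewrite (_ : (fun x => (g x)^* * cexpi (xi * x)) =
    (fun y => cexpi (1 * (xi * y)) * (g y)^*)).
    by move: (abel e xi)%:C (fourierL1 f xi) (fourier_cst%:C) (cint _) => p q r s; ring.
  by apply/funext => y; rewrite mul1r mulrC.
rewrite E1; congr cint; apply/funext => y; congr (_ * _).
have [ia _] := abel_fourier y e0.
have [_ E2] := kernel_swap (k := fun z => cexpi (-1 * (z.1 * z.2)))
  (cmeas_expi_lin2 (-1)) (cexpi_le1 (-1)) (cintegrableZ (fourier_cst * fourier_cst)%:C ia) jf.
transitivity (cint (fun x => (fourier_cst * fourier_cst)%:C * ((abel e x)%:C * cexpi (y * x)) *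
    cint (fun y0 => cexpi (-1 * (x * y0)) * f y0))).
  congr cint; apply/funext => xi; rewrite /u /fourierL1 mul1r (mulrC xi y) realcM.
  rewrite (_ : (fun x => f x * cexpi (- (xi * x))) =
    (fun y0 => cexpi (-1 * (xi * y0)) * f y0)).
    by move: (abel e xi)%:C (cexpi _) (fourier_cst%:C) (cint _) => p q r s; ring.
  by apply/funext => x; rewrite mulN1r mulrC.
rewrite E2; congr cint; apply/funext => x; rewrite mulrC; congr (_ * _).
have [ib E3] := abel_fourier (y - x) e0.
transitivity ((fourier_cst * fourier_cst)%:C * cint (fun z => (abel e z)%:C * cexpi ((y - x) * z))).
  rewrite -(cintZ _ ib); congr cint; apply/funext => z.
  rewrite mulN1r mulrBl cexpiD (mulrC z x).
  by move: (abel e z)%:C (cexpi _) (cexpi _) ((fourier_cst * fourier_cst)%:C) => p q r s; ring.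
rewrite E3 -realcM fourier_cst2 /poisson; congr (_%:C).
have -> : (x - y) ^+ 2 = (y - x) ^+ 2 by rewrite -sqrrN opprB.
have := addr_sqr_neq0 (y - x) e0.
have : pi != 0 :> R by rewrite gt_eqF ?pi_gt0.
move: (@trigo.pi R) ((y - x) ^+ 2) => p q q0 p0.
by field; rewrite ?p0 ?q0.
Qed.

(** Tonelli's theorem for a nonnegative integrand; the kernel is even, so its mass is 1 in either
    variable. *)
Lemma conv_poisson (e : R) (p : R -> R) : 0 < e -> rI p -> (forall x, 0 <= p x) ->
  [/\ forall y, rI (fun x => poisson e (x - y) * p x),
      rI (fun y => \int[mu]_x (poisson e (x - y) * p x)) &
      \int[mu]_y \int[mu]_x (poisson e (x - y) * p x) = \int[mu]_x p x].
Proof.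
move=> e0 ip p0; have mp := integrable_measurable ip.
have K0 x y : 0 <= poisson e (x - y) * p x.
  by apply: mulr_ge0 => //; exact: poisson_ge0.
have mQ := measurable_poisson_sub e0.
have mQ1 (y : R) : measurable_fun setT (fun x : RT => poisson e (x - y) : RT).
  exact: measurableT_comp mQ (measurable_pair1 y).
have h1 y : rI (fun x => poisson e (x - y) * p x).
  apply: (integrable_dom _ (integrableMl_EFin (pi * e)^-1 ip)).
    exact: (measurable_funM (mQ1 y) mp).
  move=> x; rewrite ger0_norm ?K0//.
  by rewrite ler_wpM2r// poisson_le.
pose K (z : RT * RT) := (poisson e (z.2 - z.1) * p z.2)%:E.
have mK : measurable_fun setT K.
  apply/measurable_EFinP; apply: measurable_funM => //.
  exact: measurableT_comp mp measurable_snd.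
have KE0 z : (0 <= K z)%E by rewrite lee_fin.
have T := @fubini_tonelli _ _ _ _ _ mu mu K mK KE0.
have TE : (\int[mu]_y \int[mu]_z K (y, z) = \int[mu]_x (p x)%:E)%E.
  rewrite T; apply: eq_integral => w _; rewrite /K /=.
  transitivity (\int[mu]_y ((p w)%:E * (poisson e (w - y))%:E))%E.
    by apply: eq_integral => v _; rewrite mulrC EFinM.
  have [i1 E] := poisson_shift w e0.
  have pE : (\int[mu]_y (poisson e (w - y))%:E = 1)%E.
    rewrite -E fineK; last exact: integrable_fin_num.
    by apply: eq_integral => v _; rewrite -poissonN opprB.
  rewrite ge0_integralZl_EFin; [by rewrite pE mule1|by []|..|exact: p0].
  - by move=> v _; rewrite lee_fin poisson_ge0.
  - by apply/measurable_EFinP; exact: measurableT_comp mQ (measurable_pair2 w).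
clear T.
have KE s : (\int[mu]_r K (s, r))%E = (\int[mu]_r (poisson e (r - s) * p r))%:E.
  by rewrite /Rintegral fineK//; apply: integrable_fin_num => //; exact: h1.
have TE' : (\int[mu]_s (\int[mu]_r (poisson e (r - s) * p r))%:E =
    \int[mu]_r (p r)%:E)%E.
  by rewrite -TE; apply: eq_integral => s _; rewrite KE.
split=> //.
- apply/integrableP; split.
    have := measurable_fun_fubini_tonelli_F K mK KE0 (m2 := mu).
    rewrite /fubini_F; apply: eq_measurable_fun => s _; exact: KE.
  rewrite (_ : (\int[mu]_r `| _ |)%E =
      (\int[mu]_s (\int[mu]_r (poisson e (r - s) * p r))%:E)%E).
    by rewrite TE' -[X in (X < _)%E]fineK ?ltry//; exact: integrable_fin_num.
  apply: eq_integral => s _ /=; rewrite ger0_norm//.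
  by apply: Rintegral_ge0 => r _; exact: K0.
- by rewrite [LHS]/Rintegral TE'.
Qed.

(** With g = f in [poisson_formula], |f x| |f y| is at most the half-sum of the squares, and each
    half integrates to sqnorm f / 2 since the kernel has mass 1 in both variables. The bound does
    not depend on e. *)
Lemma abel_fourierL1_le (e : R) f : 0 < e -> cintegrable f -> memL2 f ->
  rI (fun xi => abel e xi * normc (fourierL1 f xi) ^+ 2) /\
  \int[mu]_xi (abel e xi * normc (fourierL1 f xi) ^+ 2) <= sqnorm f.
Proof.
move=> e0 jf f2.
have ia : rI (fun xi => abel e xi * normc (fourierL1 f xi) ^+ 2).
  set C := fourier_cst * (2 * \int[mu]_x normc (f x)).
  apply: (integrable_dom _ (integrableMl_EFin (C ^+ 2) (integrable_abel e0))).
    apply: measurable_funM; first exact: (integrable_measurable (integrable_abel e0)).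
    by apply: measurable_normc2; exact: fourierL1_cmeas.
  move=> x; rewrite ger0_norm ?mulr_ge0 ?exprn_ge0 ?normc_ge0 ?expR_ge0//.
  rewrite mulrC ler_wpM2r ?expR_ge0// lerXn2r// ?nnegrE ?normc_ge0//.
    by rewrite (le_trans (normc_ge0 _) (normc_fourierL1_le x jf)).
  exact: normc_fourierL1_le.
split=> //.
have [_ f2i] := f2.
have f20 x : 0 <= normc (f x) ^+ 2 by rewrite exprn_ge0 ?normc_ge0.
have [c1 c2 c3] := conv_poisson e0 f2i f20.
have mQ : cmeas ((fun z => (poisson e (z.2 - z.1))%:C) : RT * RT -> _).
  by apply: cmeasC; exact: measurable_poisson_sub.
have [i1 _] := kernel_swap mQ (normc_poisson e0) (cintegrableJ jf) jf.
have -> : \int[mu]_xi (abel e xi * normc (fourierL1 f xi) ^+ 2) =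
    Re (cint (fun y => (f y)^* * cint (fun x => (poisson e (x - y))%:C * f x))).
  rewrite -(poisson_formula e0 jf jf) Re_cint; apply: eq_Rintegral => xi _.
  by rewrite mulcJ -realcM.
rewrite Re_cint.
apply: (@le_trans _ _ (\int[mu]_y (2^-1 * (normc (f y) ^+ 2 +
    \int[mu]_x (poisson e (x - y) * normc (f x) ^+ 2))))).
  apply: le_Rintegral => //; first by case: i1.
    by apply: integrableMl_EFin; apply: integrableD_EFin.
  move=> y _; have [i2 E2] := poisson_shift y e0.
  have iQf : cintegrable (fun x => (poisson e (x - y))%:C * f x).
    apply: (cintegrable_bounded (c := (pi * e)^-1)) => //.
      by move=> x; exact: normc_poisson.
    by apply: cmeasC; exact: (integrable_measurable i2).
  rewrite -(cintZ _ iQf) Re_cint.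
  have -> : normc (f y) ^+ 2 = \int[mu]_x (normc (f y) ^+ 2 * poisson e (x - y)).
    by rewrite RintegralZl// E2 mulr1.
  rewrite -RintegralD//; last exact: integrableMl_EFin.
  rewrite -RintegralZl//; last by apply: integrableD_EFin => //; exact: integrableMl_EFin.
  apply: le_Rintegral => //.
  - by have [] := cintegrableZ (f y)^* iQf.
  - by apply: integrableMl_EFin; apply: integrableD_EFin => //; exact: integrableMl_EFin.
  - move=> x _; apply: (le_trans (ler_norm _)); apply: (le_trans (normc_Re _)).
    rewrite !normcM normc_conj normcC ger0_norm ?poisson_ge0//.
    move: (poisson e (x - y)) (poisson_ge0 (x - y) e0) (normc (f x)) (normc (f y)).
    move=> q q0 r s.
    rewrite -subr_ge0 (_ : _ - _ = 2^-1 * (q * (r - s) ^+ 2)); last by field.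
    apply: mulr_ge0; first by rewrite invr_ge0.
    by apply: mulr_ge0 => //; exact: sqr_ge0.
rewrite RintegralZl//; last exact: integrableD_EFin.
rewrite RintegralD// c3 -/(sqnorm f) le_eqVlt; apply/orP; left; by apply/eqP; field.
Qed.

Lemma cvg_epsn : epsn R n @[n --> \oo] --> (0 : R).
Proof. exact: cvg_harmonic. Qed.

Lemma cvg_abel_epsn x : abel (epsn R n) x @[n --> \oo] --> (1 : R).
Proof.
rewrite -expR0 -oppr0 -(mul0r `|x|).
apply: continuous_cvg; first exact: continuous_expR.
by apply: cvgN; apply: cvgMl; exact: cvg_epsn.
Qed.

(** Fatou's lemma, as the Abel parameter tends to 0, in the uniform bound [abel_fourierL1_le]. *)
Lemma fourierL1_contraction f : cintegrable f -> memL2 f ->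
  memL2 (fourierL1 f) /\ sqnorm (fourierL1 f) <= sqnorm f.
Proof.
move=> jf f2.
have mF := fourierL1_cmeas jf.
have le : (\int[mu]_xi (normc (fourierL1 f xi) ^+ 2)%:E <= (sqnorm f)%:E)%E.
  pose G n xi := (abel (epsn R n) xi * normc (fourierL1 f xi) ^+ 2)%:E.
  have P n := abel_fourierL1_le (epsn_gt0 R n) jf f2.
  have mG n : measurable_fun setT (G n).
    by apply/measurable_EFinP; exact: (integrable_measurable (P n).1).
  have G0 n x : setT x -> (0 <= G n x)%E.
    by rewrite lee_fin mulr_ge0 ?exprn_ge0 ?normc_ge0 ?expR_ge0.
  have H := @fatou _ _ _ mu setT measurableT G mG G0.
  apply: (@le_trans _ _ (limn_einf (fun k => \int[mu]_x G k x)%E)); last first.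
    apply: limn_einf_le => k; have [Pi Pl] := P k.
    rewrite -(fineK (integrable_fin_num _ Pi))//.
  apply: le_trans H; rewrite le_eqVlt; apply/orP; left; apply/eqP.
  apply: eq_integral => x _.
  have GG : G k x @[k --> \oo] --> (normc (fourierL1 f x) ^+ 2)%:E.
    apply: cvg_EFin; first exact: nearW.
    rewrite -[X in _ --> X]mul1r; apply: cvgMl; exact: cvg_abel_epsn.
  by rewrite [RHS](cvg_limn_einf_sup GG).1.
have F2 : memL2 (fourierL1 f) by apply: memL2_lty => //; exact: le_lt_trans le (ltry _).
by split=> //; rewrite -lee_fin -integral_sqnorm.
Qed.

End fourier_L1.

(** * Plancherel extension to square-integrable functions *)

Section plancherel.
Variable R : realType.
Local Notation mu := (@lebesgue_measure R).
Local Notation RT := (measurableTypeR R).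
Local Notation rI f := (mu.-integrable setT (EFin \o f)).
Local Notation Re := complex.Re.
Local Notation Im := complex.Im.
Implicit Types u v f g : R -> R[i].

Definition ind (a b : R) : R -> R[i] := fun x => (\1_(`[a, b]%classic) x)%:C.

Lemma ind_cmeas a b : cmeas (ind a b : RT -> _).
Proof. by apply: cmeasC. Qed.

Lemma normc_ind a b x : normc (ind a b x) <= 1.
Proof. by rewrite /ind normcC indicE ger0_norm// lern1; case: (_ \in _). Qed.

Lemma ind_conj a b x : (ind a b x)^* = ind a b x.
Proof. by rewrite /ind conj_real. Qed.

Lemma integrable_indic_cc (a b : R) : rI (\1_(`[a, b]%classic) : R -> R).
Proof. exact: integrable_indic_itv. Qed.

Lemma ind_memL2 a b : memL2 (ind a b).
Proof.
apply: (memL2_dom _ (integrable_indic_cc a b)); first exact: ind_cmeas.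
by move=> x; rewrite /ind normcC indicE; case: (_ \in _); rewrite ?normr1 ?normr0 ?expr1n ?expr0n.
Qed.

Lemma cintegrable_ind a b : cintegrable (ind a b).
Proof.
apply: (cintegrable_dom _ (integrable_indic_cc a b)); first exact: ind_cmeas.
by move=> x; rewrite /ind normcC indicE; case: (_ \in _); rewrite ?normr1 ?normr0.
Qed.

Lemma Re_mul_ind u a b x : Re (u x * ind a b x) = ((fun x => Re (u x)) \_ `[a, b]) x.
Proof.
by rewrite /ind cReM cReC cImC mulr0 subr0 patchE indicE; case: ifP; rewrite ?mulr1 ?mulr0.
Qed.

Lemma Im_mul_ind u a b x : Im (u x * ind a b x) = ((fun x => Im (u x)) \_ `[a, b]) x.
Proof.
by rewrite /ind cImM cReC cImC mulr0 add0r patchE indicE; case: ifP; rewrite ?mulr1 ?mulr0.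
Qed.

Lemma Re_cint_mul_ind u a b : Re (cint (fun x => u x * ind a b x)) =
  \int[mu]_(x in `[a, b]) Re (u x).
Proof.
by rewrite Re_cint [RHS]Rintegral_mkcond; apply: eq_Rintegral => x _; exact: Re_mul_ind.
Qed.

Lemma Im_cint_mul_ind u a b : Im (cint (fun x => u x * ind a b x)) =
  \int[mu]_(x in `[a, b]) Im (u x).
Proof.
by rewrite Im_cint [RHS]Rintegral_mkcond; apply: eq_Rintegral => x _; exact: Im_mul_ind.
Qed.

Lemma Rintegral_itv_ge (f : R -> R) (a b : R) : b <= a ->
  \int[mu]_(x in `[a, b]) f x = 0.
Proof.
rewrite le_eqVlt => /predU1P[->|ba]; first by rewrite set_itv1 Rintegral_set1.
by rewrite set_itv_ge ?Rintegral_set0// bnd_simp -ltNge.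
Qed.

Lemma ae0_ind u : cmeas (u : RT -> _) ->
  (forall a b, cintegrable (fun x => u x * ind a b x)) ->
  (forall a b, a < b -> cint (fun x => u x * ind a b x) = 0) ->
  \forall x \ae mu, u x = 0.
Proof.
move=> [mr mi] iu u0.
have aeF : Filter (nbhs (almost_everywhere mu)).
  exact: ae_filter_ringOfSetsType.
have hr : \forall x \ae mu, Re (u x) = 0.
  apply: ae0_itv => [//|a b|a b].
    apply/(integrable_mkcond _ _).2 => //.
    have [h _] := iu a b; move: h; apply: eq_integrable => // x _ /=.
    by rewrite Re_mul_ind !patchE; case: ifP.
  have [ab|] := ltP a b; last exact: Rintegral_itv_ge.
  by rewrite -Re_cint_mul_ind u0.
have hi : \forall x \ae mu, Im (u x) = 0.
  apply: ae0_itv => [//|a b|a b].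
    apply/(integrable_mkcond _ _).2 => //.
    have [_ h] := iu a b; move: h; apply: eq_integrable => // x _ /=.
    by rewrite Im_mul_ind !patchE; case: ifP.
  have [ab|] := ltP a b; last exact: Rintegral_itv_ge.
  by rewrite -Im_cint_mul_ind u0.
by move: hr hi; apply: filterS2 => x rx ix; exact: complexP.
Qed.

Lemma Rintegral_dominated (f_ : nat -> R -> R) (f g : R -> R) :
  (forall n, measurable_fun setT (f_ n)) -> measurable_fun setT f -> rI g ->
  (\forall x \ae mu, f_ n x @[n --> \oo] --> f x) ->
  (forall n x, `|f_ n x| <= g x) ->
  \int[mu]_x f_ n x @[n --> \oo] --> \int[mu]_x f x.
Proof.
have aeF : Filter (nbhs (almost_everywhere mu)).
  exact: ae_filter_ringOfSetsType.
move=> mf_ mf ig ff fg.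
have h1 n : measurable_fun setT (fun x => (f_ n x)%:E) by exact/measurable_EFinP.
have h2 : measurable_fun setT (fun x => (f x)%:E) by exact/measurable_EFinP.
have h3 : \forall x \ae mu, [set: RT] x -> (f_ n x)%:E @[n --> \oo] --> (f x)%:E.
  by apply: filterS ff => x fx _; apply: cvg_EFin => //; exact: nearW.
have h4 : \forall x \ae mu, forall n, [set: RT] x -> (`|(f_ n x)%:E| <= (EFin \o g) x)%E.
  by apply: aeW => x n _ /=; rewrite lee_fin.
have [i _ H] := @dominated_convergence _ RT R mu setT measurableT
  (fun n x => (f_ n x)%:E) (fun x => (f x)%:E) (EFin \o g) h1 h2 h3 ig h4.
apply: fine_cvg; rewrite /Rintegral fineK//.
exact: integrable_fin_num.
Qed.

Lemma cint_dominated (u_ : nat -> R -> R[i]) u (g : R -> R) :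
  (forall n, cmeas (u_ n : RT -> _)) -> cmeas (u : RT -> _) -> rI g ->
  (\forall x \ae mu, cvgc (u_ ^~ x) (u x)) ->
  (forall n x, normc (u_ n x) <= g x) ->
  cvgc (fun n => cint (u_ n)) (cint u).
Proof.
have aeF : Filter (nbhs (almost_everywhere mu)).
  exact: ae_filter_ringOfSetsType.
move=> mu_ mu' ig uu ug.
have hR : \int[mu]_x Re (u_ n x) @[n --> \oo] --> \int[mu]_x Re (u x).
  apply: (Rintegral_dominated (g := g)) => //.
  - by move=> n; case: (mu_ n).
  - by case: mu'.
  - apply: filterS uu => x ux; apply/cvgrPdist_le => e e0.
    move/cvgr0Pnorm_le : ux => /(_ e e0); apply: filterS => n.
    rewrite ger0_norm ?normc_ge0// => H; apply: le_trans H.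
    by rewrite distrC (le_trans _ (normc_Re _))// cReD cReN.
  - by move=> n x; exact: le_trans (normc_Re _) (ug n x).
have hI : \int[mu]_x Im (u_ n x) @[n --> \oo] --> \int[mu]_x Im (u x).
  apply: (Rintegral_dominated (g := g)) => //.
  - by move=> n; case: (mu_ n).
  - by case: mu'.
  - apply: filterS uu => x ux; apply/cvgrPdist_le => e e0.
    move/cvgr0Pnorm_le : ux => /(_ e e0); apply: filterS => n.
    rewrite ger0_norm ?normc_ge0// => H; apply: le_trans H.
    by rewrite distrC (le_trans _ (normc_Im _))// cImD cImN.
  - by move=> n x; exact: le_trans (normc_Im _) (ug n x).
apply: (@squeeze0 _ _ (fun n => 1 * `|\int[mu]_x Re (u_ n x) - \int[mu]_x Re (u x)| +
    1 * `|\int[mu]_x Im (u_ n x) - \int[mu]_x Im (u x)|)).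
  move=> n; rewrite normc_ge0 !mul1r.
  by rewrite (le_trans (normc_le _))// !cReD !cReN !cImD !cImN !Re_cint !Im_cint.
by apply: cvgr0MD; apply/norm_cvg0P; apply/subr_cvg0.
Qed.

(** In [poisson_formula] the kernel is moved onto the indicator: u is then integrated against the
    Poisson integral of the indicator, which is bounded by 1 and tends to the indicator off two
    points, so dominated convergence concludes. *)
Lemma abel_weak_inversion u a b : a < b -> cintegrable u ->
  cvgc (fun n => cint (fun xi => (abel (epsn R n) xi)%:C *
    (fourierL1 u xi * (fourierL1 (ind a b) xi)^*))) (cint (fun x => u x * ind a b x)).
Proof.
have aeF : Filter (nbhs (almost_everywhere mu)).
  exact: ae_filter_ringOfSetsType.
move=> ab iu.
have jJ := cintegrable_ind a b.
have mc n : cmeas ((fun x => (poisson_itv a b n x)%:C) : RT -> _).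
  apply: cmeasC.
  have mQ : cmeas ((fun z => (poisson (epsn R n) (z.2 - z.1))%:C) : RT * RT -> _).
    by apply: cmeasC; apply: measurable_poisson_sub; exact: epsn_gt0.
  have [P0 _] := poisson_shift 0 (epsn_gt0 R n).
  have [] := conv_poisson (epsn_gt0 R n) (integrable_indic_cc a b) _.
    by move=> x; rewrite indicE.
  move=> _ /integrable_measurable + _; apply: eq_measurable_fun => y _.
  rewrite /poisson_itv [RHS]Rintegral_mkcond; apply: eq_Rintegral => x _.
  by rewrite patchE indicE; case: ifP; rewrite ?mulr1 ?mulr0.
rewrite (_ : (fun n => _) =
    (fun n => cint (fun x => (poisson_itv a b n x)%:C * u x))); last first.
  apply/funext => n; have e0 := epsn_gt0 R n.
  rewrite (poisson_formula e0 iu jJ).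
  have mQ : cmeas ((fun z => (poisson (epsn R n) (z.2 - z.1))%:C) : RT * RT -> _).
    by apply: cmeasC; exact: measurable_poisson_sub.
  have Qb x y : normc (poisson (epsn R n) (y - x))%:C <= (pi * epsn R n)^-1.
    by rewrite normcC ger0_norm ?poisson_ge0// poisson_le.
  have [_ ->] := kernel_swap (k := fun z => (poisson (epsn R n) (z.2 - z.1))%:C)
    mQ Qb (cintegrableJ jJ) iu.
  congr cint; apply/funext => x; rewrite mulrC; congr (_ * _).
  apply: complexP.
    rewrite Re_cint cReC /poisson_itv [RHS]Rintegral_mkcond.
    apply: eq_Rintegral => y _.
    rewrite ind_conj mulrC.
    rewrite [LHS](Re_mul_ind (fun y => (poisson (epsn R n) (x - y))%:C)).
    rewrite !patchE; case: ifP => // _.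
    by rewrite cReC -poissonN opprB.
  rewrite Im_cint cImC; transitivity (\int[mu]_(y in setT) (0 : R)).
    by apply: eq_Rintegral => y _; rewrite ind_conj cImM !cImC mulr0 mul0r addr0.
  by rewrite Rintegral_cst// mul0r.
apply: (cint_dominated (g := fun x => normc (u x))).
- by move=> n; apply: cmeasM; [exact: mc|exact: cintegrable_cmeas].
- by apply: cmeasM; [exact: cintegrable_cmeas|exact: ind_cmeas].
- exact: cintegrable_normc.
- have ne (c : R) : \forall x \ae mu, x != c.
    exists [set c]; split; [exact: measurable_set1|exact: lebesgue_measure_set1|].
    by move=> x /= /negP; rewrite negbK => /eqP.
  move: (ne a) (ne b); apply: filterS2 => x xa xb.
  rewrite /cvgc.
  have H := cvg_poisson_itv ab xa xb.
  rewrite (_ : (fun n => _) = fun n =>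
      `|poisson_itv a b n x - \1_(`[a, b]%classic) x| * normc (u x)).
    rewrite -(mul0r (normc (u x))); apply: cvgMl.
    by apply/norm_cvg0P; apply/subr_cvg0.
  apply/funext => n; rewrite -normcC -normcM; congr normc.
  rewrite /ind [X in _ - X]mulrC -mulrBl; congr (_ * _).
  by apply: complexP; rewrite !ReImE ?subr0.
- move=> n x; rewrite normcM normcC ler_piMl ?normc_ge0//.
  exact: poisson_itv_norm.
Qed.

Lemma fourierL1_inj u : cintegrable u -> (forall xi, fourierL1 u xi = 0) ->
  \forall x \ae mu, u x = 0.
Proof.
move=> iu u0; apply: ae0_ind.
- exact: cintegrable_cmeas.
- move=> a b; have := cintegrable_bounded (normc_ind a b) (ind_cmeas a b) iu.
  by congr cintegrable; apply/funext => x; rewrite mulrC.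
move=> a b ab; have H := abel_weak_inversion ab iu.
apply: (cvgc_unique H); apply: cvgc_cst => n.
rewrite (_ : (fun xi => _) = fun=> 0 * 0).
  by rewrite cintZ ?mul0r//; split; exact: integrable0.
by apply/funext => xi; rewrite u0 mul0r mulr0 mul0r.
Qed.

(** Both sides are limits of the same regularised pairing: one by [abel_weak_inversion], the other
    by dominated convergence, since the two transforms are square-integrable and their product is
    integrable. *)
Lemma fourierL1_ind_inner g a b : a < b -> cintegrable g -> memL2 g ->
  cint (fun xi => fourierL1 g xi * (fourierL1 (ind a b) xi)^*) = cint (fun x => g x * ind a b x).
Proof.
move=> ab ig g2; have H := abel_weak_inversion ab ig.
have [Fg2 _] := fourierL1_contraction ig g2.
have [FJ2 _] := fourierL1_contraction (cintegrable_ind a b) (ind_memL2 a b).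
have iP := memL2_mul Fg2 (memL2J FJ2).
apply: cvgc_unique H.
apply: (cint_dominated (g := fun x => normc (fourierL1 g x * (fourierL1 (ind a b) x)^*))).
- move=> n; apply: cmeasM; last exact: cintegrable_cmeas iP.
  by apply: cmeasC; apply: continuous_measurable_fun; exact: continuous_abel.
- exact: cintegrable_cmeas iP.
- exact: cintegrable_normc.
- apply: aeW => x; rewrite /cvgc.
  rewrite (_ : (fun n => _) = fun n => `|abel (epsn R n) x - 1| *
      normc (fourierL1 g x * (fourierL1 (ind a b) x)^*)).
    rewrite -(mul0r (normc (fourierL1 g x * (fourierL1 (ind a b) x)^*))); apply: cvgMl.
    by apply/norm_cvg0P; apply/subr_cvg0; exact: cvg_abel_epsn.
  apply/funext => n; rewrite -normcC -normcM; congr normc.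
  move: (fourierL1 g x * _) => z; rewrite -[X in _ - X]mul1r -mulrBl; congr (_ * _).
  by apply: complexP; rewrite !ReImE ?subr0.
- move=> n x; rewrite normcM normcC ler_piMl ?normc_ge0//.
  by rewrite ger0_norm ?expR_ge0// abel_le1// epsn_gt0.
Qed.

Definition trunc (n : nat) u : R -> R[i] := fun x => ind (- n%:R) n%:R x * u x.

Lemma trunc_memL2 n u : memL2 u -> memL2 (trunc n u).
Proof.
by apply: memL2_bounded; [exact: normc_ind|exact: ind_cmeas].
Qed.

Lemma trunc_cintegrable n u : memL2 u -> cintegrable (trunc n u).
Proof. by move=> u2; apply: memL2_mul => //; exact: ind_memL2. Qed.

Lemma cvgL2_trunc u : memL2 u -> cvgL2 (fun n => trunc n u) u.
Proof.
move=> u2; have [mu' ui] := u2.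
have mt n : cmeas ((fun x => trunc n u x - u x) : RT -> _).
  by apply: cmeasB => //; exact: (trunc_memL2 n u2).1.
have le1 n x : normc (trunc n u x - u x) <= normc (u x).
  rewrite /trunc /ind indicE; case: (_ \in _); last by rewrite mul0r sub0r normcN.
  by rewrite mul1r subrr normc0 normc_ge0.
have H := @Rintegral_dominated (fun n x => normc (trunc n u x - u x) ^+ 2) (cst 0)
  (fun x => normc (u x) ^+ 2).
rewrite /cvgL2 /sqnorm -(_ : \int[mu]_x (cst 0 x : R) = 0); last first.
  by rewrite Rintegral_cst// mul0r.
apply: H => //.
- by move=> n; exact: measurable_normc2.
- apply: aeW => x /=.
  have [N Nx] : exists N : nat, `|x| < N%:R.
    by exists (Num.truncn `|x|).+1; exact: Num.Theory.truncnS_gt.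
  apply/cvgrPdist_le => e e0; exists N => // n /= Nn.
  rewrite /trunc /ind indicE mem_set.
    by rewrite mul1r subrr normc0 expr0n/= subrr normr0 ltW.
  rewrite /= in_itv/= -ler_norml (le_trans (ltW Nx))//.
  by rewrite ler_nat.
- move=> n x; rewrite ger0_norm ?exprn_ge0 ?normc_ge0//.
  by rewrite lerXn2r// ?nnegrE ?normc_ge0.
Qed.

(** [is_fourier] for functions rather than classes: a relation insensitive to changes on null sets
    by [FT_ae], and determining v up to them by [FT_unique]. *)
Definition is_FT u v :=
  [/\ memL2 u, memL2 v & cvgL2 (fun n => fourierL1 (trunc n u)) v].

Lemma sqnorm_fourierL1B u v : memL2 u -> memL2 v -> cintegrable u -> cintegrable v ->
  sqnorm (fun x => fourierL1 u x - fourierL1 v x) <= sqnorm (fun x => u x - v x).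
Proof.
move=> u2 v2 iu iv.
rewrite (_ : (fun x => fourierL1 u x - fourierL1 v x) = fourierL1 (fun x => u x - v x)).
  by have [] := fourierL1_contraction (cintegrableB iu iv) (memL2B u2 v2).
by rewrite fourierL1B.
Qed.

(** By the contraction property the transforms of two integrable approximations of u come together,
    so the limit does not depend on the approximation. *)
Lemma cvgL2_fourierL1 (u_ : nat -> R -> R[i]) (v_ : nat -> R -> R[i]) u w :
  (forall n, memL2 (u_ n)) -> (forall n, cintegrable (u_ n)) ->
  (forall n, memL2 (v_ n)) -> (forall n, cintegrable (v_ n)) ->
  memL2 u -> memL2 w -> cvgL2 u_ u -> cvgL2 v_ u ->
  cvgL2 (fun n => fourierL1 (u_ n)) w -> cvgL2 (fun n => fourierL1 (v_ n)) w.
Proof.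
move=> u2 iu v2 iv mu' w2 cu cv fourier_cst.
have F2 f : memL2 f -> cintegrable f -> memL2 (fourierL1 f).
  by move=> f2 jf; have [] := fourierL1_contraction jf f2.
have H := cvgr0MD 1 2 (cvgr0MD 4 4 cu cv) fourier_cst.
apply: squeeze0 H => n; rewrite sqnorm_ge0/= mul1r.
apply: (le_trans (sqnormB_le (F2 _ (v2 n) (iv n)) (F2 _ (u2 n) (iu n)) w2)).
rewrite lerD2r (le_trans (ler_wpM2l _ (sqnorm_fourierL1B (v2 n) (u2 n) (iv n) (iu n))))//.
rewrite (le_trans (ler_wpM2l _ (sqnormB_le (v2 n) mu' (u2 n))))//.
rewrite (sqnorm_sym u); move: (sqnorm _) (sqnorm _) => p q; lra.
Qed.

Lemma FT_ex u : memL2 u -> exists v, is_FT u v.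
Proof.
move=> u2.
have t2 n := trunc_memL2 n u2.
have ti n := trunc_cintegrable n u2.
have F2 n : memL2 (fourierL1 (trunc n u)) by have [] := fourierL1_contraction (ti n) (t2 n).
have [||v v2 cv] := @L2_complete R (fun n => fourierL1 (trunc n u)) => //; last by exists v.
move=> e e0; have := cvgL2_trunc u2 => /cvgr0Pnorm_le /(_ (e / 4)) [|N _ HN].
  by rewrite divr_gt0.
exists N => m n Nm Nn; apply: (le_trans (sqnorm_fourierL1B (t2 m) (t2 n) (ti m) (ti n))).
apply: (le_trans (sqnormB_le (t2 m) u2 (t2 n))).
have := HN m Nm; have := HN n Nn; rewrite /= !ger0_norm ?sqnorm_ge0// (sqnorm_sym u).
move: (sqnorm _) (sqnorm _) => p q; lra.
Qed.

(** Frees the transform from the symmetric truncations: an affine substitution moves the truncation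
    interval, and the moved truncations are still an admissible sequence. *)
Lemma FT_limit (u_ : nat -> R -> R[i]) u v :
  (forall n, memL2 (u_ n)) -> (forall n, cintegrable (u_ n)) ->
  memL2 u -> memL2 v -> cvgL2 u_ u -> cvgL2 (fun n => fourierL1 (u_ n)) v -> is_FT u v.
Proof.
move=> h2 hi u2 v2 cu fourier_cst; split; [exact: u2|exact: v2|].
apply: (cvgL2_fourierL1 h2 hi _ _ u2 v2 cu (cvgL2_trunc u2) fourier_cst) => n.
- exact: trunc_memL2.
- exact: trunc_cintegrable.
Qed.

Lemma cvgL2_cst u : cvgL2 (fun=> u) u.
Proof.
have E : sqnorm (fun x => u x - u x) = 0.
  transitivity (\int[mu]_(x in setT) (0 : R)); last by rewrite Rintegral_cst// mul0r.
  by apply: eq_Rintegral => x _; rewrite subrr normc0 expr0n.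
by rewrite /cvgL2 -[X in _ --> X]E; exact: cvg_cst.
Qed.

Lemma FT_L1 u : memL2 u -> cintegrable u -> is_FT u (fourierL1 u).
Proof.
move=> u2 iu; have [F2 _] := fourierL1_contraction iu u2.
by apply: (FT_limit (u_ := fun=> u)) => //; exact: cvgL2_cst.
Qed.

Lemma FT_unique u v w : is_FT u v -> is_FT u w -> \forall x \ae mu, v x = w x.
Proof.
move=> [u2 v2 cv] [_ w2 cw]; apply: (cvgL2_unique _ v2 w2 cv cw) => n.
by have [] := fourierL1_contraction (trunc_cintegrable n u2) (trunc_memL2 n u2).
Qed.

Lemma FT_ae u u' v v' : is_FT u v -> memL2 u' -> memL2 v' ->
  (\forall x \ae mu, u x = u' x) -> (\forall x \ae mu, v x = v' x) -> is_FT u' v'.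
Proof.
have aeF : Filter (nbhs (almost_everywhere mu)).
  exact: ae_filter_ringOfSetsType.
move=> [u2 v2 cv] u2' v2' uu vv; split; [exact: u2'|exact: v2'|].
have ti n := cintegrable_cmeas (trunc_cintegrable n u2).
have ti' n := cintegrable_cmeas (trunc_cintegrable n u2').
have FE n : fourierL1 (trunc n u') = fourierL1 (trunc n u).
  apply/funext => xi; rewrite !fourierL1E; congr (_ * _).
  apply: ae_eq_cint.
  - by apply: cmeasM; [exact: ti'|exact: cmeas_expi_lin].
  - by apply: cmeasM; [exact: ti|exact: cmeas_expi_lin].
  - by apply: filterS uu => x ux; rewrite /trunc ux.
have F2 n : cmeas (fourierL1 (trunc n u) : RT -> _).
  by apply: fourierL1_cmeas; exact: trunc_cintegrable.
rewrite /cvgL2 (_ : (fun n => _) = (fun n => sqnorm (fun x => fourierL1 (trunc n u) x - v x)))//.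
apply/funext => n; rewrite FE; apply: ae_eq_sqnorm.
- by apply: cmeasB => //; exact: v2'.1.
- by apply: cmeasB => //; exact: v2.1.
- by apply: filterS vv => x ->.
Qed.

End plancherel.

(** * Inversion, Parseval identity and affine substitution for the transform in mean square *)

Section fourier_transform.
Variable R : realType.
Local Notation mu := (@lebesgue_measure R).
Local Notation RT := (measurableTypeR R).
Implicit Types u v w : R -> R[i].

Lemma cvgc_cintr f_ u v : (forall n, memL2 (f_ n)) -> memL2 u -> memL2 v ->
  cvgL2 f_ u ->
  cvgc (fun n => cint (fun x => v x * f_ n x)) (cint (fun x => v x * u x)).
Proof.
move=> mf u2 v2 fu.
have C p q : cint (fun x : R => p x * q x) = cint (fun x => q x * p x) :> R[i].
  by congr cint; apply/funext => x; rewrite mulrC.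
have -> : (fun n => cint (fun x => v x * f_ n x)) = (fun n => cint (fun x => f_ n x * v x)).
  by apply/funext => n; exact: C.
by rewrite C; exact: cvgc_cint.
Qed.

Lemma FT_mult u u' v v' : is_FT u u' -> is_FT v v' ->
  cint (fun x => u' x * v x) = cint (fun x => u x * v' x).
Proof.
move=> [u2 u2' cu] [v2 v2' cv].
have tu2 n := trunc_memL2 n u2; have tui n := trunc_cintegrable n u2.
have tv2 n := trunc_memL2 n v2; have tvi n := trunc_cintegrable n v2.
have Fu2 n : memL2 (fourierL1 (trunc n u)) by have [] := fourierL1_contraction (tui n) (tu2 n).
have Fv2 n : memL2 (fourierL1 (trunc n v)) by have [] := fourierL1_contraction (tvi n) (tv2 n).
(* [cvgc_cint] keeps one factor of the pairing fixed, so the truncation of u is removed for each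
   fixed m before that of v. *)
have A m : cint (fun x => u' x * trunc m v x) = cint (fun x => u x * fourierL1 (trunc m v) x).
  apply: (cvgc_unique (cvgc_cint Fu2 u2' (tv2 m) cu)).
  rewrite (_ : (fun n => _) = (fun n => cint (fun x => trunc n u x * fourierL1 (trunc m v) x))).
    exact: (cvgc_cint tu2 u2 (Fv2 m) (cvgL2_trunc u2)).
  by apply/funext => n; exact: fourierL1_mult.
apply: (cvgc_unique (cvgc_cintr tv2 v2 u2' (cvgL2_trunc v2))).
have -> : (fun n => cint (fun x => u' x * trunc n v x)) =
    (fun n => cint (fun x => u x * fourierL1 (trunc n v) x)) by apply/funext => n; exact: A.
exact: (cvgc_cintr Fv2 v2' u2 cv).
Qed.

Lemma FT_ind_inner u u' a b : a < b -> is_FT u u' ->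
  cint (fun xi => u' xi * (fourierL1 (ind a b) xi)^*) = cint (fun x => u x * ind a b x).
Proof.
move=> ab [u2 u2' cu].
have tu2 n := trunc_memL2 n u2; have tui n := trunc_cintegrable n u2.
have Fu2 n : memL2 (fourierL1 (trunc n u)) by have [] := fourierL1_contraction (tui n) (tu2 n).
have [FJ2 _] := fourierL1_contraction (cintegrable_ind a b) (ind_memL2 a b).
apply: (cvgc_unique (cvgc_cint Fu2 u2' (memL2J FJ2) cu)).
have -> : (fun n => cint (fun xi => fourierL1 (trunc n u) xi * (fourierL1 (ind a b) xi)^*)) =
    (fun n => cint (fun x => trunc n u x * ind a b x)).
  by apply/funext => n; exact: fourierL1_ind_inner.
exact: (cvgc_cint tu2 u2 (ind_memL2 a b) (cvgL2_trunc u2)).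
Qed.

(* With F* := conj o F o conj, the transpose of F is F itself, so testing
   F* F u against an interval reduces to [FT_ind_inner]. *)
Lemma FT_inv u u' w : is_FT u u' -> is_FT (fun x => (u' x)^*) w ->
  \forall x \ae mu, w x = (u x)^*.
Proof.
have aeF : Filter (nbhs (almost_everywhere mu)).
  exact: ae_filter_ringOfSetsType.
move=> uu' uw.
have [u2 u2' _] := uu'; have [_ w2 _] := uw.
have J2 := ind_memL2.
have : \forall x \ae mu, w x - (u x)^* = 0.
  have B2 := memL2B w2 (memL2J u2).
  apply: ae0_ind.
  - exact: B2.1.
  - by move=> a b; exact: memL2_mul B2 (J2 _ a b).
  move=> a b ab.
  have JF := FT_L1 (J2 _ a b) (cintegrable_ind a b).
  transitivity (cint (fun x => w x * ind a b x) - cint (fun x => (u x)^* * ind a b x)).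
    rewrite -cintB; [|exact: memL2_mul w2 (J2 _ a b)|
      exact: memL2_mul (memL2J u2) (J2 _ a b)].
    by congr cint; apply/funext => x; rewrite mulrBl.
  apply/eqP; rewrite subr_eq0; apply/eqP.
  rewrite (FT_mult uw JF).
  have [_ FJ2 _] := JF.
  transitivity ((cint (fun x => u' x * (fourierL1 (ind a b) x)^*))^*).
    rewrite -cintJ; last exact: memL2_mul u2' (memL2J FJ2).
    by congr cint; apply/funext => x; rewrite conj_mul conj_invol.
  rewrite (FT_ind_inner ab uu') -cintJ; last exact: memL2_mul u2 (J2 _ a b).
  by congr cint; apply/funext => x; rewrite conj_mul ind_conj.
by apply: filterS => x /eqP; rewrite subr_eq0 => /eqP.
Qed.

(** By [FT_inv] the conjugate of v' transforms into the conjugate of v, so this is the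
    multiplication formula [FT_mult] for u and the conjugate of v'. *)
Lemma FT_inner u u' v v' : is_FT u u' -> is_FT v v' ->
  cint (fun x => u' x * (v' x)^*) = cint (fun x => u x * (v x)^*).
Proof.
have aeF : Filter (nbhs (almost_everywhere mu)).
  exact: ae_filter_ringOfSetsType.
move=> uu' vv'; have [u2 u2' _] := uu'; have [v2 v2' _] := vv'.
have [w vw] := FT_ex (memL2J v2'); have [_ w2 _] := vw.
rewrite (FT_mult uu' vw); apply: ae_eq_cint.
- by apply: cmeasM; [exact: u2.1|exact: w2.1].
- by apply: cmeasM; [exact: u2.1|exact: (memL2J v2).1].
- by apply: filterS (FT_inv vv' vw) => x ->.
Qed.

Lemma FT_sqnorm u u' : is_FT u u' -> sqnorm u' = sqnorm u.
Proof.
move=> uu'; have [u2 u2' _] := uu'; have := FT_inner uu' uu'.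
by rewrite !cint_mulJ// => -[].
Qed.

(** The candidate is the conjugate of the transform of the conjugate of w, which [FT_inv] shows to
    be a preimage. *)
Lemma FT_surj w : memL2 w -> exists u, is_FT u w.
Proof.
have aeF : Filter (nbhs (almost_everywhere mu)).
  exact: ae_filter_ringOfSetsType.
move=> w2; have [v wv] := FT_ex (memL2J w2); have [_ v2 _] := wv.
have [h vh] := FT_ex (memL2J v2); exists (fun x => (v x)^*).
apply: (FT_ae vh (memL2J v2) w2); first exact: aeW.
by apply: filterS (FT_inv wv vh) => x; rewrite conj_invol.
Qed.

Lemma FT_sub u u' v v' : is_FT u u' -> is_FT v v' ->
  is_FT (fun x => u x - v x) (fun x => u' x - v' x).
Proof.
move=> [u2 u2' cu] [v2 v2' cv].
have tu2 n := trunc_memL2 n u2; have tui n := trunc_cintegrable n u2.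
have tv2 n := trunc_memL2 n v2; have tvi n := trunc_cintegrable n v2.
have Fu2 n : memL2 (fourierL1 (trunc n u)) by have [] := fourierL1_contraction (tui n) (tu2 n).
have Fv2 n : memL2 (fourierL1 (trunc n v)) by have [] := fourierL1_contraction (tvi n) (tv2 n).
split; [exact: memL2B|exact: memL2B|].
apply: squeeze0 (cvgr0MD 2 2 cu cv) => n; rewrite sqnorm_ge0 /=.
rewrite (_ : (fun x => _) =
  (fun x => (fourierL1 (trunc n u) x - u' x) + (v' x - fourierL1 (trunc n v) x))).
  rewrite (sqnorm_sym (fourierL1 (trunc n v))).
  by apply: sqnormD_le; exact: memL2B.
have -> : trunc n (fun x => u x - v x) = (fun x => trunc n u x - trunc n v x).
  by apply/funext => x; rewrite /trunc mulrBr.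
rewrite fourierL1B//; apply/funext => x.
by move: (fourierL1 _ _) (fourierL1 _ _) (u' x) (v' x) => p q r s; ring.
Qed.

Lemma FT_scale (c : R[i]) u v : is_FT u v -> is_FT (fun x => c * u x) (fun x => c * v x).
Proof.
move=> [u2 v2 cu]; split; [exact: memL2Z|exact: memL2Z|].
have := cvgr0MD (normc c ^+ 2) 0 cu cu; apply: squeeze0 => n.
have ti := trunc_cintegrable n u2.
have F2 : memL2 (fourierL1 (trunc n u)).
  by have [] := fourierL1_contraction ti (trunc_memL2 n u2).
rewrite sqnorm_ge0 mul0r addr0.
have -> : trunc n (fun x => c * u x) = (fun x => c * trunc n u x).
  by apply/funext => x; rewrite /trunc mulrCA.
rewrite (fourierL1_cmul c ti) -(sqnormZ c (memL2B F2 v2)).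
by rewrite le_eqVlt; apply/orP; left; apply/eqP; congr sqnorm; apply/funext => x;
  rewrite mulrBr.
Qed.

(** The shape [s^-1 * xi + 0] matches the substitution s * x + b, so that [memL2_affine] and
    [cvgL2_affine] also apply on the frequency side. *)
Lemma fourierL1_affine u (s b : R) : s != 0 -> cintegrable u ->
  fourierL1 (fun x => u (s * x + b)) =
  (fun xi => (`|s|^-1%:C * cexpi (s^-1 * b * xi)) * fourierL1 u (s^-1 * xi + 0)).
Proof.
move=> s0 iu; apply/funext => xi; rewrite !fourierL1E addr0.
pose p x := u x * cexpi (- (s^-1 * xi) * x).
have ip : cintegrable p by exact: cintegrable_expi.
pose q x := cexpi (s^-1 * b * xi) * p x.
have iq : cintegrable q by exact: cintegrableZ.
have [_ E] := cint_affine b s0 iq.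
have -> : (fun x => u (s * x + b) * cexpi (- xi * x)) = (fun x => q (s * x + b)).
  apply/funext => x; rewrite /q /p mulrCA -cexpiD; congr (_ * cexpi _).
  by field.
rewrite E cintZ//.
by move: (fourier_cst R)%:C (cint _) (cexpi _) (`|s|^-1%:C) => k l m n; ring.
Qed.

(** The bounded factor c is there for the exponential that a translation produces on the Fourier
    side, together with the constant of the dilation. *)
Lemma cvgL2_affine f_ u (s b : R) (c : R -> R[i]) (M : R) : s != 0 ->
  cmeas (c : RT -> _) -> (forall x, normc (c x) <= M) ->
  (forall n, memL2 (f_ n)) -> memL2 u -> cvgL2 f_ u ->
  cvgL2 (fun n x => c x * f_ n (s * x + b)) (fun x => c x * u (s * x + b)).
Proof.
move=> s0 mc cM f2 u2 cu.
have M0 : 0 <= M by exact: le_trans (normc_ge0 _) (cM 0).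
have := cvgr0MD (M ^+ 2 * `|s|^-1) 0 cu cu; apply: squeeze0 => n.
rewrite sqnorm_ge0 mul0r addr0 -mulrA.
have d2 := memL2B (f2 n) u2.
have [d2' E] := memL2_affine b s0 d2.
rewrite -E; have [_ di] := d2'.
rewrite /sqnorm -RintegralZl//; apply: le_Rintegral => //.
- have := memL2_bounded cM mc d2'; move=> [_].
  by apply: eq_integrable => // x _ /=; rewrite mulrBr.
- exact: integrableMl_EFin.
- move=> x _; rewrite -mulrBr normcM exprMn ler_wpM2r ?exprn_ge0 ?normc_ge0//.
  by rewrite lerXn2r// nnegrE normc_ge0.
Qed.

Lemma FT_affine u u' (s b : R) : s != 0 -> is_FT u u' ->
  is_FT (fun x => u (s * x + b))
    (fun xi => (`|s|^-1%:C * cexpi (s^-1 * b * xi)) * u' (s^-1 * xi + 0)).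
Proof.
move=> s0 [u2 u2' cu].
have tu2 n := trunc_memL2 n u2; have tui n := trunc_cintegrable n u2.
have Fu2 n : memL2 (fourierL1 (trunc n u)) by have [] := fourierL1_contraction (tui n) (tu2 n).
have si0 : s^-1 != 0 by rewrite invr_neq0.
have mc : cmeas ((fun xi => `|s|^-1%:C * cexpi (s^-1 * b * xi)) : RT -> _).
  by apply: cmeasM; [exact: cmeas_cst|exact: cmeas_expi_lin].
have cM xi : normc (`|s|^-1%:C * cexpi (s^-1 * b * xi)) <= `|s|^-1.
  by rewrite normcM normc_cexpi mulr1 normcC ger0_norm ?invr_ge0.
apply: (FT_limit (u_ := fun n x => trunc n u (s * x + b))).
- by move=> n; have [] := memL2_affine b s0 (tu2 n).
- by move=> n; have [] := cint_affine b s0 (tui n).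
- by have [] := memL2_affine b s0 u2.
- by apply: (memL2_bounded cM mc); have [] := memL2_affine 0 si0 u2'.
- have ct := cvgL2_trunc u2.
  have := cvgr0MD `|s|^-1 0 ct ct; apply: squeeze0 => n.
  have [_ E] := memL2_affine b s0 (memL2B (tu2 n) u2).
  by rewrite sqnorm_ge0 mul0r addr0 -E /=.
- have := cvgL2_affine 0 si0 mc cM Fu2 u2' cu.
  by rewrite /cvgL2; under [in X in _ -> X]eq_fun do rewrite fourierL1_affine//.
Qed.

End fourier_transform.

(** * The transform on classes *)

Section fourier_L2.
Variable R : realType.
Local Notation mu := (@lebesgue_measure R).
Implicit Types f g h : L2 R.

Lemma L2_memL2 f : memL2 f.
Proof. by apply: L2pred_memL2; exact: (valP (repr f)). Qed.

Lemma L2_aeP f g : (\forall x \ae mu, f x = g x) -> f = g.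
Proof.
by move=> /L2_eqP; rewrite !reprK.
Qed.

Lemma toL2_ae (u : R -> R[i]) : memL2 u -> \forall x \ae mu, toL2 u x = u x.
Proof. by move=> u2; apply: toL2E; exact: memL2_L2pred. Qed.

Lemma fourier_truncE f n : fourier_trunc f n = fourierL1 (trunc n f).
Proof.
apply/funext => xi; rewrite /fourier_trunc /fourierL1 /fourier_cst; congr (_ * _).
pose u := fun x => f x * cexpi (- (xi * x)).
have -> : (fun x => trunc n f x * cexpi (- (xi * x))) =
    (fun x => u x * ind (- n%:R) n%:R x).
  apply/funext => x; rewrite /trunc /u.
  by move: (ind _ _ x) (f x) (cexpi _) => p q r; ring.
by apply: complexP; rewrite ?Re_cint_mul_ind ?Im_cint_mul_ind.
Qed.

Lemma is_fourierP f g : is_fourier f g <-> is_FT f g.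
Proof.
have F2 n : memL2 (fourierL1 (trunc n f)).
  by have [] := fourierL1_contraction (trunc_cintegrable n (L2_memL2 f))
    (trunc_memL2 n (L2_memL2 f)).
pose a n := sqnorm (fun xi => fourierL1 (trunc n f) xi - g xi).
have E : (fun n => eL2norm (fun xi => fourier_trunc f n xi - g xi)) =
    (fun n => (Num.sqrt (a n))%:E).
  apply/funext => n; rewrite fourier_truncE eL2norm_sqnorm//.
  by apply: memL2B => //; exact: L2_memL2.
rewrite /is_fourier E; split.
- move=> /fine_cvg /= H; split; [exact: L2_memL2|exact: L2_memL2|].
  have HH : Num.sqrt (a n) * Num.sqrt (a n) @[n --> \oo] --> (0 : R) * 0.
    exact: (cvgM H H).
  rewrite mulr0 in HH; rewrite /cvgL2.
  rewrite (_ : (fun n => _) = (fun n => Num.sqrt (a n) * Num.sqrt (a n)))//.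
  by apply/funext => n; rewrite -expr2 sqr_sqrtr// sqnorm_ge0.
- move=> [_ _ H].
  have HS : Num.sqrt (a n) @[n --> \oo] --> Num.sqrt (0 : R).
    by apply: continuous_cvg; [exact: sqrt_continuous|exact: H].
  by rewrite sqrtr0 in HS; apply: cvg_EFin; [exact: nearW|exact: HS].
Qed.

(** The class of any function supplied by [FT_ex] is admissible, so [xget] does select a
    transform. *)
Lemma fourierP f : is_FT f (fourier f).
Proof.
have aeF : Filter (nbhs (almost_everywhere mu)).
  exact: ae_filter_ringOfSetsType.
apply/is_fourierP; rewrite /fourier.
case: xgetP => [g _ //|H].
have [v fv] := FT_ex (L2_memL2 f); have [f2 v2 _] := fv.
exfalso; apply: (H (toL2 v)); apply/is_fourierP.
apply: (FT_ae fv f2 (L2_memL2 _)); first exact: aeW.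
by apply: filterS (toL2_ae v2) => x ->.
Qed.

Lemma fourier_ae f (u v : R -> R[i]) : is_FT u v ->
  (\forall x \ae mu, f x = u x) -> \forall x \ae mu, fourier f x = v x.
Proof.
have aeF : Filter (nbhs (almost_everywhere mu)).
  exact: ae_filter_ringOfSetsType.
move=> uv fu; have [u2 v2 _] := uv.
apply: (FT_unique (fourierP f)).
by apply: (FT_ae uv (L2_memL2 f) v2); [apply: filterS fu => x ->|exact: aeW].
Qed.

Lemma fourier_surj (w : R -> R[i]) : memL2 w ->
  exists f, \forall x \ae mu, fourier f x = w x.
Proof.
have aeF : Filter (nbhs (almost_everywhere mu)).
  exact: ae_filter_ringOfSetsType.
move=> w2; have [u uw] := FT_surj w2; have [u2 _ _] := uw.
by exists (toL2 u); apply: fourier_ae uw _; exact: toL2_ae.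
Qed.

Lemma fourier_inner f g :
  cint (fun x => fourier f x * (fourier g x)^*) = inner f g.
Proof. exact: FT_inner (fourierP f) (fourierP g). Qed.

Lemma L2norm_sqnorm f : L2norm f = Num.sqrt (sqnorm f).
Proof. by rewrite /L2norm eL2norm_sqnorm//; exact: L2_memL2. Qed.

Lemma fourier_inj f g : (\forall x \ae mu, fourier f x = fourier g x) -> f = g.
Proof.
have aeF : Filter (nbhs (almost_everywhere mu)).
  exact: ae_filter_ringOfSetsType.
move=> fg; apply: L2_aeP.
have S := FT_sub (fourierP f) (fourierP g); have [S2 S2' _] := S.
have : sqnorm (fun x => f x - g x) = 0.
  rewrite -(FT_sqnorm S) (@ae_eq_sqnorm _ _ (fun=> 0)).
  - by rewrite /sqnorm normc0 expr0n/= Rintegral_cst// mul0r.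
  - exact: S2'.1.
  - exact: cmeas_cst.
  - by apply: filterS fg => x E; apply/eqP; rewrite subr_eq0; apply/eqP.
move=> /(sqnorm_eq0 S2); apply: filterS => x /eqP.
by rewrite subr_eq0 => /eqP.
Qed.

Lemma fourier_translate a f : \forall xi \ae mu,
  fourier (translate a f) xi = cexpi (- (a * xi)) * fourier f xi.
Proof.
have aeF : Filter (nbhs (almost_everywhere mu)).
  exact: ae_filter_ringOfSetsType.
have := FT_affine (- a) (oner_neq0 R) (fourierP f).
move=> /(fourier_ae (f := translate a f)) H.
have /H : \forall x \ae mu, translate a f x = f (1 * x + - a).
  by apply: filterS (translateE a f) => x ->; rewrite mul1r.
apply: filterS => xi E; apply: (etrans E).
by rewrite normr1 invr1 !mul1r addr0 mulNr.
Qed.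

Lemma fourier_dilate lam f : lam != 0 -> \forall xi \ae mu,
  fourier (dilate lam f) xi = fourier f (lam * xi).
Proof.
have aeF : Filter (nbhs (almost_everywhere mu)).
  exact: ae_filter_ringOfSetsType.
move=> l0; have li0 : lam^-1 != 0 by rewrite invr_neq0.
have A := FT_affine 0 li0 (fourierP f).
pose c := (`|lam|^-1)%:C : R[i].
have := fourier_ae (f := dilate lam f) (FT_scale c A).
have H : \forall x \ae mu, dilate lam f x = c * f (lam^-1 * x + 0).
  by apply: filterS (dilateE f l0) => x ->; rewrite addr0 (mulrC lam^-1).
move=> /(_ H); apply: filterS => xi E; apply: (etrans E).
rewrite invrK mulr0 mul0r cexpi0 mulr1 addr0 mulrA -realcM.
by rewrite normfV invrK mulVf ?normr_eq0// mul1r.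
Qed.

End fourier_L2.

(** * The multiplier of a translation-invariant unitary operator *)

Section multiplier.
Local Opaque fourier translate dilate.
Variable R : realType.
Local Notation mu := (@lebesgue_measure R).
Local Notation RT := (measurableTypeR R).
Local Notation Re := complex.Re.
Local Notation Im := complex.Im.
Implicit Types (f g h : L2 R) (T : L2 R -> L2 R).

Lemma ae_shift (P : R -> Prop) b :
  (\forall x \ae mu, P x) -> \forall x \ae mu, P (x + b).
Proof.
have aeF : Filter (nbhs (almost_everywhere mu)).
  exact: ae_filter_ringOfSetsType.
move=> /(ae_affine b (oner_neq0 R)); apply: filterS => x; by rewrite mul1r.
Qed.

Lemma ae_scale (P : R -> Prop) s : s != 0 ->
  (\forall x \ae mu, P x) -> \forall x \ae mu, P (s * x).
Proof.
have aeF : Filter (nbhs (almost_everywhere mu)).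
  exact: ae_filter_ringOfSetsType.
move=> s0 /(ae_affine 0 s0); apply: filterS => x; by rewrite addr0.
Qed.

Lemma translateK a f : translate a (translate (- a) f) = f.
Proof.
have aeF : Filter (nbhs (almost_everywhere mu)).
  exact: ae_filter_ringOfSetsType.
apply: L2_aeP.
have H := ae_shift (- a) (translateE (- a) f).
move: (translateE a (translate (- a) f)) H; apply: filterS2 => x E1 E2.
by apply: (etrans E1); apply: (etrans E2); rewrite opprK subrK.
Qed.

Lemma translation_invariantE T a f : translation_invariant T ->
  T (translate a f) = translate a (T f).
Proof.
move=> HT; have /(congr1 (fun S => translate a (S f))) /= := HT a.
by rewrite translateK.
Qed.

(** Up to a constant, [inner h (translate a k)] is the Fourier transform at - a of the integrable
    product of the transform of h with the conjugate of that of k. Unitarity and commutation with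
    translations make the transforms of the two products agree at all frequencies, and
    [fourierL1_inj] applies. *)
Lemma unitary_fourier_mul T f g : unitary_op T -> translation_invariant T ->
  \forall x \ae mu, fourier (T f) x * (fourier (T g) x)^* =
                    fourier f x * (fourier g x)^*.
Proof.
have aeF : Filter (nbhs (almost_everywhere mu)).
  exact: ae_filter_ringOfSetsType.
move=> [uT _] tT.
pose P h k (x : R) := fourier h x * (fourier k x)^*.
have iP h k : cintegrable (P h k).
  by apply: memL2_mul; [exact: L2_memL2|apply: memL2J; exact: L2_memL2].
have inn h k a : inner h (translate a k) = cint (fun x => P h k x * cexpi (a * x)).
  rewrite -fourier_inner; apply: ae_eq_cint.
  - apply: cintegrable_cmeas; exact: (iP h (translate a k)).
  - by apply: cmeasM; [exact: cintegrable_cmeas|exact: cmeas_expi_lin].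
  - apply: filterS (fourier_translate a k) => x E.
    apply: (etrans (congr1 (fun z => fourier h x * z^*) E)).
    by rewrite conj_mul cexpiJ opprK mulrA mulrAC.
pose u x := P (T f) (T g) x - P f g x.
have iu : cintegrable u by exact: cintegrableB.
have u0 xi : fourierL1 u xi = 0.
  rewrite fourierL1E (_ : cint _ = 0) ?mulr0//.
  transitivity (cint (fun x => P (T f) (T g) x * cexpi (- xi * x)) -
      cint (fun x => P f g x * cexpi (- xi * x))).
    rewrite -cintB; [|exact: cintegrable_expi|exact: cintegrable_expi].
    by congr cint; apply/funext => x; rewrite /u mulrBl.
  apply/eqP; rewrite subr_eq0; apply/eqP.
  apply: (etrans (esym (inn (T f) (T g) (- xi)))).
  apply: (etrans _ (inn f g (- xi))).
  apply: (etrans (congr1 (inner (T f)) (esym (translation_invariantE _ _ tT)))).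
  exact: uT.
apply: filterS (fourierL1_inj iu u0) => x /eqP; rewrite /u subr_eq0 => /eqP.
exact.
Qed.

Definition is_multiplier T (m : R -> R[i]) :=
  forall f, \forall xi \ae mu, fourier (T f) xi = m xi * fourier f xi.

Lemma abel1_memL2 : memL2 (fun x : R => (abel 1 x)%:C).
Proof.
apply: (memL2_dom _ (integrable_abel (ltr01 : 0 < (1 : R)))).
  exact: cintegrable_cmeas (cintegrable_abel ltr01).
move=> x; rewrite normcC ger0_norm ?expR_ge0// expr2 ler_piMr ?expR_ge0//.
exact: abel_le1.
Qed.

Lemma normc_quotient (p q : R[i]) (a : R) : 0 < a ->
  p * p^* = q * q^* -> q = a%:C -> normc (p * (a^-1)%:C) = 1.
Proof.
move=> a0 E qa.
have : (normc p ^+ 2)%:C = (a ^+ 2)%:C :> R[i].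
  by rewrite -mulcJ E qa mulcJ normcC (gtr0_norm a0).
move=> /(congr1 (@complex.Re R)); rewrite !cReC => /eqP.
rewrite eqrXn2 ?normc_ge0 ?(ltW a0)// => /eqP pa.
by rewrite normcM pa normcC normfV (gtr0_norm a0) divff// gt_eqF.
Qed.

(** Here r = z s with s real and nonzero, so the hypothesis reduces to p times the conjugate of z
    being q; multiplying by z of modulus 1 concludes. *)
Lemma quotient_mul (p q r s z : R[i]) (a : R) : 0 < a -> p * r^* = q * s^* ->
  s = a%:C -> z = r * (a^-1)%:C -> normc z = 1 -> p = z * q.
Proof.
move=> a0 E sa zr nz.
have rz : r = z * a%:C by rewrite zr -mulrA -realcM mulVf ?mulr1// gt_eqF.
have zz : z^* * z = 1 by rewrite mulrC mulcJ nz expr1n.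
have ac : a%:C != 0 :> R[i] by apply/eqP => -[] /eqP; rewrite gt_eqF.
apply: (mulIf ac); move: E; rewrite sa rz conj_mul !conj_real => E.
transitivity (p * (z^* * a%:C) * z).
  by rewrite -[LHS]mulr1 -zz; move: (z^*) (a%:C) => c d; ring.
by rewrite E mulrC mulrA.
Qed.

Lemma multiplier_exists T : unitary_op T -> translation_invariant T ->
  exists m : R -> R[i],
    [/\ cmeas (m : RT -> _), (forall x, normc (m x) = 1) & is_multiplier T m].
Proof.
have aeF : Filter (nbhs (almost_everywhere mu)).
  exact: ae_filter_ringOfSetsType.
move=> uT tT.
have [phi Hphi] := fourier_surj abel1_memL2.
pose m0 x := fourier (T phi) x * ((abel 1 x)^-1)%:C.
have a0 x : (abel 1 x : R) != 0 by rewrite gt_eqF ?abel_gt0.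
have mm0 : cmeas (m0 : RT -> _).
  apply: cmeasM; first exact: (L2_memL2 _).1.
  apply: cmeasC; apply: continuous_measurable_fun => x.
  by apply: cvgV; [exact: a0|exact: continuous_abel].
(* The quotient [m0] has modulus 1 only almost everywhere; resetting it to 1 elsewhere gives modulus
   1 everywhere, which the later pointwise bounds use. *)
pose m x := if normc (m0 x) == 1 then m0 x else 1.
have m1 x : normc (m x) = 1.
  by rewrite /m; case: ifPn => [/eqP//|_]; rewrite normc1.
have m0m : \forall x \ae mu, m0 x = m x.
  move: (unitary_fourier_mul phi phi uT tT) Hphi; apply: filterS2 => x E1 E2.
  have nq : normc (m0 x) = 1 := normc_quotient (abel_gt0 1 x) E1 E2.
  by rewrite /m nq eqxx.
exists m; split => //.
  have mb : measurable_fun setT (fun x : RT => normc (m0 x) == 1).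
    apply: measurable_fun_eqr => //; exact: cmeas_normc.
  split.
  - rewrite (_ : (fun x => _) = fun x => if normc (m0 x) == 1 then Re (m0 x) else 1).
      by apply: measurable_fun_ifT => //; exact: mm0.1.
    by apply/funext => x; rewrite /m; case: ifP.
  - rewrite (_ : (fun x => _) = fun x => if normc (m0 x) == 1 then Im (m0 x) else 0).
      by apply: measurable_fun_ifT => //; exact: mm0.2.
    by apply/funext => x; rewrite /m; case: ifP.
move=> f.
have H1 := unitary_fourier_mul f phi uT tT.
have H2 : \forall x \ae mu, m x = m0 x /\ fourier phi x = (abel 1 x)%:C.
  by move: m0m Hphi; apply: filterS2 => x E1 E2; split; [exact: esym|].
move: H1 H2; apply: filterS2 => x E1 [Em Ephi].
exact: quotient_mul (abel_gt0 1 x) E1 Ephi Em (m1 x).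
Qed.

(** A single function whose transform vanishes nowhere separates multipliers. *)
Lemma multiplier_unique T m m' : is_multiplier T m -> is_multiplier T m' ->
  \forall x \ae mu, m x = m' x.
Proof.
have aeF : Filter (nbhs (almost_everywhere mu)).
  exact: ae_filter_ringOfSetsType.
move=> Hm Hm'; have [phi Hphi] := fourier_surj abel1_memL2.
have H := Hm' phi.
have : \forall x \ae mu, m x * fourier phi x = m' x * fourier phi x.
  move: (Hm phi) H; apply: filterS2 => x E1 E2.
  by apply: (etrans (esym E1)).
have a0 x : (abel 1 x)%:C != 0 :> R[i].
  by apply/eqP => -[] /eqP; rewrite gt_eqF ?abel_gt0.
move: Hphi; apply: filterS2 => x E1 E2.
apply: (mulIf (a0 x)).
apply: (etrans (congr1 (fun z => m x * z) (esym E1))).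
by apply: (etrans E2); exact: (congr1 (fun z => m' x * z) E1).
Qed.

Lemma multiplier_comp T S m k : is_multiplier T m -> is_multiplier S k ->
  is_multiplier (T \o S) (fun x => m x * k x).
Proof.
have aeF : Filter (nbhs (almost_everywhere mu)).
  exact: ae_filter_ringOfSetsType.
move=> Hm Hk f; move: (Hm (S f)) (Hk f); apply: filterS2 => x E1 E2.
apply: (etrans E1); apply: (etrans (congr1 (fun z => m x * z) E2)).
exact: mulrA.
Qed.

(** On the Fourier side [dilate lam] is precomposition with the multiplication by lam, so the two
    dilations cancel on f and act only on m. *)
Lemma multiplier_dilate T m lam : lam != 0 -> is_multiplier T m ->
  is_multiplier (dilate_op lam T) (fun x => m (lam * x)).
Proof.
have aeF : Filter (nbhs (almost_everywhere mu)).
  exact: ae_filter_ringOfSetsType.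
move=> l0 Hm f; rewrite /dilate_op /=.
have li0 : lam^-1 != 0 by rewrite invr_neq0.
pose h := dilate lam^-1 f.
have A1 := fourier_dilate (T h) l0.
have A2 := ae_scale l0 (Hm h).
have A3 := ae_scale l0 (fourier_dilate f li0).
have : \forall x \ae mu, fourier h (lam * x) = fourier f x.
  by apply: filterS A3 => x E; apply: (etrans E); rewrite mulrA mulVf// mul1r.
have : \forall x \ae mu, fourier (dilate lam (T h)) x = m (lam * x) * fourier h (lam * x).
  by move: A1 A2; apply: filterS2 => x E1 E2; apply: (etrans E1).
apply: filterS2 => x E1 E2; apply: (etrans E1).
exact: (congr1 (fun z => m (lam * x) * z) E2).
Qed.

End multiplier.

(** * Averages of the multiplier from local uniform continuity *)

Section luc.
Variable R : realType.
Local Notation mu := (@lebesgue_measure R).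
Local Notation RT := (measurableTypeR R).
Implicit Types (f g h : L2 R) (T : L2 R -> L2 R).
Local Opaque fourier translate dilate.

Lemma sqnorm_mul_ind (u : R -> R[i]) c d :
  sqnorm (fun x => u x * ind c d x) = \int[mu]_(x in `[c, d]) (normc (u x) ^+ 2).
Proof.
rewrite /sqnorm [RHS]Rintegral_mkcond; apply: eq_Rintegral => x _.
rewrite /ind patchE indicE; case: ifP => _; first by rewrite mulr1.
by rewrite mulr0 normc0 expr0n.
Qed.

Lemma L2_sub_ae f g : \forall x \ae mu, L2_repr (f - g) x = f x - g x.
Proof.
have aeF : Filter (nbhs (almost_everywhere mu)).
  exact: ae_filter_ringOfSetsType.
have : \pi_(L2 R) (repr (f - g)) = \pi_(L2 R) (repr f - repr g).
  by rewrite reprK -{1}[f]reprK -{1}[g]reprK !piE.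
by move=> /L2_eqP; apply: filterS => x.
Qed.

Lemma fourier_sub f g : \forall x \ae mu,
  L2_repr (fourier (f - g)) x = fourier f x - fourier g x.
Proof. exact: fourier_ae (FT_sub (fourierP f) (fourierP g)) (L2_sub_ae f g). Qed.

Lemma LUC_average T (m : R -> R[i]) (r e : R) : LUC T -> cmeas (m : RT -> _) ->
  (forall x, normc (m x) = 1) -> is_multiplier T m -> 1 < r -> 0 < e ->
  exists2 del : R, 0 < del & forall lam c d : R, `|lam - 1| < del ->
    r^-1 <= c -> c < d -> d <= r ->
    \int[mu]_(x in `[c, d]) (normc (m (lam * x) - m x) ^+ 2) <= e ^+ 2 * (d - c).
Proof.
have aeF : Filter (nbhs (almost_everywhere mu)).
  exact: ae_filter_ringOfSetsType.
move=> luc mm m1 Hm r1 e0.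
have := luc r r1 1 ltr01 => L.
have near_lt : \forall lam \near (1 : R),
    (opnorm_on (L2band r) (fun f => dilate_op lam T f - dilate_op 1 T f)%R < e%:E)%E.
  have : nbhs (0%E : \bar R) [set y | (y < e%:E)%E].
    by apply: open_nbhs_nbhs; split; [exact: open_ereal_lt_ereal|rewrite /= lte_fin].
  by move=> /L.
have near_gt : \forall lam \near (1 : R), 0 < lam by exact: lt_nbhsr.
have N : nbhs (1 : R) (fun lam => (opnorm_on (L2band r)
    (fun f => dilate_op lam T f - dilate_op 1 T f)%R < e%:E)%E /\ 0 < lam).
  exact: filterI near_lt near_gt.
move/nbhs_ballP : N => [del /= del0 Hdel].
exists del => // lam c d ld rc cd dr.
have [Hop lam0] : (opnorm_on (L2band r)
    (fun f => dilate_op lam T f - dilate_op 1 T f)%R < e%:E)%E /\ 0 < lam.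
  by apply: Hdel; rewrite /ball/= distrC.
(* This factor gives the indicator of [c, d] norm 1. The operator norm bounds all such tests at
   once, so [del] does not depend on the interval. *)
pose k : R := (Num.sqrt (d - c))^-1.
have dc0 : 0 < d - c by rewrite subr_gt0.
have k0 : 0 <= k by rewrite invr_ge0 sqrtr_ge0.
have k2 : k ^+ 2 = (d - c)^-1 by rewrite exprVn sqr_sqrtr// ltW.
pose w x : R[i] := k%:C * ind c d x.
have w2 : memL2 w by apply: memL2Z; exact: ind_memL2.
have nind : sqnorm (ind c d) = d - c.
  transitivity (sqnorm (fun x => 1 * ind c d x)).
    by congr sqnorm; apply/funext => x; rewrite mul1r.
  rewrite sqnorm_mul_ind normc1 expr1n Rintegral_cst//= lebesgue_measure_itv/= lte_fin cd.
  by rewrite -EFinB/= mul1r.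
have nw : sqnorm w = 1.
  by rewrite sqnormZ ?nind ?normcC ?real_normK ?num_real ?k2 ?mulVf ?gt_eqF//; exact: ind_memL2.
have [f Hf] := fourier_surj w2.
have nf : L2norm f = 1.
  rewrite L2norm_sqnorm -(FT_sqnorm (fourierP f)) (ae_eq_sqnorm _ _ Hf) ?nw ?sqrtr1//.
  - exact: (L2_memL2 _).1.
  - exact: w2.1.
have bf : L2band r f.
  rewrite /L2band /=; apply: filterS Hf => x E xr; apply: (etrans E).
  rewrite /w /ind indicE memNset ?mulr0//= in_itv/= => /andP[cx xd].
  have c0 : 0 < c by rewrite (lt_le_trans _ rc)// invr_gt0 (lt_trans ltr01).
  have x0 : 0 <= x by rewrite (le_trans (ltW c0)).
  case: xr; rewrite ger0_norm//.
    by rewrite ltNge (le_trans rc).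
  by rewrite ltNge (le_trans xd).
pose g : L2 R := dilate_op lam T f - dilate_op 1 T f.
have ng : L2norm g <= e.
  rewrite -lee_fin; apply: (le_trans _ (ltW Hop)).
  by apply: ereal_sup_ubound; exists f => //; split=> //; rewrite nf.
have lamn0 : lam != 0 by rewrite gt_eqF.
have Fg : \forall x \ae mu, fourier g x = (m (lam * x) - m x) * w x.
  have H1 := multiplier_dilate lamn0 Hm f.
  have H2 := multiplier_dilate (oner_neq0 R) Hm f.
  have H3 : \forall x \ae mu, fourier (dilate_op lam T f) x = m (lam * x) * w x.
    move: H1 Hf; apply: filterS2 => x E1 E2; apply: (etrans E1).
    exact: (congr1 (fun z => m (lam * x) * z) E2).
  have H4 : \forall x \ae mu, fourier (dilate_op 1 T f) x = m x * w x.
    move: H2 Hf; apply: filterS2 => x E1 E2; apply: (etrans E1).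
    by rewrite mul1r; exact: (congr1 (fun z => m x * z) E2).
  have H5 : \forall x \ae mu, fourier g x = m (lam * x) * w x - fourier (dilate_op 1 T f) x.
    move: (fourier_sub (dilate_op lam T f) (dilate_op 1 T f)) H3.
    apply: filterS2 => x E1 E2; apply: (etrans E1).
    exact: (congr1 (fun z => z - fourier (dilate_op 1 T f) x) E2).
  move: H5 H4; apply: filterS2 => x E1 E2; apply: (etrans E1).
  apply: (etrans (congr1 (fun z => m (lam * x) * w x - z) E2)).
  by rewrite mulrBl.
have mlam : cmeas ((fun x => m (lam * x)) : RT -> _).
  by apply: (cmeas_comp (phi := fun x : RT => lam * x : RT)) => //; exact: measurable_funM.
have mdw : cmeas ((fun x => (m (lam * x) - m x) * w x) : RT -> _).
  by apply: cmeasM; [exact: cmeasB|exact: w2.1].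
have norm_g : sqnorm g <= e ^+ 2.
  have := ng; rewrite L2norm_sqnorm => ng'.
  by rewrite -(sqr_sqrtr (sqnorm_ge0 g)) lerXn2r// nnegrE ?sqrtr_ge0// ltW.
rewrite -ler_pdivrMr//; apply: le_trans norm_g.
rewrite -(FT_sqnorm (fourierP g)) (ae_eq_sqnorm (L2_memL2 _).1 mdw Fg).
rewrite -sqnorm_mul_ind mulrC -k2.
have -> : (fun x => (m (lam * x) - m x) * w x) =
    (fun x => k%:C * ((m (lam * x) - m x) * ind c d x)).
  by apply/funext => x; rewrite /w mulrCA.
rewrite sqnormZ ?normcC ?real_normK ?num_real//.
apply: memL2_bounded (ind_memL2 c d) => [x|]; last exact: cmeasB.
rewrite (le_trans (le_normcD _ _))// normcN !m1; exact: lexx.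
Qed.

End luc.

(** * Continuous representatives from averages *)

Section continuous_representative.
Variable R : realType.
Local Notation mu := (@lebesgue_measure R).
Local Notation RT := (measurableTypeR R).
Local Notation rI f := (mu.-integrable setT (EFin \o f)).
Implicit Types u v : R -> R.

Lemma integrableD_itv (i : interval R) u v :
  mu.-integrable [set` i] (EFin \o u) -> mu.-integrable [set` i] (EFin \o v) ->
  mu.-integrable [set` i] (EFin \o (fun x => u x + v x)).
Proof.
move=> iu iv; have mi : measurable ([set` i] : set RT) by exact: measurable_itv.
by have := integrableD mi iu iv; apply: eq_integrable.
Qed.

Lemma integrableZ_itv (i : interval R) (c : R) u :
  mu.-integrable [set` i] (EFin \o u) ->
  mu.-integrable [set` i] (EFin \o (fun x => c * u x)).
Proof.
move=> iu; have mi : measurable ([set` i] : set RT) by exact: measurable_itv.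
by have := integrableZl mi c iu; apply: eq_integrable.
Qed.

Lemma bounded_integrable_itv v (C a b : R) (b0 b1 : bool) :
  measurable_fun setT v -> (forall x, `|v x| <= C) ->
  mu.-integrable [set` Interval (BSide b0 a) (BSide b1 b)] (EFin \o v).
Proof.
move=> mv vC; set D := [set` _].
have mD : measurable (D : set RT) by exact: measurable_itv.
apply/(integrable_mkcond _ mD); rewrite restrict_EFin.
apply: (integrable_dom (g := fun x => C * \1_D x)).
- by apply/(measurable_restrictT _ mD); exact: measurable_funTS.
- by apply: integrableMl_EFin; exact: integrable_indic_itv.
- move=> x; rewrite patchE indicE; case: ifP => _; first by rewrite mulr1.
  by rewrite normr0 mulr0.
Qed.

(** The definition of a Lebesgue point with the division by the length 2 h cleared. *)
Lemma lebesgue_pt_small u x (eta : R) : measurable_fun setT u ->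
  (forall x, `|u x| <= 1) -> lebesgue_pt u x -> 0 < eta ->
  exists2 h0 : R, 0 < h0 & forall h, 0 < h -> h < h0 ->
    \int[mu]_(s in `]x - h, x + h[) `|u s - u x| <= eta * (2 * h).
Proof.
move=> mu' u1 ux eta0.
have N : \forall r \near (0 : R)^'+, (davg u x r < eta%:E)%E.
  have : nbhs (0%E : \bar R) [set y | (y < eta%:E)%E].
    by apply: open_nbhs_nbhs; split; [exact: open_ereal_lt_ereal|rewrite /= lte_fin].
  by move=> /ux.
move: N; rewrite near_withinE => /nbhs_ballP[h0 /= h00 H].
exists h0 => // h hp hh.
have {H} := H h; rewrite /ball/= sub0r normrN gtr0_norm// => /(_ hh hp).
rewrite /davg /iavg (lebesgue_measure_ball _ (ltW hp)) inver gt_eqF ?mulrn_wgt0// ball_itv.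
rewrite (_ : (\int[_]_(y in _) _)%E =
    (\int[mu]_(s in `]x - h, x + h[) `|u s - u x|)%:E).
  rewrite -EFinM lte_fin mulrC ltr_pdivrMr ?mulrn_wgt0// => /ltW.
  by rewrite mulr_natl.
rewrite /Rintegral fineK//; apply: integrable_fin_num => //.
apply: (@bounded_integrable_itv _ (1 + `|u x|)).
  by apply: measurableT_comp => //; apply: measurable_funB => //; exact: measurable_cst.
by move=> s; rewrite normr_id (le_trans (ler_normB _ _))// lerD2r.
Qed.

Lemma Rintegral_itv_oo_le_cc v (C a b : R) : measurable_fun setT v ->
  (forall x, 0 <= v x <= C) ->
  \int[mu]_(s in `]a, b[) v s <= \int[mu]_(s in `[a, b]) v s.
Proof.
move=> mv vC.
have vC' x : `|v x| <= C by have /andP[v0 ?] := vC x; rewrite ger0_norm.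
rewrite Rintegral_mkcond [leRHS]Rintegral_mkcond; apply: le_Rintegral => //.
- by rewrite -restrict_EFin; apply/(integrable_mkcond _ _).1 => //;
    exact: bounded_integrable_itv vC'.
- by rewrite -restrict_EFin; apply/(integrable_mkcond _ _).1 => //;
    exact: bounded_integrable_itv vC'.
- move=> x _; rewrite !patchE; case: ifPn => xab.
    rewrite mem_set//; move: xab; rewrite inE /= !in_itv/= => /andP[? ?].
    by rewrite !ltW.
  by case: ifP => // _; have /andP[] := vC x.
Qed.

Lemma Rintegral_itv_scale v (C lam x h : R) : measurable_fun setT v ->
  (forall x, `|v x| <= C) -> 0 < lam ->
  \int[mu]_(s in `]x - h, x + h[) v (lam * s) =
  lam^-1 * \int[mu]_(s in `]lam * x - lam * h, lam * x + lam * h[) v s.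
Proof.
move=> mv vC l0; rewrite Rintegral_mkcond [in RHS]Rintegral_mkcond.
have iv : rI (v \_ `]lam * x - lam * h, lam * x + lam * h[).
  by rewrite -restrict_EFin; apply/(integrable_mkcond _ _).1 => //;
    exact: bounded_integrable_itv vC.
have ln : lam != 0 by rewrite gt_eqF.
have [_] := Rintegral_affine 0 ln iv.
rewrite (gtr0_norm l0) => <-; apply: eq_Rintegral => s _.
rewrite !patchE addr0.
suff -> : (s \in `]x - h, x + h[%classic) =
  (lam * s \in `]lam * x - lam * h, lam * x + lam * h[%classic) by [].
apply/idP/idP; rewrite !inE /= !in_itv/= -mulrBr -mulrDr !ltr_pM2l//.
Qed.

(* The substitution s |-> y / x * s maps averages near x to averages near y, so
   that the hypothesis compares the limits of both at Lebesgue points. *)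
Lemma average_close u (x y e del : R) : measurable_fun setT u ->
  (forall x, `|u x| <= 1) -> 0 < x -> 0 < e -> lebesgue_pt u x -> lebesgue_pt u y ->
  0 < y -> 0 < del ->
  (forall h, 0 < h -> h < del ->
    \int[mu]_(s in `[x - h, x + h]) (u (y / x * s) - u s) ^+ 2 <= e ^+ 2 * (2 * h)) ->
  `|u y - u x| <= e.
Proof.
move=> mu' u1 x0 e0 ux uy y0 del0 H.
apply/ler_addgt0Pr => eta eta0.
have eta2 : 0 < eta / 2 by rewrite divr_gt0.
have [h1 h10 H1] := lebesgue_pt_small mu' u1 ux eta2.
have [h2 h20 H2] := lebesgue_pt_small mu' u1 uy eta2.
pose lam := y / x.
have l0 : 0 < lam by rewrite divr_gt0.
(* Averages near x have radius h, below [del] and [h1]; their images near y have radius lam * h,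
   which must be below [h2]. *)
pose h := Num.min del (Num.min h1 (h2 / lam)) / 2.
have m0 : 0 < Num.min del (Num.min h1 (h2 / lam)).
  by rewrite !lt_min del0 h10 divr_gt0.
have h0 : 0 < h by rewrite divr_gt0.
have hm : h < Num.min del (Num.min h1 (h2 / lam)).
  by rewrite /h ltr_pdivrMr// ltr_pMr// ltr1n.
move: hm; rewrite !lt_min => /andP[hd /andP[hh1 hh2]].
have {}H1 := H1 h h0 hh1.
have {}H2 : \int[mu]_(s in `]x - h, x + h[) `|u (lam * s) - u y| <= eta / 2 * (2 * h).
  rewrite (@Rintegral_itv_scale (fun s => `|u s - u y|) (1 + 1))//.
  - have lx : lam * x = y by rewrite /lam divfK// gt_eqF.
    rewrite lx mulrC ler_pdivrMr//.
    apply: (le_trans (H2 (lam * h) _ _)).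
    + by rewrite mulr_gt0.
    + by rewrite mulrC -ltr_pdivlMr.
    + by rewrite le_eqVlt; apply/orP; left; apply/eqP; ring.
  - by apply: measurableT_comp => //; apply: measurable_funB => //; exact: measurable_cst.
  - by move=> s; rewrite normr_id (le_trans (ler_normB _ _))// lerD.
have mlam : measurable_fun setT (fun s => u (lam * s)).
  by apply: (@measurableT_comp _ _ _ _ _ _ u) => //; exact: measurable_funM.
have {}H : \int[mu]_(s in `]x - h, x + h[) `|u (lam * s) - u s| <= e * (2 * h).
  have m1 : measurable_fun setT (fun s => (u (lam * s) - u s) ^+ 2).
    by apply: measurable_funX; exact: measurable_funB.
  have b1 s : `|u (lam * s) - u s| <= 2.
    by rewrite (le_trans (ler_normB _ _))// -[leRHS](_ : 1 + 1 = 2)// lerD.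
  have b2 s : 0 <= (u (lam * s) - u s) ^+ 2 <= 4.
    rewrite sqr_ge0/= -[(_ - _) ^+ 2]ger0_norm ?sqr_ge0// normrX.
    by rewrite (_ : 4 = 2 ^+ 2 :> R) ?lerXn2r ?nnegrE// -natrX.
  have HH := le_trans (Rintegral_itv_oo_le_cc (x - h) (x + h) m1 b2) (H h h0 hd).
  have i1 : mu.-integrable `]x - h, x + h[ (EFin \o (fun s => (u (lam * s) - u s) ^+ 2)).
    apply: (bounded_integrable_itv (C := 4)) => // s.
    by have /andP[? ?] := b2 s; rewrite ger0_norm.
  have i2 : mu.-integrable `]x - h, x + h[ (EFin \o (fun s => (2 * e)^-1 * (u (lam * s) - u s) ^+ 2)).
    exact: integrableZ_itv.
  have i3 : mu.-integrable `]x - h, x + h[ (EFin \o (fun s : R => e / 2)).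
    apply: (bounded_integrable_itv (C := `|e / 2|)) => //; exact: measurable_cst.
  have i4 : mu.-integrable `]x - h, x + h[ (EFin \o (fun s => `|u (lam * s) - u s|)).
    apply: (bounded_integrable_itv (C := 2)) => [|s]; last by rewrite normr_id.
    by apply: measurableT_comp => //; exact: measurable_funB.
  (* The inequality p <= p^2 / (2 e) + e / 2 turns the bound e^2 on the mean square into the bound e
     on the mean. *)
  apply: (@le_trans _ _ (\int[mu]_(s in `]x - h, x + h[)
      ((2 * e)^-1 * (u (lam * s) - u s) ^+ 2 + e / 2))).
    apply: le_Rintegral => //.
      exact: integrableD_itv.
    move=> s _; rewrite -[in leRHS]real_normK ?num_real//.
    move: `|_| => p; rewrite -subr_ge0.
    rewrite (_ : _ - _ = (2 * e)^-1 * (p - e) ^+ 2); last by field; rewrite gt_eqF.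
    by apply: mulr_ge0; [rewrite invr_ge0 mulr_ge0 ?ltW|exact: sqr_ge0].
  rewrite RintegralD// [X in X + _]RintegralZl// Rintegral_cst//=.
  rewrite lebesgue_measure_itv/= lte_fin ltrD2l -EFinB/=.
  have -> : (- h < h) = true by rewrite (lt_trans _ h0)// oppr_lt0.
  have -> : e * (2 * h) = (2 * e)^-1 * (e ^+ 2 * (2 * h)) + e / 2 * (2 * h).
    by field; rewrite gt_eqF.
  rewrite /= (_ : x + h - (x - h) = 2 * h); last by ring.
  by rewrite lerD2r ler_wpM2l// invr_ge0 mulr_ge0 ?ltW.
have mcst (c : R) : measurable_fun setT (fun _ : RT => c) by exact: measurable_cst.
have j1 : mu.-integrable `]x - h, x + h[ (EFin \o (fun s => `|u s - u x|)).
  apply: (bounded_integrable_itv (C := 1 + 1)) => [|s].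
    by apply: measurableT_comp => //; exact: measurable_funB.
  by rewrite normr_id (le_trans (ler_normB _ _))// lerD.
have j2 : mu.-integrable `]x - h, x + h[ (EFin \o (fun s => `|u (lam * s) - u y|)).
  apply: (bounded_integrable_itv (C := 1 + 1)) => [|s].
    by apply: measurableT_comp => //; exact: measurable_funB.
  by rewrite normr_id (le_trans (ler_normB _ _))// lerD.
have j3 : mu.-integrable `]x - h, x + h[ (EFin \o (fun s => `|u (lam * s) - u s|)).
  apply: (bounded_integrable_itv (C := 1 + 1)) => [|s].
    by apply: measurableT_comp => //; exact: measurable_funB.
  by rewrite normr_id (le_trans (ler_normB _ _))// lerD.
have j12 : mu.-integrable `]x - h, x + h[
    (EFin \o (fun s => `|u s - u x| + `|u (lam * s) - u y|)).
  exact: integrableD_itv.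
have j123 : mu.-integrable `]x - h, x + h[
    (EFin \o (fun s => `|u s - u x| + `|u (lam * s) - u y| + `|u (lam * s) - u s|)).
  exact: integrableD_itv.
have len : fine (mu `]x - h, x + h[%classic) = 2 * h.
  rewrite lebesgue_measure_itv/= lte_fin ltrD2l -EFinB/=.
  have -> : (- h < h) = true by rewrite (lt_trans _ h0)// oppr_lt0.
  by rewrite /=; ring.
have HC : \int[mu]_(s in `]x - h, x + h[) `|u y - u x| <=
    \int[mu]_(s in `]x - h, x + h[)
      (`|u s - u x| + `|u (lam * s) - u y| + `|u (lam * s) - u s|).
  apply: le_Rintegral => //.
    by apply: (bounded_integrable_itv (C := `|u y - u x|)) => // s; rewrite normr_id.
  move=> s _.
  have -> : u y - u x = - (u (lam * s) - u y) + (u (lam * s) - u s) + (u s - u x) by ring.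
  rewrite (le_trans (ler_normD _ _))// (le_trans (lerD (ler_normD _ _) (lexx _)))// normrN.
  by rewrite le_eqVlt; apply/orP; left; apply/eqP; ring.
rewrite Rintegral_cst// len RintegralD// RintegralD// in HC.
have := le_trans HC (lerD (lerD H1 H2) H).
rewrite [leRHS](_ : _ = (e + eta) * (2 * h)); last by field.
by rewrite ler_pM2r// mulr_gt0.
Qed.

(** The oscillation condition is assumed at every point of (0, oo), whether or not it lies in G: the
    values of u along a sequence of G tending to x0 are Cauchy, and their limit is taken as M x0.
    Continuity at x compares M x and M y through one point of G close to both. *)
Lemma dense_extension (G : set R) u :
  (forall x0 e, 0 < x0 -> 0 < e -> exists2 eta, 0 < eta & forall x y, G x -> G y ->
     `|x - x0| < eta -> `|y - x0| < eta -> `|u y - u x| <= e) ->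
  (forall x0 eta, 0 < x0 -> 0 < eta -> exists2 y, G y & `|y - x0| < eta) ->
  exists2 M : R -> R, (forall x, 0 < x -> {for x, continuous M}) &
    (forall x, 0 < x -> G x -> M x = u x).
Proof.
move=> uG dG.
have lim x0 : exists l, 0 < x0 -> forall e, 0 < e -> exists2 eta, 0 < eta &
    forall y, G y -> `|y - x0| < eta -> `|u y - l| <= e.
  have [x00|x00] := ltP 0 x0; last by exists 0.
  have ch n : exists y, G y /\ `|y - x0| < n.+1%:R^-1.
    by have [|y Gy yx] := dG x0 n.+1%:R^-1 x00; [rewrite invr_gt0|exists y].
  have [s Hs] := choice ch.
  have small eta : 0 < eta -> exists N : nat, forall n, (N <= n)%N -> `|s n - x0| < eta.
    move=> eta0; exists (Num.truncn eta^-1) => n Nn.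
    apply: lt_le_trans (Hs n).2 _.
    rewrite -[leRHS]invrK lef_pV2 ?posrE ?invr_gt0//.
    by apply: ltW; apply: lt_le_trans (Num.Theory.truncnS_gt _) _; rewrite ler_nat.
  have cu : cvgn (u \o s).
    apply/cauchy_cvgP; apply: cauchy_exP => e e0.
    have e2 : 0 < e / 2 by rewrite divr_gt0.
    have [eta eta0 He] := uG x0 (e / 2) x00 e2.
    have [N HN] := small eta eta0.
    exists (u (s N)); exists N => // n Nn; rewrite /ball/=.
    apply: (le_lt_trans (He _ _ (Hs n).1 (Hs N).1 (HN n Nn) (HN N (leqnn N)))).
    by rewrite ltr_pdivrMr// ltr_pMr// ltr1n.
  exists (limn (u \o s)) => _ e e0.
  have [eta eta0 He] := uG x0 e x00 e0; exists eta => // y Gy yx.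
  have [N HN] := small eta eta0.
  have cl : `|u y - (u \o s) n| @[n --> \oo] --> `|u y - limn (u \o s)|.
    by apply: cvg_norm; apply: cvgB; [exact: cvg_cst|exact: cu].
  rewrite -(cvg_lim (@Rhausdorff R) cl); apply: limr_le; first exact: (cvgP _ cl).
  by exists N => // n Nn /=; apply: He => //; [exact: (Hs n).1|exact: HN].
have [M HM] := choice lim.
have MG x : 0 < x -> G x -> M x = u x.
  move=> x0 Gx; apply/eqP; rewrite eq_sym -subr_eq0 -normr_le0.
  apply/ler_addgt0Pr => e e0; rewrite add0r.
  by have [eta eta0 H] := HM x x0 e e0; apply: H => //; rewrite subrr normr0.
exists M => // x x0; apply/cvgrPdist_le => e e0.
have e2 : 0 < e / 2 by rewrite divr_gt0.
have [eta eta0 H] := HM x x0 (e / 2) e2.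
have near_pos : \forall y \near x, 0 < y by exact: lt_nbhsr.
have near_ball : \forall y \near x, ball x eta y by exact: nbhsx_ballx.
move: near_pos near_ball; apply: filterS2 => y y0; rewrite /ball/= => xy.
have [eta' eta'0 H'] := HM y y0 (e / 2) e2.
have mn : 0 < Num.min eta' (eta - `|x - y|) by rewrite lt_min eta'0 subr_gt0.
have [z Gz] := dG y _ y0 mn; rewrite lt_min => /andP[z1 z2].
have A1 : `|u z - M x| <= e / 2.
  apply: H => //; rewrite -(subrKA y) (le_lt_trans (ler_normD _ _))//.
  by rewrite (distrC y) -ltrBrDr.
have A2 := H' z Gz z1.
rewrite (_ : M x - M y = - (u z - M x) + (u z - M y)); last by ring.
rewrite (le_trans (ler_normD _ _))// normrN [leRHS](_ : e = e / 2 + e / 2); last by field.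
exact: lerD.
Qed.

End continuous_representative.

(** * The continuous representative of the multiplier *)

Section multiplier_representative.
Variable R : realType.
Local Notation mu := (@lebesgue_measure R).
Local Notation RT := (measurableTypeR R).
Local Notation Re := complex.Re.
Local Notation Im := complex.Im.
Implicit Types u v : R -> R.

Lemma locally_integrable_bounded u (C : R) : measurable_fun setT u ->
  (forall x, `|u x| <= C) -> locally_integrable [set: R] u.
Proof.
move=> mu' uC; split=> //; first exact: openT.
move=> K _ cK; have [M [Mr HM]] := compact_bounded cK.
have KM : K `<=` `[- (M + 1), M + 1].
  move=> x Kx /=; rewrite in_itv/= -ler_norml.
  by apply: HM => //; rewrite ltrDl.
have : mu.-integrable K (EFin \o u).
  refine (@integrableS _ RT R mu `[- (M + 1), M + 1]%classic K _ _ _ KM _) => //.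
    exact: compact_measurable.
  exact: bounded_integrable_itv uC.
by move=> /integrableP [].
Qed.

(** A ball has positive measure and so cannot lie in a null set. *)
Lemma ae_dense (P : R -> Prop) : (\forall x \ae mu, P x) ->
  forall x0 eta : R, 0 < eta -> exists2 y, P y & `|y - x0| < eta.
Proof.
move=> [N [mN N0 PN]] x0 eta eta0; apply: contrapT => H.
have sub : ball x0 eta `<=` N.
  move=> y xy; apply: PN => Py; apply: H; exists y => //.
  by move: xy; rewrite /ball/= distrC.
have : (mu (ball x0 eta) <= mu N)%E.
  apply: le_measure => //; rewrite inE//.
  by rewrite ball_itv; exact: measurable_itv.
by rewrite N0 (lebesgue_measure_ball _ (ltW eta0)) lee_fin leNgt mulrn_wgt0.
Qed.

(** The two functions are compared at a point of the full-measure set arbitrarily close to x, found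
    by [ae_dense]. *)
Lemma ae_cont_eq (f g : R -> R) :
  (forall x, 0 < x -> {for x, continuous f}) ->
  (forall x, 0 < x -> {for x, continuous g}) ->
  (\forall x \ae mu, 0 < x -> f x = g x) -> forall x, 0 < x -> f x = g x.
Proof.
move=> cf cg fg x x0; apply/eqP; rewrite -subr_eq0 -normr_le0.
apply/ler_addgt0Pr => e e0; rewrite add0r.
have e2 : 0 < e / 2 by rewrite divr_gt0.
have := cf x x0 => /cvgrPdist_le /(_ _ e2) nf.
have := cg x x0 => /cvgrPdist_le /(_ _ e2) ng.
have np : \forall y \near x, 0 < y by exact: lt_nbhsr.
have N : nbhs x (fun y => (`|f x - f y| <= e / 2 /\ `|g x - g y| <= e / 2) /\ 0 < y).
  by apply: filterI => //; exact: filterI.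
move/nbhs_ballP : N => [del /= del0 Hdel].
have [y Ey yx] := ae_dense fg x del0.
have [|[h1 h2] h3] := Hdel y; first by rewrite /ball/= distrC.
rewrite (_ : f x - g x = (f x - f y) - (g x - g y)); last by rewrite Ey//; ring.
rewrite (le_trans (ler_normB _ _))// [leRHS](_ : e = e / 2 + e / 2); last by field.
exact: lerD.
Qed.

Lemma continuous_of_average u :
  measurable_fun setT u -> (forall x, `|u x| <= 1) ->
  (forall r e : R, 1 < r -> 0 < e ->
    exists2 del : R, 0 < del & forall lam c d : R, `|lam - 1| < del ->
      r^-1 <= c -> c < d -> d <= r ->
      \int[mu]_(x in `[c, d]) (u (lam * x) - u x) ^+ 2 <= e ^+ 2 * (d - c)) ->
  exists2 M : R -> R, (forall x, 0 < x -> {for x, continuous M}) &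
    \forall x \ae mu, 0 < x -> u x = M x.
Proof.
move=> mu' u1 H.
have aeF : Filter (nbhs (almost_everywhere mu)).
  exact: ae_filter_ringOfSetsType.
have lu := lebesgue_differentiation (locally_integrable_bounded mu' u1).
have [|x0 eta x00 eta0|M cM MG] := @dense_extension R (lebesgue_pt u) u.
- move=> x0 e x00 e0.
  (* Large enough for [x0 / 2, 2 * x0] to lie in [r^-1, r]; the + 1 ensures 1 < r. *)
  pose r := Num.max (2 * x0) (2 / x0) + 1.
  have r1 : 1 < r.
    by rewrite ltrDr lt_max mulr_gt0.
  have r2 : 2 * x0 <= r by rewrite /r (le_trans (_ : _ <= Num.max (2 * x0) (2 / x0)))// ?le_max ?lexx// lerDl.
  have r3 : r^-1 <= x0 / 2.
    rewrite -[leRHS]invrK lef_pV2 ?posrE ?invr_gt0 ?divr_gt0 ?(lt_trans ltr01 r1)//.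
    rewrite invfM invrK mulrC /r (le_trans (_ : _ <= Num.max (2 * x0) (2 / x0)))//.
      by rewrite le_max lexx orbT.
    by rewrite lerDl.
  have [del del0 Hdel] := H r e r1 e0.
  (* The bound x0 / 4, imposed on h as well, keeps [x - h, x + h] within [x0 / 2, 2 * x0]; the bound
     del * x0 / 4 gives |y / x - 1| < del, since x > x0 / 2. *)
  pose eta := Num.min (x0 / 4) (del * x0 / 4).
  have eta0 : 0 < eta.
    rewrite lt_min; apply/andP; split; first exact: divr_gt0.
    by apply: divr_gt0 => //; exact: mulr_gt0.
  exists eta => // x y Gx Gy; rewrite !lt_min => /andP[xa xb] /andP[ya yb].
  have xl : x0 / 2 < x.
    move: xa; rewrite ltr_norml => /andP[h _]; lra.
  have xlb : 3 / 4 * x0 < x.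
    move: xa; rewrite ltr_norml => /andP[h _]; lra.
  have xu : x < 5 / 4 * x0.
    move: xa; rewrite ltr_norml => /andP[_ h]; lra.
  have yl : 0 < y.
    move: ya; rewrite ltr_norml => /andP[h _]; lra.
  have xp : 0 < x by rewrite (lt_trans _ xl)// divr_gt0.
  have x04 : 0 < x0 / 4 by rewrite divr_gt0.
  apply: (average_close mu' u1 xp e0 Gx Gy yl x04) => h h0 hx.
  rewrite (_ : 2 * h = x + h - (x - h)); last by ring.
  apply: Hdel.
  + rewrite (_ : y / x - 1 = (y - x) / x); last by field; rewrite gt_eqF.
    rewrite normrM normfV (gtr0_norm xp) ltr_pdivrMr//.
    have : `|y - x| < del * x0 / 4 + del * x0 / 4.
      rewrite -(subrKA x0) (le_lt_trans (ler_normD _ _))// ltrD//.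
      by rewrite distrC.
    move/lt_trans; apply.
    rewrite (_ : _ + _ = del * (x0 / 2)); last by field.
    by rewrite ltr_pM2l.
  + rewrite (le_trans r3)//; lra.
  + lra.
  + rewrite (le_trans _ r2)//; lra.
- exact: ae_dense.
- exists M => //; apply: filterS lu => x Gx x0.
  by rewrite MG.
Qed.

Lemma multiplier_representative (m : R -> R[i]) :
  cmeas (m : RT -> _) -> (forall x, normc (m x) = 1) ->
  (forall r e : R, 1 < r -> 0 < e ->
    exists2 del : R, 0 < del & forall lam c d : R, `|lam - 1| < del ->
      r^-1 <= c -> c < d -> d <= r ->
      \int[mu]_(x in `[c, d]) (normc (m (lam * x) - m x) ^+ 2) <= e ^+ 2 * (d - c)) ->
  exists p q : R -> R, [/\ forall x, 0 < x -> {for x, continuous p},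
    forall x, 0 < x -> {for x, continuous q},
    forall x, 0 < x -> p x ^+ 2 + q x ^+ 2 = 1 &
    \forall x \ae mu, 0 < x -> m x = p x +i* q x].
Proof.
move=> mm m1 H.
have aeF : Filter (nbhs (almost_everywhere mu)).
  exact: ae_filter_ringOfSetsType.
(* Common to the real and imaginary parts: a map that respects differences and is bounded by the
   modulus inherits the estimate on averages. *)
have part (h : R[i] -> R) : (forall z w : R[i], h (z - w) = h z - h w) ->
    (forall z : R[i], `|h z| <= normc z) -> measurable_fun setT (h \o m) ->
    exists2 M : R -> R, (forall x, 0 < x -> {for x, continuous M}) &
      \forall x \ae mu, 0 < x -> h (m x) = M x.
  move=> hB hn mh; apply: (continuous_of_average mh) => [x|r e r1 e0].
    by rewrite -(m1 x); exact: hn.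
  have [del del0 Hdel] := H r e r1 e0; exists del => // lam c d l1 rc cd dr.
  apply: le_trans (Hdel lam c d l1 rc cd dr).
  have mlam : cmeas ((fun x => m (lam * x)) : RT -> _).
    by apply: (cmeas_comp (phi := fun x : RT => lam * x : RT)) => //; exact: measurable_funM.
  have b2 x : normc (m (lam * x) - m x) <= 2.
    by rewrite (le_trans (le_normcD _ _))// normcN !m1.
  have b4 x : `|normc (m (lam * x) - m x) ^+ 2| <= 4.
    rewrite ger0_norm ?exprn_ge0 ?normc_ge0//.
    by rewrite (_ : 4 = 2 ^+ 2 :> R) ?lerXn2r ?nnegrE ?normc_ge0// -natrX.
  have hle x : (h (m (lam * x)) - h (m x)) ^+ 2 <= normc (m (lam * x) - m x) ^+ 2.
    rewrite -hB -[leLHS]real_normK ?num_real//.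
    by rewrite lerXn2r ?nnegrE ?normc_ge0.
  have i1 : mu.-integrable `[c, d] (EFin \o (fun x => normc (m (lam * x) - m x) ^+ 2)).
    apply: (bounded_integrable_itv (C := 4)) => //.
    by apply: measurable_normc2; exact: cmeasB.
  apply: le_Rintegral => //.
  apply: (bounded_integrable_itv (C := 4)) => [|x].
    apply: measurable_funX; apply: measurable_funB => //.
    by apply: (measurableT_comp mh); exact: measurable_funM.
  rewrite ger0_norm ?sqr_ge0// (le_trans (hle x))//.
  by rewrite -[leLHS]ger0_norm ?exprn_ge0 ?normc_ge0.
  by move=> x _; exact: hle.
have ReB (z w : R[i]) : Re (z - w) = Re z - Re w by rewrite cReD cReN.
have ImB (z w : R[i]) : Im (z - w) = Im z - Im w by rewrite cImD cImN.
have [p cp mp] := part _ ReB (@normc_Re R) mm.1.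
have [q cq mq] := part _ ImB (@normc_Im R) mm.2.
have mpq : \forall x \ae mu, 0 < x -> m x = p x +i* q x.
  move: mp mq; apply: filterS2 => x E1 E2 x0.
  by apply: complexP; rewrite /= ?E1 ?E2.
exists p, q; split => //.
(* The modulus 1 of m passes to p and q almost everywhere, then everywhere on (0, oo) by
   continuity. *)
apply: ae_cont_eq => [x x0|x x0|].
- by apply: cvgD; (rewrite expr2; under eq_fun do rewrite expr2; apply: cvgM); [exact: cp|exact: cp|exact: cq|exact: cq].
- exact: cvg_cst.
- apply: filterS mpq => x + x0 => /(_ x0) E.
  by have := m1 x; rewrite E => /(congr1 (fun t => t ^+ 2)); rewrite normc2E expr1n.
Qed.

End multiplier_representative.

(** * Lifting a curve on the unit circle to a phase *)

Section circle_lifting.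
Variable R : realType.
Implicit Types (f p q th g : R -> R).

(** Only x is confined to the interval, so that of two consecutive nodes of a subdivision just the
    first has to be located. *)
Lemma continuous_compact_unif f (N e : R) : continuous f -> 0 < e ->
  exists2 del : R, 0 < del &
    forall x y, `|x| <= N -> `|y - x| < del -> `|f y - f x| <= e.
Proof.
move=> cf e0.
have cK : compact (`[- N, N]%classic : set R) by exact: segment_compact.
suff NK : \forall del \near (0 : R)^'+, `[- N, N]%classic `<=`
    (fun x => forall y, `|y - x| < del -> `|f y - f x| <= e).
  have [del [Hdel del0]] := filter_ex (filterI NK (nbhs_right_gt (0 : R))).
  exists del => // x y xN; apply: Hdel.
  by rewrite /= in_itv/= -ler_norml.
move/compact_near_coveringP : cK; apply => x _.
have e2 : 0 < e / 2 by rewrite divr_gt0.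
have := cf x => /cvgrPdist_le /(_ _ e2) /nbhs_ballP[d /= d0 Hd].
have d2 : 0 < d / 2 by rewrite divr_gt0.
exists (ball x (d / 2), [set t | t < d / 2]) => /=.
  split; first exact: nbhsx_ballx.
  exact: nbhs_right_lt.
move=> [z t] /= [xz td] y yz.
have hz : `|f x - f z| <= e / 2.
  apply: Hd; rewrite /ball/=; apply: lt_trans xz _.
  by rewrite ltr_pdivrMr// ltr_pMr// ltr1n.
have hy : `|f x - f y| <= e / 2.
  apply: Hd; rewrite /ball/= -(subrKA z) (le_lt_trans (ler_normD _ _))//.
  rewrite [ltRHS](_ : d = d / 2 + d / 2); last by field.
  by rewrite ltrD// distrC (lt_trans yz).
rewrite (_ : f y - f z = (f x - f z) - (f x - f y)); last by ring.
rewrite (le_trans (ler_normB _ _))// [leRHS](_ : e = e / 2 + e / 2); last by field.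
exact: lerD.
Qed.

Lemma angle_exists (a b : R) : a ^+ 2 + b ^+ 2 = 1 ->
  exists t : R, cos t = a /\ sin t = b.
Proof.
move=> ab.
have b1 : -1 <= b <= 1 by rewrite -ler_norml -(@ler_pXn2r _ 2)// ?nnegrE// real_normK ?num_real// expr1n -ab lerDr sqr_ge0.
have ca : cos (asin b) = `|a|.
  by rewrite cos_asin// -sqrtr_sqr; congr Num.sqrt; rewrite -ab addrK.
have sb : sin (asin b) = b by apply: asinK; rewrite in_itv.
have [a0|a0] := leP 0 a.
  by exists (asin b); rewrite ca sb ger0_norm.
exists (pi - asin b); rewrite cosB sinB cospi sinpi ca sb ltr0_norm//.
by split; ring.
Qed.

Lemma cos_lt1 (v : R) : 0 < v -> v < pi -> cos v < 1.
Proof.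
move=> v0 vp; rewrite lt_neqAle cos_le1 andbT; apply/eqP => c1.
have : v = 0.
  apply: (@cos_inj R); rewrite ?in_itv/=; last by rewrite c1 cos0.
    by rewrite (ltW v0) (ltW vp).
  by rewrite lexx pi_ge0.
by move=> E; rewrite E ltxx in v0.
Qed.

(** A nonzero value g t would, by the intermediate value theorem on the segment from 0 to t, force a
    value of modulus strictly between 0 and pi, where the cosine is below 1. The restriction |t| < N
    serves the comparison of lifts defined on bounded intervals. *)
Lemma circle_trivial_lift g (N : R) : g 0 = 0 ->
  (forall t : R, `|t| < N -> {for t, continuous g}) ->
  (forall t : R, `|t| < N -> cos (g t) = 1) -> forall t : R, `|t| < N -> g t = 0.
Proof.
move=> g0 cg g1 t tN; apply: contrapT => /eqP gt0.
pose h x := g (t * x).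
have ch : {within `[0, 1], continuous h}.
  apply: continuous_in_subspaceT => x /[!inE]/= /[!in_itv]/= /andP[x0 x1].
  apply: (continuous_comp (f := fun x => t * x) (g := g)); first exact: mulrl_continuous.
  apply: cg; rewrite normrM (le_lt_trans _ tN)// ler_piMr//.
  by rewrite ger0_norm.
have main (v : R) : 0 < `|v| -> `|v| < pi ->
    Num.min (h 0) (h 1) <= v <= Num.max (h 0) (h 1) -> False.
  move=> v0 vp vb; have [c] := IVT ler01 ch vb.
  rewrite in_itv/= => /andP[c0 c1] hc.
  have := g1 (t * c); rewrite -/(h c) hc => H.
  have cv : cos `|v| = 1.
    have -> : cos `|v| = cos v by case: (ger0P v) => // _; rewrite cosN.
    apply: H; rewrite normrM (le_lt_trans _ tN)// ler_piMr//.
    by rewrite ger0_norm.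
  by have := cos_lt1 v0 vp; rewrite cv ltxx.
have h0 : h 0 = 0 by rewrite /h mulr0.
have h1 : h 1 = g t by rewrite /h mulr1.
pose v0 : R := Num.min `|g t| (pi / 2).
have pi2 : 0 < pi / 2 :> R by rewrite divr_gt0 ?pi_gt0.
have v0p : 0 < v0 by rewrite /v0 lt_min normr_gt0 gt0.
have v0pi : v0 < pi.
  rewrite /v0 gt_min; apply/orP; right.
  by rewrite ltr_pdivrMr// ltr_pMr ?pi_gt0// ltr1n.
have v0g : v0 <= `|g t| by rewrite /v0 ge_min lexx.
have [gp|gn] := leP 0 (g t).
  apply: (main v0); rewrite ?(gtr0_norm v0p)// h0 h1.
  rewrite (min_idPl gp) (max_idPr gp) (ltW v0p)/=.
  by rewrite -(ger0_norm gp).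
apply: (main (- v0)); rewrite ?normrN ?(gtr0_norm v0p)// h0 h1.
rewrite (min_idPr (ltW gn)) (max_idPl (ltW gn)) oppr_le0 (ltW v0p) andbT.
by rewrite lerNr -(ltr0_norm gn).
Qed.

Lemma circle_const_lift g : continuous g -> (forall t, cos (g t) = 1) ->
  (forall t, sin (g t) = 0) -> forall t, g t = g 0.
Proof.
move=> cg g1 g0 t; apply/eqP; rewrite -subr_eq0; apply/eqP.
apply: (@circle_trivial_lift (fun t => g t - g 0) (`|t| + 1)) => [|s _|s _|].
- by rewrite subrr.
- by apply: cvgB; [exact: cg|exact: cvg_cst].
- by rewrite cosB !g1 !g0 mulr0 addr0 mulr1.
- by rewrite ltrDl.
Qed.

Lemma circle_lift_on p q (t0 : R) (N : nat) : continuous p -> continuous q ->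
  (forall t, p t ^+ 2 + q t ^+ 2 = 1) -> cos t0 = p 0 -> sin t0 = q 0 ->
  exists th, [/\ th 0 = t0, (forall t : R, `|t| < N%:R -> {for t, continuous th}) &
    forall t, `|t| < N%:R -> cos (th t) = p t /\ sin (th t) = q t].
Proof.
move=> cp cq pq ct0 st0.
have e0 : 0 < (4^-1 : R) by rewrite invr_gt0.
have [d1 d10 H1] := continuous_compact_unif N%:R cp e0.
have [d2 d20 H2] := continuous_compact_unif N%:R cq e0.
have dm0 : 0 < Num.min d1 d2 by rewrite lt_min d10.
pose K := (Num.truncn (N%:R / Num.min d1 d2)).+1.
have K0 : 0 < K%:R :> R by rewrite ltr0n.
have KN : N%:R / K%:R < Num.min d1 d2.
  by rewrite ltr_pdivrMr// mulrC -ltr_pdivrMr//; exact: Num.Theory.truncnS_gt.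
(* The nodes divide the segment from 0 to t into K equal pieces with K independent of t, so that the
   sum of angles below is continuous in t. The number [dR] + i [dI] is the quotient of p + i q at
   two consecutive nodes. *)
pose x (t : R) (k : nat) : R := k%:R * t / K%:R.
pose dI t k := q (x t k.+1) * p (x t k) - p (x t k.+1) * q (x t k).
pose dR t k := p (x t k.+1) * p (x t k) + q (x t k.+1) * q (x t k).
have dRI t k : dR t k ^+ 2 + dI t k ^+ 2 = 1.
  rewrite /dR /dI; have := pq (x t k); have := pq (x t k.+1).
  move: (p _) (p _) (q _) (q _) => a b c d E1 E2.
  rewrite (_ : _ + _ = (a ^+ 2 + c ^+ 2) * (b ^+ 2 + d ^+ 2)); last by ring.
  by rewrite E1 E2 mulr1.
have dRp t k : `|t| < N%:R -> (k < K)%N -> 0 < dR t k.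
  move=> tN kK.
  have xk : `|x t k| <= N%:R.
    rewrite /x !normrM normfV !normr_nat ler_pdivrMr// (le_trans (ler_wpM2l _ (ltW tN)))//.
    by rewrite mulrC ler_wpM2l// ler_nat ltnW.
  have xx : `|x t k.+1 - x t k| < Num.min d1 d2.
    rewrite (_ : _ - _ = t / K%:R); last by rewrite /x -natr1; field; rewrite gt_eqF.
    rewrite normrM normfV normr_nat (le_lt_trans _ KN)//.
    by rewrite ler_wpM2r ?invr_ge0 ?ler0n// ltW.
  move: xx; rewrite lt_min => /andP[x1 x2].
  (* [dR] is 1 minus half the squared chord between two points of the circle, and both components of
     the chord are at most 1 / 4. *)
  have := H1 _ _ xk x1; have := H2 _ _ xk x2; have := pq (x t k); have := pq (x t k.+1).
  rewrite /dR; move: (p _) (p _) (q _) (q _) => a b c d E1 E2.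
  rewrite !ler_norml => /andP[u1 u2] /andP[v1 v2]; nra.
have dI1 t k : `|t| < N%:R -> (k < K)%N -> -1 < dI t k < 1.
  move=> tN kK; have := dRp t k tN kK; have := dRI t k.
  move: (dR t k) (dI t k) => a b E a0; apply/andP; split; nra.
(* The arc from 0 to t is cut into K pieces along which (p, q) turns by less
   than a right angle, whose sine is dI t k. *)
pose S t j := t0 + \sum_(k < j) asin (dI t k).
have Sj t : `|t| < N%:R -> forall j, (j <= K)%N ->
    cos (S t j) = p (x t j) /\ sin (S t j) = q (x t j).
  move=> tN; elim=> [_|j IHj jK].
    by rewrite /S big_ord0 addr0 /x mul0r mul0r.
  have [IH1 IH2] := IHj (ltnW jK).
  rewrite /S big_ord_recr/= addrA -/(S t j).
  have b1 := dI1 t j tN jK.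
  have b1' : -1 <= dI t j <= 1 by case/andP : b1 => ? ?; rewrite !ltW.
  have sa : sin (asin (dI t j)) = dI t j by apply: asinK; rewrite in_itv.
  have ca : cos (asin (dI t j)) = dR t j.
    rewrite cos_asin// (_ : 1 - _ = dR t j ^+ 2); last by rewrite -(dRI t j); ring.
    by rewrite sqrtr_sqr gtr0_norm// dRp.
  rewrite (cosD (S t j)) (sinD (S t j)) sa ca IH1 IH2 /dI /dR.
  have := pq (x t j).
  move: (p (x t j)) (q (x t j)) (p (x t j.+1)) (q (x t j.+1)) => a b c d E.
  split.
  - transitivity (c * (a ^+ 2 + b ^+ 2)); last by rewrite E mulr1.
    by ring.
  - transitivity (d * (a ^+ 2 + b ^+ 2)); last by rewrite E mulr1.
    by ring.
exists (S ^~ K); split.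
- rewrite /S big1 ?addr0// => k _.
  rewrite (_ : dI 0 k = 0); last by rewrite /dI /x !mulr0 !mul0r mulrC subrr.
  by rewrite -[X in asin X]sin0 sinK// in_itv/= oppr_le0 divr_ge0 ?pi_ge0.
- move=> t tN; rewrite /S; apply: cvgD; first exact: cvg_cst.
  apply: cvg_big => [|k _]; first exact: add_continuous.
  apply: (continuous_comp (f := fun t => dI t k) (g := @asin R)).
    have cx j : continuous (fun u : R => x u j).
      move=> s; apply: cvgMl; exact: mulrl_continuous.
    have cc (h : R -> R) j : continuous h -> {for t, continuous (fun t => h (x t j))}.
      move=> ch.
      exact: (@continuous_comp _ _ _ (fun u => x u j) h t (cx j t) (ch (x t j))).
    by apply: cvgB; apply: cvgM; exact: cc.
  by apply: continuous_asin; exact: dI1.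
- move=> t tN; have [E1 E2] := Sj t tN K (leqnn K).
  by rewrite E1 E2 (_ : x t K = t)// /x mulrAC divff ?mul1r// gt_eqF.
Qed.

(** Lifts on the intervals (-N, N) that share the value t0 at 0 agree where both are defined, by
    [circle_trivial_lift] applied to their difference, and so they glue. *)
Lemma circle_lift p q : continuous p -> continuous q ->
  (forall t, p t ^+ 2 + q t ^+ 2 = 1) ->
  exists2 th, continuous th & forall t, cos (th t) = p t /\ sin (th t) = q t.
Proof.
move=> cp cq pq.
have [t0 [ct0 st0]] := angle_exists (pq 0).
have [th Hth] := choice (fun N => @circle_lift_on p q t0 N cp cq pq ct0 st0).
have uni (M N : nat) (t : R) : (M <= N)%N -> `|t| < M%:R -> th N t = th M t.
  move=> MN tM.
  have lift (s : R) : `|s| < M%:R -> `|s| < N%:R.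
    by move=> sM; rewrite (lt_le_trans sM)// ler_nat.
  have [M0 cM HM] := Hth M; have [N0 cN HN] := Hth N.
  apply/eqP; rewrite -subr_eq0; apply/eqP.
  apply: (@circle_trivial_lift (fun s => th N s - th M s) M%:R) => [|s sM|s sM|//].
  - by rewrite M0 N0 subrr.
  - by apply: cvgB; [apply: cN; exact: lift|exact: cM].
  - have [c1 s1] := HM s sM; have [c2 s2] := HN s (lift s sM).
    by rewrite cosB c1 s1 c2 s2 -!expr2.
pose n (t : R) := (Num.truncn `|t|).+1.
have nt (t : R) : `|t| < (n t)%:R by exact: Num.Theory.truncnS_gt.
exists (fun t => th (n t) t) => [t|t]; last by have [_ _ H] := Hth (n t); exact: H.
have tn1 : `|t| < (n t).+1%:R by rewrite (lt_le_trans (nt t))// ler_nat.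
(* Points s near t may have index n t + 1, so continuity at t is read on the lift of that index. *)
have E : \forall s \near t, th (n t).+1 s = th (n s) s.
  have : \forall s \near t, ball t 1 s by exact: nbhsx_ballx.
  apply: filterS => s; rewrite /ball/= => ts.
  have sn : (n s <= (n t).+1)%N.
    rewrite /n Num.Theory.truncn_lt_nat// -natr1.
    rewrite -(subrK t s) (le_lt_trans (ler_normD _ _))//.
    by rewrite addrC ltrD// distrC.
  by rewrite (uni _ _ _ sn).
rewrite /continuous_at -(uni _ _ _ (leqnSn (n t)) (nt t)).
have [_ c _] := Hth (n t).+1.
by apply: cvg_trans (c t tn1); exact: near_eq_cvg.
Qed.

End circle_lifting.

(** * The doubling and tripling equations *)

Section functional_equation.
Variable R : realType.
Implicit Types (f th phi : R -> R) (s t A B : R).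

Definition period f s := forall t, f (t + s) = f t.

Lemma periodN f s : period f s -> period f (- s).
Proof. by move=> fs t; rewrite -[LHS]fs subrK. Qed.

Lemma periodD f s t : period f s -> period f t -> period f (s + t).
Proof. by move=> fs ft x; rewrite addrA ft fs. Qed.

Lemma periodMz f s (k : int) : period f s -> period f (k%:~R * s).
Proof.
move=> fs; have nat_period (n : nat) : period f (n%:R * s).
  elim: n => [|n IHn]; first by move=> t; rewrite mul0r addr0.
  by rewrite -natr1 mulrDl mul1r; exact: periodD.
case: k => n; first exact: nat_period.
rewrite NegzE mulrNz mulNr; exact: (periodN (nat_period n.+1)).
Qed.

Lemma floor_rem t s : 0 < s -> 0 <= t - (Num.floor (t / s))%:~R * s < s.
Proof.
move=> s0; have /andP[f1 f2] := Num.Theory.floor_itv (t / s).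
move: f1 f2; rewrite ler_pdivlMr// ltr_pdivrMr// intrD mulrDl mul1r => f1 f2.
by rewrite subr_ge0 f1 ltrBlDl.
Qed.

(** A multiple of the period s, where f takes the value f 0, lies within s of t; continuity at t
    concludes. *)
Lemma small_periods_const f : continuous f ->
  (forall e, 0 < e -> exists s, [/\ 0 < s, s < e & period f s]) ->
  forall t, f t = f 0.
Proof.
move=> cf sp t; apply/eqP; rewrite -subr_eq0 -normr_eq0; apply/eqP.
apply/le_anti/andP; split; last exact: normr_ge0.
apply/ler_addgt0Pr => e e0; rewrite add0r.
have := cf t => /cvgrPdist_le /(_ _ e0) /nbhs_ballP[d /= d0 Hd].
have [s [s0 sd fs]] := sp d d0.
have /andP[r0 rs] := floor_rem t s0.
have /(_ 0) := periodMz (Num.floor (t / s)) fs; rewrite add0r => <-.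
apply: Hd; rewrite /ball/= ger0_norm//; exact: lt_trans sd.
Qed.

Lemma periodic_bounded f A : continuous f -> A != 0 -> period f A ->
  exists C, forall t, `|f t| <= C.
Proof.
move=> cf; wlog A0 : A / 0 < A => [WL Ane fA|_ fA].
  have [An|] := ltP A 0.
    by apply: (WL (- A)); rewrite ?oppr_gt0 ?oppr_eq0//; exact: periodN.
  by rewrite le_eqVlt eq_sym (negPf Ane)/= => Ap; exact: (WL A).
have cn : {within `[0, A], continuous (fun t => `|f t|)}.
  apply: continuous_subspaceT => x.
  exact: (@continuous_comp _ _ _ f (fun y => `|y|) x (cf x) (@norm_continuous _ _ (f x))).
have [c _ Hc] := EVT_max (ltW A0) cn.
exists `|f c| => t; have /andP[r0 rs] := floor_rem t A0.
have := periodMz (- Num.floor (t / A)) fA t; rewrite mulrNz mulNr => <-.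
by apply: Hc; rewrite in_itv/= r0 ltW.
Qed.

(** Since c |f u| is again a value of |f|, the supremum of |f| is at most itself divided by c, hence
    0. *)
Lemma bounded_expanding f s c (C : R) : (forall t, `|f t| <= C) -> 1 < c ->
  (forall t, f (t + s) = c * f t) -> forall t, f t = 0.
Proof.
move=> fC c1 fs t.
pose E := range (fun t => `|f t|).
have ubE : has_ubound E by exists C => _ [u _ <-].
have fE u : `|f u| <= sup E by apply: ub_le_sup => //; exists u.
have supE : sup E <= sup E / c.
  apply: ge_sup; first by exists `|f 0|; exists 0.
  move=> _ [u _ <-]; rewrite ler_pdivlMr ?(lt_trans ltr01)// mulrC.
  by rewrite -(ger0_norm (ltW (lt_trans ltr01 c1))) -normrM -fs.
have sup0 : sup E <= 0.
  move: supE; rewrite ler_pdivlMr ?(lt_trans ltr01)// => H.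
  rewrite leNgt; apply/negP => S0; move: H; rewrite leNgt => /negP; apply.
  by rewrite ltr_pMr.
by apply/eqP; rewrite -normr_eq0 eq_le normr_ge0 (le_trans (fE t)).
Qed.

(** A subgroup of the line is dense or cyclic, here for the subgroup generated by A and B; the
    infimum of its positive elements tells the two cases apart. *)
Lemma period_dichotomy A B : A != 0 ->
  (forall e, 0 < e -> exists s (k l : int),
     [/\ 0 < s, s < e & s = k%:~R * A + l%:~R * B]) \/
  (exists s (m n : int), A = m%:~R * s /\ B = n%:~R * s).
Proof.
move=> A0.
pose G := [set s : R | 0 < s /\ exists k l : int, s = k%:~R * A + l%:~R * B].
have GB s s' (k : int) : G s -> (exists k l : int, s' = k%:~R * A + l%:~R * B) ->
    0 < s' - k%:~R * s -> G (s' - k%:~R * s).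
  move=> [_ [a [b ->]]] [c [d ->]] H; split => //.
  by exists (c - k * a), (d - k * b); rewrite !intrB !intrM; ring.
have lbG : has_lbound G by exists 0 => s [/ltW].
have G0 : G !=set0.
  exists `|A|; split; first by rewrite normr_gt0.
  case: (ger0P A) => _; first by exists 1, 0; rewrite mul1r mul0r addr0.
  by exists (-1), 0; rewrite mulN1r mul0r addr0.
have infG s : G s -> inf G <= s by move=> Gs; apply: ge_inf.
have [i0|i0] := leP (inf G) 0; [left=> e e0|right].
  have [s [s0 [k [l skl]]] se] := inf_adherent e0 (conj G0 lbG).
  exists s, k, l; split => //; apply: (lt_le_trans se).
  by rewrite gerDr.
(* With s below twice the infimum, a positive remainder r < s and its complement s - r would both
   belong to G, and one of them would be below the infimum; so every element of the subgroup is a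
   multiple of s. *)
have [s Gs s2] := inf_adherent i0 (conj G0 lbG).
have s0 : 0 < s by case: Gs.
have mult g : (exists k l : int, g = k%:~R * A + l%:~R * B) ->
    exists n : int, g = n%:~R * s.
  move=> Hg; exists (Num.floor (g / s)).
  have /andP[r0 rs] := floor_rem g s0.
  apply/eqP; rewrite -subr_eq0; apply/negPn/negP => rn0.
  have rp : 0 < g - (Num.floor (g / s))%:~R * s by rewrite lt_neqAle eq_sym rn0.
  have Gr := GB s g _ Gs Hg rp.
  have := infG _ Gr; set r := g - _ in Gr rp r0 rs *.
  have Gsr : G (s - 1%:~R * r).
    apply: GB => //; first by case: Gs.
    by rewrite mul1r subr_gt0.
  have := infG _ Gsr; rewrite mul1r; lra.
have [m Am] : exists n : int, A = n%:~R * s.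
  by apply: mult; exists 1, 0; rewrite mul1r mul0r addr0.
have [n Bn] : exists n : int, B = n%:~R * s.
  by apply: mult; exists 0, 1; rewrite mul1r mul0r add0r.
by exists s, m, n.
Qed.

(** Exponentiating gives 2^|n| = 3^|m|, and the right side is odd, so n = 0. *)
Lemma ln2_ln3_independent (m n : int) :
  n%:~R * ln 2 = m%:~R * ln 3 :> R -> m = 0.
Proof.
move=> E.
have l2 : 0 < ln (2 : R) by rewrite ln_gt0// ltr1n.
have l3 : 0 < ln (3 : R) by rewrite ln_gt0// ltr1n.
have : `|n|%N%:R * ln 2 = `|m|%N%:R * ln 3 :> R.
  have := congr1 (fun x : R => `|x|) E.
  by rewrite !normrM (gtr0_norm l2) (gtr0_norm l3) -!intr_norm -!natr_absz.
rewrite !mulr_natl -!lnXn//; move/ln_inj.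
rewrite !posrE !exprn_gt0// => /(_ isT isT) /eqP.
rewrite -!natrX eqr_nat => /eqP/(congr1 odd).
rewrite !oddX/= orbF orbT => /eqP n0.
have := E; rewrite (_ : n = 0); last by apply/eqP; rewrite -absz_eq0 n0.
rewrite mul0r => /esym/eqP; rewrite mulf_eq0 (gt_eqF l3) orbF intr_eq0.
by move/eqP.
Qed.

Lemma scaling_solution phi A B : continuous phi ->
  (forall t, phi (t + A) = 2 * phi t) -> (forall t, phi (t + B) = 3 * phi t) ->
  exists al be : R, forall t, phi t = be * expR (al * t).
Proof.
move=> cphi phiA phiB.
have [[t0 pt0]|] := pselect (exists t, phi t != 0); last first.
  move=> H; exists 0, 0 => t; rewrite mul0r; apply/eqP/negPn/negP => h.
  by apply: H; exists t.
have A0 : A != 0.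
  apply/eqP => A0; have := phiA t0; rewrite A0 addr0 => /eqP.
  rewrite -subr_eq0 (_ : phi t0 - 2 * phi t0 = - phi t0); last by ring.
  by rewrite oppr_eq0 (negPf pt0).
have B0 : B != 0.
  apply/eqP => B0; have := phiB t0; rewrite B0 addr0 => /eqP.
  rewrite -subr_eq0 (_ : phi t0 - 3 * phi t0 = - 2 * phi t0); last by ring.
  by rewrite mulf_eq0 oppr_eq0 pnatr_eq0 (negPf pt0).
pose al := ln 2 / A.
pose psi t := phi t * expR (- (al * t)).
have cpsi : continuous psi.
  move=> t; apply: cvgM; first exact: cphi.
  apply: (continuous_comp (f := fun t : R => - (al * t)) (g := @expR R)).
    by apply: cvgN; exact: mulrl_continuous.
  exact: continuous_expR.
have psiD t : expR (- (al * (t + A))) = expR (- (al * t)) / 2.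
  rewrite mulrDr opprD expRD; congr (_ * _).
  by rewrite /al divfK// expRN lnK// posrE.
have pA : period psi A by move=> t; rewrite /psi phiA psiD; field.
have [C HC] := periodic_bounded cpsi A0 pA.
pose c := 3 * expR (- (al * B)).
have c0 : 0 < c by rewrite mulr_gt0// expR_gt0.
have psiB t : psi (t + B) = c * psi t.
  by rewrite /psi phiB mulrDr opprD expRD /c; ring.
have psi0 : psi t0 != 0 by rewrite mulf_neq0// gt_eqF// expR_gt0.
(* psi is bounded and nonzero at t0: c > 1 contradicts this under the shift by B, and c < 1 under
   the shift by - B. *)
have c1 : c = 1.
  apply/le_anti/andP; split; rewrite leNgt; apply/negP => cl.
    by have := bounded_expanding HC cl psiB t0; apply/eqP.
  have cV : 1 < c^-1 by rewrite invf_gt1.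
  have psiBN t : psi (t - B) = c^-1 * psi t.
    by rewrite -{2}(subrK B t) psiB mulKf// gt_eqF.
  by have := bounded_expanding HC cV psiBN t0; apply/eqP.
have pB : period psi B by move=> t; rewrite psiB c1 mul1r.
have alB : al * B = ln 3.
  have : expR (al * B) = 3.
    have := c1; rewrite /c expRN => /(congr1 ( *%R^~ (expR (al * B)))) /=.
    by rewrite mulfVK ?gt_eqF ?expR_gt0// mul1r.
  by move=> <-; rewrite expRK.
have alA : al * A = ln 2 by rewrite /al divfK.
have psic : forall t, psi t = psi 0.
  have [sm|[s [m [n [Am Bn]]]]] := period_dichotomy B A0.
    apply: small_periods_const => // e e0.
    have [s [k [l [s0 se skl]]]] := sm e e0; exists s; split => //.
    by rewrite skl; apply: periodD; exact: periodMz.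
  (* Since al * A = ln 2 and al * B = ln 3, commensurable periods A = m s and B = n s give n ln 2 =
     m ln 3; then m = 0 and A = 0. *)
  exfalso; move/eqP: A0; apply; rewrite Am.
  rewrite (@ln2_ln3_independent m n) ?mul0r// -alA -alB Am Bn; ring.
exists al, (psi 0) => t; rewrite -(psic t) /psi -mulrA -expRD.
by rewrite addNr expR0 mulr1.
Qed.

(** The lift satisfies the two equations only up to additive constants c and d in 2 pi Z. Since d =
    2 c, the function th + c satisfies both exactly, and it has the same exponential as th because
    [cexpi c] is 1. *)
Lemma circle_functional_equation th A B : continuous th ->
  (forall t, cexpi (th (t + A)) = cexpi (th t) ^+ 2) ->
  (forall t, cexpi (th (t + B)) = cexpi (th t) ^+ 3) ->
  exists al be : R, forall t, cexpi (th t) = cexpi (be * expR (al * t)).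
Proof.
move=> cth thA thB.
have const (s : R) (n : nat) : (forall t, cexpi (th (t + s)) = cexpi (th t) ^+ n) ->
    exists2 c, cexpi c = 1 & forall t, th (t + s) = th t *+ n + c.
  move=> ths; pose g t := th (t + s) - n%:R * th t.
  have g1 t : cexpi (g t) = 1.
    rewrite /g mulr_natl cexpiD ths -cexpiMn -cexpiD subrr; exact: cexpi0.
  have cg : continuous g.
    move=> t; apply: cvgB.
      apply: (continuous_comp (f := fun t : R => t + s) (g := th)); last exact: cth.
      by apply: cvgD; [exact: cvg_id|exact: cvg_cst].
    by apply: cvgMr; exact: cth.
  exists (g 0); first exact: g1.
  move=> t; rewrite -(circle_const_lift cg _ _ t) => [|u|u].
  - by rewrite /g mulr_natl [RHS]addrC subrK.
  - by have /(congr1 (@complex.Re R)) := g1 u.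
  - by have /(congr1 (@complex.Im R)) := g1 u.
have [c c1 thAc] := const A 2 thA; have [d d1 thBd] := const B 3 thB.
(* Both sides of th (A + B) = th (B + A). *)
have dc : d = 2 * c.
  have := thAc B; have := thBd A; have := thBd 0; have := thAc 0.
  rewrite !add0r (addrC B) => -> -> ->; lra.
have [|||al [be H]] := @scaling_solution (fun t => th t + c) A B.
- by move=> t; apply: cvgD; [exact: cth|exact: cvg_cst].
- by move=> t; rewrite thAc; ring.
- by move=> t; rewrite thBd dc; ring.
exists al, be => t; rewrite -H cexpiD c1; exact/esym/mulr1.
Qed.

End functional_equation.

(** * From the phase to a power, and uniqueness of the power *)

Section power_form.
Variable R : realType.
Local Notation mu := (@lebesgue_measure R).

Lemma cX2E (x y : R) : (x +i* y) ^+ 2 = (x ^+ 2 - y ^+ 2) +i* (2 * x * y).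
Proof. by rewrite expr2; simpc; congr (_ +i* _); ring. Qed.

Lemma cX3E (x y : R) : (x +i* y) ^+ 3 =
  (x ^+ 3 - 3 * x * y ^+ 2) +i* (3 * x ^+ 2 * y - y ^+ 3).
Proof. by rewrite exprS cX2E; simpc; congr (_ +i* _); ring. Qed.

Lemma continuous_scaler (f : R -> R) (s : R) : 0 < s ->
  (forall x, 0 < x -> {for x, continuous f}) ->
  forall x, 0 < x -> {for x, continuous (fun x => f (s * x))}.
Proof.
move=> s0 cf x x0.
apply: (@continuous_comp _ _ _ (fun x : R => s * x) f); first exact: mulrl_continuous.
by apply: cf; exact: mulr_gt0.
Qed.

(** The equations for m hold almost everywhere; for the continuous p and q they hold at every x > 0,
    obtained one component at a time because [ae_cont_eq] compares real functions. Only then can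
    they be read on the lift. *)
Lemma power_form (m : R -> R[i]) (p q : R -> R) (a b : R) : 0 < a -> 0 < b ->
  (forall x, 0 < x -> {for x, continuous p}) ->
  (forall x, 0 < x -> {for x, continuous q}) ->
  (forall x, 0 < x -> p x ^+ 2 + q x ^+ 2 = 1) ->
  (\forall x \ae mu, 0 < x -> m x = p x +i* q x) ->
  (\forall x \ae mu, m (a * x) = m x ^+ 2) ->
  (\forall x \ae mu, m (b * x) = m x ^+ 3) ->
  exists al be : R, \forall x \ae mu, 0 < x -> m x = cexpi (be * x `^ al).
Proof.
have aeF : Filter (nbhs (almost_everywhere mu)).
  exact: ae_filter_ringOfSetsType.
move=> a0 b0 cp cq pq mpq ma mb.
have scaled s n : 0 < s -> (\forall x \ae mu, m (s * x) = m x ^+ n) ->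
    \forall x \ae mu, 0 < x -> p (s * x) +i* q (s * x) = (p x +i* q x) ^+ n.
  move=> s0 ms; have := ae_scale (lt0r_neq0 s0) mpq.
  move: ms mpq; apply: filterS3 => x Es Ex Esx x0.
  by rewrite -(Esx (mulr_gt0 s0 x0)) Es (Ex x0).
have ea x : 0 < x -> p (a * x) +i* q (a * x) = (p x +i* q x) ^+ 2.
  move=> x0; rewrite cX2E; congr (_ +i* _).
    move: x x0; apply: ae_cont_eq.
    - exact: continuous_scaler.
    - by move=> x x0; apply: cvgB; apply: cvgM; (exact: cp || exact: cq).
    have := scaled a 2 a0 ma; apply: filterS => x + x0 => /(_ x0).
    by rewrite cX2E => -[].
  move: x x0; apply: ae_cont_eq.
  - exact: continuous_scaler.
  - move=> x x0; apply: cvgM; last exact: cq.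
    by apply: cvgMr; exact: cp.
  have := scaled a 2 a0 ma; apply: filterS => x + x0 => /(_ x0).
  by rewrite cX2E => -[].
have eb x : 0 < x -> p (b * x) +i* q (b * x) = (p x +i* q x) ^+ 3.
  move=> x0; rewrite cX3E; congr (_ +i* _).
    move: x x0; apply: ae_cont_eq.
    - exact: continuous_scaler.
    - move=> x x0; have cpx := cp x x0; have cqx := cq x x0.
      apply: cvgB.
        by apply: cvgM; [exact: cpx|apply: cvgM; exact: cpx].
      by apply: cvgM; [apply: cvgMr; exact: cpx|apply: cvgM; exact: cqx].
    have := scaled b 3 b0 mb; apply: filterS => x + x0 => /(_ x0).
    by rewrite cX3E => -[].
  move: x x0; apply: ae_cont_eq.
  - exact: continuous_scaler.
  - move=> x x0; have cpx := cp x x0; have cqx := cq x x0.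
    apply: cvgB.
      by apply: cvgM; [apply: cvgMr; apply: cvgM; exact: cpx|exact: cqx].
    by apply: cvgM; [exact: cqx|apply: cvgM; exact: cqx].
  have := scaled b 3 b0 mb; apply: filterS => x + x0 => /(_ x0).
  by rewrite cX3E => -[].
have cexp (f : R -> R) : (forall x, 0 < x -> {for x, continuous f}) ->
    continuous (fun t => f (expR t)).
  move=> cf t; apply: (@continuous_comp _ _ _ (@expR R) f); first exact: continuous_expR.
  by apply: cf; exact: expR_gt0.
have [th cth Hth] := circle_lift (cexp p cp) (cexp q cq) (fun t => pq _ (expR_gt0 t)).
have thE t : cexpi (th t) = p (expR t) +i* q (expR t).
  by rewrite /cexpi; have [-> ->] := Hth t.
have thS s n : 0 < s ->
    (forall x, 0 < x -> p (s * x) +i* q (s * x) = (p x +i* q x) ^+ n) ->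
    forall t, cexpi (th (t + ln s)) = cexpi (th t) ^+ n.
  move=> s0 H t; rewrite !thE addrC expRD lnK ?posrE//.
  by apply: H; exact: expR_gt0.
have [al [be H]] := circle_functional_equation cth (thS a 2 a0 ea) (thS b 3 b0 eb).
exists al, be; move: mpq; apply: filterS => x + x0 => /(_ x0) ->.
rewrite /powR gt_eqF// -H thE lnK// posrE//.
Qed.

(** Equal exponentials leave the phases equal modulo 2 pi; in the variable t = ln x their difference
    is continuous with exponential 1, hence equal to its value at t = 0. *)
Lemma power_phase_constant (al be al' be' : R) :
  (\forall x \ae mu, cexpi (be * `|x| `^ al) = cexpi (be' * `|x| `^ al')) ->
  forall t, be * expR (al * t) - be' * expR (al' * t) = be - be'.
Proof.
have aeF : Filter (nbhs (almost_everywhere mu)).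
  exact: ae_filter_ringOfSetsType.
move=> E.
have cpow (c d : R) x : 0 < x -> {for x, continuous (fun x => c * expR (d * ln x))}.
  move=> x0; apply: cvgMr.
  apply: (@continuous_comp _ _ _ (fun x : R => d * ln x) (@expR R)); last exact: continuous_expR.
  by apply: cvgMr; exact: continuous_ln.
have powE (d x : R) : 0 < x -> `|x| `^ d = expR (d * ln x).
  by move=> x0; rewrite gtr0_norm// /powR gt_eqF.
have cosE x : 0 < x -> cos (be * expR (al * ln x)) = cos (be' * expR (al' * ln x)).
  move: x; apply: ae_cont_eq.
  - move=> x x0; apply: (@continuous_comp _ _ _ _ (@cos R)); [exact: cpow|exact: continuous_cos].
  - move=> x x0; apply: (@continuous_comp _ _ _ _ (@cos R)); [exact: cpow|exact: continuous_cos].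
  - by move: E; apply: filterS => x + x0; rewrite !powE// => -[].
have sinE x : 0 < x -> sin (be * expR (al * ln x)) = sin (be' * expR (al' * ln x)).
  move: x; apply: ae_cont_eq.
  - move=> x x0; apply: (@continuous_comp _ _ _ _ (@sin R)); [exact: cpow|exact: continuous_sin].
  - move=> x x0; apply: (@continuous_comp _ _ _ _ (@sin R)); [exact: cpow|exact: continuous_sin].
  - by move: E; apply: filterS => x + x0; rewrite !powE// => -[].
pose g t := be * expR (al * t) - be' * expR (al' * t).
have cg : continuous g.
  move=> t; apply: cvgB; apply: cvgMr.
    by apply: (@continuous_comp _ _ _ (fun t : R => al * t) (@expR R)); [exact: mulrl_continuous|exact: continuous_expR].
  by apply: (@continuous_comp _ _ _ (fun t : R => al' * t) (@expR R)); [exact: mulrl_continuous|exact: continuous_expR].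
have trig t : cos (g t) = 1 /\ sin (g t) = 0.
  have := cosE _ (expR_gt0 t); have := sinE _ (expR_gt0 t); rewrite !expRK.
  rewrite /g cosB sinB => -> ->; split; last by rewrite mulrC subrr.
  by rewrite -!expr2 cos2Dsin2.
have g0 : g 0 = be - be' by rewrite /g !mulr0 expR0 !mulr1.
by move=> t; rewrite -g0; apply: (circle_const_lift cg) => u; case: (trig u).
Qed.

(** The values t = 1 and t = 2 suffice: with u = e^al and v = e^al', dividing be (u^2 - 1) = be'
    (v^2 - 1) by be (u - 1) = be' (v - 1) gives u = v. The divisor is nonzero because al and be
    are. *)
Lemma power_phase_unique (al be al' be' : R) : al != 0 -> be != 0 ->
  (forall t, be * expR (al * t) - be' * expR (al' * t) = be - be') ->
  al = al' /\ be = be'.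
Proof.
move=> al0 be0 H.
pose u := expR al; pose v := expR al'.
have H1 : be * (u - 1) = be' * (v - 1).
  by have := H 1; rewrite !mulr1 -/u -/v; lra.
have H2 : be * (u ^+ 2 - 1) = be' * (v ^+ 2 - 1).
  by have := H 2; rewrite !expRM_natr -/u -/v; lra.
have u1 : be * (u - 1) != 0.
  rewrite mulf_neq0// subr_eq0 -expR0; apply: contra al0 => /eqP/expR_inj ->.
  by [].
have uv : u = v.
  apply: (addIr 1); apply: (mulfI u1); rewrite {2}H1.
  by transitivity (be * (u ^+ 2 - 1)); [ring|rewrite H2; ring].
split; first exact: expR_inj.
by apply: (mulIf (x := u - 1)); [move: u1; rewrite mulf_eq0 negb_or => /andP[]|rewrite H1 uv].
Qed.
End power_form.

(** * Existence and uniqueness of the constants for the operator *)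

Section main.
Local Opaque fourier translate dilate.
Variable R : realType.
Local Notation mu := (@lebesgue_measure R).
Implicit Types (T : L2 R -> L2 R).

(** An operator determines its multiplier almost everywhere, so the two operator identities turn
    into identities between multipliers. *)
Lemma semistable_multiplier T m : semistable T -> is_multiplier T m ->
  exists a b : R, [/\ 0 < a, 0 < b, \forall x \ae mu, m (a * x) = m x ^+ 2 &
    \forall x \ae mu, m (b * x) = m x ^+ 3].
Proof.
have aeF : Filter (nbhs (almost_everywhere mu)).
  exact: ae_filter_ringOfSetsType.
move=> [a [b [a0 b0 Ta Tb]]] Tm; exists a, b; split => //.
- have := multiplier_comp Tm Tm; rewrite Ta => T2.
  have := multiplier_unique (multiplier_dilate (lt0r_neq0 a0) Tm) T2.
  by apply: filterS => x ->; rewrite expr2.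
- have := multiplier_comp (multiplier_comp Tm Tm) Tm; rewrite Tb => T3.
  have := multiplier_unique (multiplier_dilate (lt0r_neq0 b0) Tm) T3.
  by apply: filterS => x ->; rewrite exprSr expr2.
Qed.

Lemma multiplier_even T m : symmetric_op T -> is_multiplier T m ->
  \forall x \ae mu, m (- x) = m x.
Proof.
have aeF : Filter (nbhs (almost_everywhere mu)).
  exact: ae_filter_ringOfSetsType.
move=> symT Tm.
have N1 : (-1 : R) != 0 by rewrite oppr_eq0 oner_neq0.
have := multiplier_dilate N1 Tm; rewrite symT => TN.
by have := multiplier_unique TN Tm; apply: filterS => x; rewrite mulN1r.
Qed.

(** At any point of a full-measure set the doubling equation reads c = c^2, and c is nonzero, so c =
    1. *)
Lemma constant_multiplier_id T (c : R[i]) : semistable T -> normc c = 1 ->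
  is_multiplier T (fun=> c) -> T = id.
Proof.
have aeF : Filter (nbhs (almost_everywhere mu)).
  exact: ae_filter_ringOfSetsType.
move=> ssT c1 Tc; have [a [b [_ _ cc _]]] := semistable_multiplier ssT Tc.
have [_ ccE _] := ae_dense cc 0 ltr01.
have cn0 : c != 0.
  by apply: contra_eq_neq c1 => ->; rewrite normc0 eq_sym oner_neq0.
have {}c1 : c = 1 by apply: (mulfI cn0); rewrite mulr1 -expr2 -ccE.
apply/funext => f; apply: fourier_inj.
by have := Tc f; apply: filterS => x Ex; exact: etrans Ex (etrans (congr1 ( *%R^~ _) c1) (mul1r _)).
Qed.

Lemma has_multiplier_exists T : semistable T -> unitary_op T ->
  translation_invariant T -> symmetric_op T -> LUC T ->
  exists al be : R, has_multiplier T al be.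
Proof.
have aeF : Filter (nbhs (almost_everywhere mu)).
  exact: ae_filter_ringOfSetsType.
move=> ssT uT tiT symT lucT.
have [m [mm m1 Tm]] := multiplier_exists uT tiT.
have [a [b [a0 b0 ma mb]]] := semistable_multiplier ssT Tm.
have [p [q [cp cq pq mpq]]] := multiplier_representative mm m1
  (fun r e r1 e0 => LUC_average lucT mm m1 Tm r1 e0).
have [al [be mE]] := power_form a0 b0 cp cq pq mpq ma mb.
exists al, be.
(* [power_form] describes m on (0, oo); evenness carries the formula to (-oo, 0), and the point 0 is
   negligible. *)
have mall : \forall x \ae mu, m x = cexpi (be * `|x| `^ al).
  have N1 : (-1 : R) != 0 by rewrite oppr_eq0 oner_neq0.
  have ne0 : \forall x \ae mu, (x : R) != 0.
    exists [set 0]; split; [exact: measurable_set1|exact: lebesgue_measure_set1|].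
    by move=> x /= /negP; rewrite negbK => /eqP.
  have mN : \forall x \ae mu, 0 < - x -> m (- x) = cexpi (be * (- x) `^ al).
    by have := ae_scale N1 mE; apply: filterS => x; rewrite mulN1r.
  have mev := multiplier_even symT Tm.
  have : \forall x \ae mu, x != 0 /\ m (- x) = m x by move: ne0 mev; apply: filterS2.
  move: mE mN; apply: filterS3 => x E1 E2 [x0 ev].
  have [xp|xn|x00] := ltrgt0P x.
  - by rewrite E1.
  - by rewrite -ev E2// oppr_gt0.
  - by rewrite x00 eqxx in x0.
move=> f; have := Tm f; move: mall; apply: filterS2 => x E Ex.
exact: etrans Ex (congr1 ( *%R^~ _) E).
Qed.

Lemma has_multiplier_unique T (al be al' be' : R) : semistable T -> T <> id ->
  has_multiplier T al be -> has_multiplier T al' be' -> al = al' /\ be = be'.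
Proof.
move=> ssT Tid H H'.
have phase := power_phase_constant (multiplier_unique H H').
(* al = 0 or be = 0 would make the multiplier constant, which only the identity allows; both are
   therefore nonzero, as [power_phase_unique] requires. *)
have trivial_phase c : (forall x : R, be * `|x| `^ al = c) -> False.
  move=> ce; apply: Tid; apply: (@constant_multiplier_id _ (cexpi c)) => //.
    exact: normc_cexpi.
  by move=> f; have := H f; under [X in X -> _]eq_near do rewrite ce.
apply: power_phase_unique phase; apply/eqP => E0.
- by apply: (trivial_phase be) => x; rewrite E0 powRr0 mulr1.
- by apply: (trivial_phase 0) => x; rewrite E0 mul0r.
Qed.

End main.

Theorem theorem1p1 (R : realType) (T : {linear L2 R -> L2 R}) :
  bounded_op T -> semistable T -> unitary_op T ->
  translation_invariant T -> symmetric_op T -> LUC T ->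
  (exists alpha beta : R, has_multiplier T alpha beta) /\
  ((T : L2 R -> L2 R) <> id ->
   forall alpha beta alpha' beta' : R,
     has_multiplier T alpha beta -> has_multiplier T alpha' beta' ->
     alpha = alpha' /\ beta = beta').
Proof.
move=> _ ssT uT tiT symT lucT; split; first exact: has_multiplier_exists.
by move=> Tid al be al' be'; exact: has_multiplier_unique.
Qed.
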